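(* Let $q\equiv q(t)=t^3+15t^6+279t^9+\cdots$ be the unique power series in $t$ with constant term $0$ satisfying $$t=q^{1/3}\,\frac{T_{1}(1,q^3)}{4T_{0}(q,q^3)+6T_{1}(q,q^3)}.$$ Let $E(t,s)$ be the generating function of walks in the cell-centred Kreweras lattice starting at $w_0$ and ending at one of the (three) vertices closest to the origin $0$, in which each walk of length $n$ and winding angle $\frac{2\pi k}{3}$ contributes $t^n s^k$. Then $$E(t,s)=\frac{s}{(1-s^3)t}\left(s-q^{-1/3}\frac{T_{1}(q^2,q^3)}{T_{1}(1,q^3)}-q^{-1/3}\frac{T_{0}(q,q^3)\,T_{1}(sq^{-2/3},q)}{T_{1}(1,q^3)\,T_{0}(sq^{-2/3},q)}\right).$$
   Context: For $k\ge 0$ define $$T_{k}(u,q)=\sum_{n=0}^{\infty}(-1)^{n}(2n+1)^k q^{n(n+1)/2}\left(u^{n+1}-(-1)^k u^{-n}\right).$$ Cell-centred Kreweras lattice: let $\omega=e^{2\pi i/3}$. It is the oriented triangular lattice in $\mathbb{C}$ whose allowed steps (oriented edges) are $v\to v+1$, $v\to v+\omega$, $v\to v+\omega^2$, positioned so that the origin $0$ is the centre of a triangular cell whose three edges are oriented anticlockwise around $0$. Concretely, the vertex set is $-\frac{2+\omega}{3}+\mathbb{Z}[\omega]$, and the three vertices closest to $0$ are $\frac{1-\omega}{3},\ \omega\frac{1-\omega}{3},\ \omega^2\frac{1-\omega}{3}$. The starting point $w_0$ is one of these three vertices, say $w_0=\frac{1-\omega}{3}$. A walk of length $n$ is a sequence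 of $n$ consecutive allowed steps, viewed as a path of straight segments. The winding angle of a walk is the total anticlockwise angle through which the vector from $0$ to a point moving continuously along the walk turns around $0$. Conventions: $E(t,s)\in\mathbb{Z}[s,s^{-1}][[t]]$; $q^{1/3}$ denotes the cube root of $q(t)$ which is a power series in $t$ with leading term $t$, and $q^{m/3}=(q^{1/3})^m$; the identity holds in the field of formal Laurent series in $t$ with coefficients in $\mathbb{Q}(s)$. *)

(* Defs.v *)
From HB Require Import structures.
From mathcomp Require Import all_boot all_order all_algebra fraction complex.
From mathcomp Require Import boolp classical_sets reals topology normedtype trigo.
Set Implicit Arguments.
Unset Strict Implicit.
Unset Printing Implicit Defensive.
Import Order.TTheory GRing.Theory Num.Theory.
Import numFieldNormedType.Exports.
Local Open Scope ring_scope.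
Local Open Scope complex_scope.
Local Open Scope classical_set_scope.

(* The ring K[[t]], with the Cauchy product; [f n] is the coefficient of t^n
   in [f]. *)
Record powser (K : fieldType) := Powser { coefs :> nat -> K }.

HB.instance Definition _ (K : fieldType) := gen_eqMixin (powser K).
HB.instance Definition _ (K : fieldType) := gen_choiceMixin (powser K).

Section PowserRing.
Variable K : fieldType.
Implicit Types f g h : powser K.

Lemma powserP f g : (forall n, f n = g n) -> f = g.
Proof.
by case: f g => [f] [g] /= fg; congr Powser; apply/funext => n; apply: fg.
Qed.

Definition ps_const (c : K) : powser K := Powser (fun n => c *+ (n == 0)%N).
Definition ps_var : powser K := Powser (fun n => (n == 1)%N%:R).
Definition ps_add f g := Powser (fun n => f n + g n).
Definition ps_opp f := Powser (fun n => - f n).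
Definition ps_mul f g := Powser (fun n => \sum_(i < n.+1) f i * g (n - i)%N).

Definition ps_trunc N f : {poly K} := \poly_(i < N) f i.

Lemma ps_mul_coef N f g n : (n < N)%N ->
  ps_mul f g n = (ps_trunc N f * ps_trunc N g)`_n.
Proof.
move=> nN; rewrite coefM /=; apply: eq_bigr => i _; rewrite !coef_poly.
by rewrite (leq_ltn_trans (leq_ord i) nN) (leq_ltn_trans (leq_subr i n) nN).
Qed.

Lemma ps_addA : associative ps_add.
Proof. by move=> f g h; apply: powserP => n /=; rewrite addrA. Qed.
Lemma ps_addC : commutative ps_add.
Proof. by move=> f g; apply: powserP => n /=; rewrite addrC. Qed.
Lemma ps_add0 : left_id (ps_const 0) ps_add.
Proof. by move=> f; apply: powserP => n /=; rewrite mul0rn add0r. Qed.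
Lemma ps_addN : left_inverse (ps_const 0) ps_opp ps_add.
Proof. by move=> f; apply: powserP => n /=; rewrite addNr mul0rn. Qed.

HB.instance Definition _ :=
  GRing.isZmodule.Build (powser K) ps_addA ps_addC ps_add0 ps_addN.

Lemma ps_mulC : commutative ps_mul.
Proof.
by move=> f g; apply: powserP => n; rewrite !(ps_mul_coef _ _ (leqnn n.+1)) mulrC.
Qed.

Lemma ps_mulA : associative ps_mul.
Proof.
move=> f g h; apply: powserP => n; pose N := n.+1.
have nN : (n < N)%N by [].
have E a b i : (i <= n)%N ->
    (ps_trunc N (ps_mul a b))`_i = (ps_trunc N a * ps_trunc N b)`_i.
  by move=> le_in; rewrite coef_poly ltnS le_in -ps_mul_coef ?ltnS.
rewrite !(ps_mul_coef _ _ nN).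
transitivity (ps_trunc N f * (ps_trunc N g * ps_trunc N h))`_n.
  rewrite !coefM; apply: eq_bigr => i _; rewrite E ?leq_subr //.
rewrite mulrA !coefM; apply: eq_bigr => i _; rewrite E ?leq_ord //.
Qed.

Lemma ps_mul1 : left_id (ps_const 1) ps_mul.
Proof.
move=> f; apply: powserP => n /=.
rewrite big_ord_recl /= subn0 mul1r big1 ?addr0 // => i _.
by rewrite mulr0n mul0r.
Qed.

Lemma ps_mulDl : left_distributive ps_mul ps_add.
Proof.
move=> f g h; apply: powserP => n /=; rewrite -big_split /=.
by apply: eq_bigr => i _; rewrite mulrDl.
Qed.

Lemma ps_1neq0 : ps_const 1 != 0.
Proof.
apply/eqP => /(congr1 (fun f : powser K => f 0%N)) /= /eqP.
by rewrite ?mulr0n ?mulr1n oner_eq0.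
Qed.

HB.instance Definition _ := GRing.Zmodule_isComNzRing.Build (powser K)
  ps_mulA ps_mulC ps_mul1 ps_mulDl ps_1neq0.

Definition ps_unit : pred (powser K) := fun f => `[< exists g, g * f = 1 >].
Definition ps_inv f : powser K :=
  if ps_unit f then xget 0 [set g | g * f = 1] else f.

Lemma ps_mulV : {in ps_unit, left_inverse 1 ps_inv *%R}.
Proof.
move=> f uf; rewrite /ps_inv (_ : ps_unit f) //.
by case: xgetP => [//|nex]; have /asboolP[g gf] : ps_unit f := uf; case: (nex g).
Qed.
Lemma ps_unitP f g : g * f = 1 -> ps_unit f.
Proof. by move=> gf; apply/asboolP; exists g. Qed.
Lemma ps_inv_out : {in [predC ps_unit], ps_inv =1 id}.
Proof. by move=> f nuf; rewrite /ps_inv ifN. Qed.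

HB.instance Definition _ := GRing.ComNzRing_hasMulInverse.Build (powser K)
  ps_mulV ps_unitP ps_inv_out.

Lemma ps_order f : f != 0 -> exists2 n, f n != 0 & forall i, (i < n)%N -> f i = 0.
Proof.
move=> f0; have ex : exists n, f n != 0.
  apply: contrapT => nex; move/eqP: f0; apply; apply: powserP => n /=.
  by rewrite mul0rn; apply/eqP; apply: contrapT => fn; apply: nex; exists n; apply/negP.
exists (ex_minn ex); case: ex_minnP => // m _ mmin i lt_im.
by apply/eqP; apply: contraLR lt_im => /mmin; rewrite leqNgt.
Qed.

Lemma ps_integral f g : f * g = 0 -> (f == 0) || (g == 0).
Proof.
move=> fg0; apply/norP => -[/ps_order[m fm fmin] /ps_order[p gp gmin]].
have := congr1 (fun h : powser K => h (m + p)%N) fg0.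
rewrite /= mul0rn.
have lt_m : (m < (m + p).+1)%N by rewrite ltnS leq_addr.
rewrite (bigD1 (Ordinal lt_m)) //= addKn big1 ?addr0.
  by move/eqP; rewrite mulf_eq0 (negbTE fm) (negbTE gp).
move=> i ne_im; have [lt_im|le_mi] := ltnP i m; first by rewrite fmin ?mul0r.
have lt_mi : (m < i)%N.
  by rewrite ltn_neqAle le_mi andbT eq_sym; apply: contra ne_im => /eqP e; apply/eqP/val_inj.
by rewrite gmin ?mulr0 // ltn_subLR ?ltn_add2r // -ltnS.
Qed.

HB.instance Definition _ :=
  GRing.ComUnitRing_isIntegral.Build (powser K) ps_integral.

End PowserRing.

(* The field K((t)) of formal Laurent series, realised as the fraction field of K[[t]]. *)
Notation laurent K := {fraction (powser K)}.
Notation "f %:L" := (@tofrac (powser _) f : laurent _)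
  (format "f %:L") : ring_scope.

Section Tadic.
Variable K : fieldType.

(* t-adic convergence of the series with terms [F n]: for every N, the partial
   sums are eventually equal to [S] modulo t^N K[[t]]. *)
Definition has_tsum (F : nat -> laurent K) (S : laurent K) : Prop :=
  forall N : nat, exists m0 : nat, forall m : nat, (m0 <= m)%N ->
    exists g : powser K, S - \sum_(n < m) F n = (ps_var K ^+ N * g)%:L.

Definition tsum (F : nat -> laurent K) : laurent K := xget 0 (has_tsum F).

Lemma ps_varX_coef N (g : powser K) i : (i < N)%N -> (ps_var K ^+ N * g) i = 0.
Proof.
elim: N i g => // N IH i g ltiN; rewrite exprS -mulrA.
set h := _ ^+ N * g in IH *; rewrite [LHS]/=.
apply: big1 => j _; case: (j =P 1%N :> nat) => [j1|_]; last by rewrite /= mul0r.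
rewrite j1 /= mul1r; have := ltn_ord j; rewrite j1 ltnS => i1.
by apply: IH; rewrite -(ltn_add2r 1) subnK ?addn1.
Qed.

Lemma has_tsum_unique F S S' : has_tsum F S -> has_tsum F S' -> S = S'.
Proof.
move=> FS FS'; apply/eqP; rewrite -subr_eq0; set x := S - S'.
have xN N : exists g, x = (ps_var K ^+ N * g)%:L.
  have [m1 h1] := FS N; have [m2 h2] := FS' N.
  have [g1 e1] := h1 _ (leq_maxl m1 m2); have [g2 e2] := h2 _ (leq_maxr m1 m2).
  exists (g1 - g2); rewrite mulrBr tofracB -e1 -e2 /x.
  by rewrite opprB addrA subrK.
have [g0 xg0] := xN 0%N; rewrite expr0 mul1r in xg0.
rewrite xg0 tofrac_eq0; apply/eqP/powserP => n; rewrite [RHS]/= mul0rn.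
have [g xg] := xN n.+1; move: xg; rewrite xg0 => /eqP; rewrite tofrac_eq => /eqP ->.
exact: ps_varX_coef.
Qed.

Lemma tsumE F S : has_tsum F S -> tsum F = S.
Proof.
move=> FS; rewrite /tsum; case: xgetP => [x _ Fx|/(_ S)/(_ FS)//].
exact: has_tsum_unique Fx FS.
Qed.

(* (n * n.+1)./2 is the exact half, n (n + 1) being even. *)
Definition T (k : nat) (u q : laurent K) : laurent K :=
  tsum (fun n => (-1) ^+ n * (2 * n + 1)%:R ^+ k * q ^+ (n * n.+1)./2
                 * (u ^+ n.+1 - (-1) ^+ k * u ^- n)).

End Tadic.

Definition Qs : fieldType := {fraction {poly rat}}.
Definition Qs_of_rat (c : rat) : Qs := tofrac c%:P.
Definition svar : Qs := tofrac ('X : {poly rat}).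

(* The embedding of Q[[t]] in Q(s)((t)), and the elements s and t. *)
Definition QtoL (f : powser rat) : laurent Qs :=
  (Powser (fun n => Qs_of_rat (f n)))%:L.
Definition sL : laurent Qs := (ps_const svar)%:L.
Definition tL : laurent Qs := (ps_var Qs)%:L.

(* [r] is the cube root q^(1/3) with leading term t. *)
Definition is_cbrt (q r : powser rat) : Prop :=
  [/\ r ^+ 3 = q, r 0%N = 0 & r 1%N = 1].

Definition q_equation (q r : powser rat) : Prop :=
  let qL := QtoL q in let rL := QtoL r in
  tL = rL * (T 1 1 (qL ^+ 3)
             / (4%:R * T 0 qL (qL ^+ 3) + 6%:R * T 1 qL (qL ^+ 3))).

Definition is_q (q : powser rat) : Prop :=
  q 0%N = 0 /\ exists2 r, is_cbrt q r & q_equation q r.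

Section Walks.
Variable R : realType.

Definition cis (x : R) : R[i] := cos x +i* sin x.
Definition omega : R[i] := cis (2 * pi / 3).

Definition lattice_vertex (z : R[i]) : Prop :=
  exists a b : int, z = - ((2 + omega) / 3) + (a%:~R + b%:~R * omega).

(* There are three such vertices, omega^j (1 - omega) / 3 for j = 0, 1, 2. *)
Definition closest_vertex (z : R[i]) : Prop :=
  lattice_vertex z /\ forall z', lattice_vertex z' -> `|z| <= `|z'|.

(* A walk of length n is given by its starting point and by the word of its
   steps, the letter j standing for the step omega^j. The three steps are
   allowed at every vertex of the lattice. *)
Definition walk_vertex (z0 : R[i]) n (w : n.-tuple 'I_3) (j : nat) : R[i] :=
  z0 + \sum_(i < n | (i < j)%N) omega ^+ tnth w i.

(* [th] is a continuous determination of the argument along the walk, whose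
   j-th edge is traversed at unit speed during the time interval [j, j + 1]. *)
Definition winding_angle (z0 : R[i]) n (w : n.-tuple 'I_3) (a : R) : Prop :=
  exists th : R -> R,
    [/\ {within `[0, n%:R], continuous th},
        forall (j : 'I_n) (x : R), 0 <= x <= 1 ->
          let z := walk_vertex z0 w j + x%:C * omega ^+ tnth w j in
          z = `|z| * cis (th (j%:R + x))
      & a = th n%:R - th 0].

(* The integer k such that the winding angle is 2 pi k / 3. It exists when both
   endpoints are closest vertices; it is unique because two continuous
   determinations of the argument differ by a constant. *)
Definition winding_number (z0 : R[i]) n (w : n.-tuple 'I_3) : int :=
  xget 0 [set k : int | winding_angle z0 w (2 * pi * k%:~R / 3)].

Definition E (w0 : R[i]) : powser Qs :=
  Powser (fun n => \sum_(w : n.-tuple 'I_3 | `[< closest_vertex (walk_vertex w0 w n) >])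
                      svar ^ winding_number w0 w).

End Walks.

(* Main.v *)
From HB Require Import structures.
Require Import Defs.
From mathcomp Require Import all_boot all_order all_algebra fraction complex.
From mathcomp Require Import boolp classical_sets reals topology normedtype trigo.
From mathcomp Require Import ring lra zify.
Set Implicit Arguments.
Unset Strict Implicit.
Unset Printing Implicit Defensive.
Import Order.TTheory GRing.Theory Num.Theory.
Local Open Scope ring_scope.
Local Open Scope classical_set_scope.

(** Write w = (1 - omega)/3.  Every lattice vertex is omega^k (w + a + b omega^2)
    for some a, b >= 0 and some k modulo 3, where a, b are coordinates in one of
    the three sectors around 0.  Along a walk, k can be followed as an
    integer, and then it counts the sectors that the walk has turned through.
    In the coordinates (a, b, k) the steps are those of Kreweras walks in a
    quadrant, except that a step leaving the quadrant enters the next one and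
    changes k by 1.  The winding angle of a walk between closest vertices is
    2 pi / 3 times the increase of k ([winding_number_run]), so that E(t,s)
    counts the words that lead from (0,0,k0) to some (0,0,k), with weight
    s^(k - k0).

    Let F(X) and H(X) be the generating functions of the words ending on the two
    sides of a sector.  Summing over the last step gives the kernel equation
    ([kernel_identity]): if xi + ze + et = 1 and xi ze et = t^3, then
    1 - et F(xi) - et ze H(ze) + s t F(ze) + s^(-1) t^2 H(xi) = 0,
    and E(t,s) = F(0).

    The cubic curve xi ze et = t^3 is elliptic, and theta functions
    parametrise it.  Everything is done with formal power series.  In
    K[[x,y]], the product r = x y plays the role of the cube root of the nome
    q, and (x/y)^3 that of the elliptic variable.  One series [xiB] gives both
    xi and ze, as its images under two substitutions [iot], [tau] which differ
    by a third of a period.  That they lie on the curve is the theta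
    identity [cubic_identity].  The curve
    then turns the kernel equation into a twisted functional equation relating
    iot Om and tau Om for an explicit combination Om of F and H
    ([twisted_OmB]).

    A twisted equation leaves little freedom: comparing coefficients
    shows that a solution whose monomials x^i y^j satisfy i = j mod 6 is
    determined by its coefficients at i = j ([twisted_eq0]), so that two
    solutions are proportional over K[[r]].  An explicit bilateral theta-like
    series [gB] solves the same equation as Om.  Hence the values and
    the first derivatives of Om and [gB] on the line x = y are proportional
    ([twisted_wronskian]).  On that line xi vanishes, F(xi) becomes F(0), and
    this proportionality is a linear equation for E(t,s) whose coefficients are
    the series T_k ([solution_in_nome]).  The theta identity itself is proved in
    the same way, from the twisted equation satisfied by both of its sides.

    That equation is expressed in terms of r, with t = r t0(r).  It
    remains to see that this relation between t and r can be inverted in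
    K[[t]] ([nome_exists], [nome_unique]), to substitute r = r(t), and to
    recognise the series T_k ([closed_form]). *)

(** * Complete filtered algebras and infinite sums *)

(** A domain that is a K-algebra, complete and separated for a filtration:
    [vge n f] says that f has order at least n.  K[[t]] and K[[x,y]], filtered by
    total degree, are the two instances; sums, theta series and walk series are
    defined once for both, and commute with the substitutions between them. *)
HB.mixin Record isAdicAlg (K : fieldType) R of GRing.IntegralDomain R := {
  ac : K -> R;
  vge : nat -> R -> Prop;
  ac_zmod : zmod_morphism ac;
  ac_monoid : monoid_morphism ac;
  vge_zero : forall n, vge n 0;
  vge0r : forall f, vge 0%N f;
  vge_leq : forall m n f, (m <= n)%N -> vge n f -> vge m f;
  vgeB : forall n f g, vge n f -> vge n g -> vge n (f - g);
  vgeM : forall m n f g, vge m f -> vge n g -> vge (m + n)%N (f * g);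
  vge_eq0 : forall f, (forall n, vge n f) -> f = 0;
  vge_complete : forall F : nat -> R, (forall n, vge n (F n)) ->
    exists S, forall N, vge N (S - \sum_(n < N) F n)
}.

#[short(type="adicAlgType")]
HB.structure Definition AdicAlg (K : fieldType) :=
  { R of isAdicAlg K R & GRing.IntegralDomain R }.

Section AdicTheory.
Variables (K : fieldType) (B : adicAlgType K).
Implicit Types (f g z c : B) (F G : nat -> B).

HB.instance Definition _ := GRing.isZmodMorphism.Build K B (@ac K B) ac_zmod.
HB.instance Definition _ := GRing.isMonoidMorphism.Build K B (@ac K B) ac_monoid.

Lemma vgeN n f : vge n f -> vge n (- f).
Proof. by move=> h; rewrite -sub0r; apply: vgeB => //; apply: vge_zero. Qed.

Lemma vgeD n f g : vge n f -> vge n g -> vge n (f + g).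
Proof. by move=> hf hg; rewrite -[g]opprK; apply: vgeB => //; apply: vgeN. Qed.

Lemma vge_sum n (J : Type) (s : seq J) (P : pred J) (F : J -> B) :
  (forall j, P j -> vge n (F j)) -> vge n (\sum_(j <- s | P j) F j).
Proof. by move=> h; apply: big_ind => //; [apply: vge_zero | apply: vgeD]. Qed.

Lemma vgeMl n c f : vge n f -> vge n (c * f).
Proof. by move=> h; rewrite -[n]add0n; apply: vgeM => //; apply: vge0r. Qed.

Lemma vgeMr n c f : vge n f -> vge n (f * c).
Proof. by rewrite mulrC; apply: vgeMl. Qed.

Lemma vgeX n f : vge 1 f -> vge n (f ^+ n).
Proof.
move=> h; elim: n => [|n IH]; first exact: vge0r.
by rewrite exprS -add1n; apply: vgeM.
Qed.

Definition asum F : B := xget 0 [set S | forall N, vge N (S - \sum_(n < N) F n)].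

Lemma asum_spec F : (forall n, vge n (F n)) ->
  forall N, vge N (asum F - \sum_(n < N) F n).
Proof.
move=> /vge_complete[S hS]; rewrite /asum.
by case: xgetP => [x _ //|/(_ S)/(_ hS)].
Qed.

(** Checking the remainders along a cofinal set of partial sums is enough. *)
Lemma asum_unique F S : (forall n, vge n (F n)) ->
  (forall N, exists2 M, (N <= M)%N & vge N (S - \sum_(n < M) F n)) -> asum F = S.
Proof.
move=> hF hS; apply/eqP; rewrite -subr_eq0; apply/eqP/vge_eq0 => N.
have [M NM h] := hS N.
have -> : asum F - S = (asum F - \sum_(n < M) F n) - (S - \sum_(n < M) F n).
  by rewrite opprB addrA subrK.
by apply: vgeB => //; apply: vge_leq NM _; apply: asum_spec.
Qed.

Lemma asumE F S : (forall n, vge n (F n)) ->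
  (forall N, vge N (S - \sum_(n < N) F n)) -> asum F = S.
Proof. by move=> hF hS; apply: asum_unique => // N; exists N. Qed.

Lemma eq_asum F G : F =1 G -> asum F = asum G.
Proof. by move=> /funext->. Qed.

Lemma asumD F G : (forall n, vge n (F n)) -> (forall n, vge n (G n)) ->
  asum (fun n => F n + G n) = asum F + asum G.
Proof.
move=> hF hG; apply: asumE => [n|N]; first exact: vgeD.
by rewrite big_split /= opprD addrACA; apply: vgeD; apply: asum_spec.
Qed.

Lemma asumMl c F : (forall n, vge n (F n)) ->
  asum (fun n => c * F n) = c * asum F.
Proof.
move=> hF; apply: asumE => [n|N]; first exact: vgeMl.
by rewrite -big_distrr -mulrBr; apply: vgeMl; apply: asum_spec.
Qed.

Lemma asumN F : (forall n, vge n (F n)) ->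
  asum (fun n => - F n) = - asum F.
Proof.
move=> hF; rewrite -mulN1r -asumMl //; apply: eq_asum => n; by rewrite mulN1r.
Qed.

Lemma asumB F G : (forall n, vge n (F n)) -> (forall n, vge n (G n)) ->
  asum (fun n => F n - G n) = asum F - asum G.
Proof.
by move=> hF hG; rewrite asumD ?asumN // => n; apply: vgeN.
Qed.

Lemma asum_recl F : (forall n, vge n (F n)) -> asum F = F 0%N + asum (fun n => F n.+1).
Proof.
move=> hF; have hS n : vge n (F n.+1) by apply: vge_leq (hF n.+1).
apply: asumE => // N; case: N => [|N]; first exact: vge0r.
rewrite big_ord_recl opprD addrACA subrr add0r /=.
have -> : asum (fun n => F n.+1) - \sum_(i < N) F (bump 0 i)
  = (asum (fun n => F n.+1) - \sum_(i < N.+1) F i.+1) + F N.+1.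
  by rewrite big_ord_recr /= opprD; ring.
by apply: vgeD => //; apply: asum_spec.
Qed.

Lemma vge_asum k F : (forall n, vge n (F n)) -> (forall n, vge k (F n)) -> vge k (asum F).
Proof.
move=> hF hk; rewrite -(subrK (\sum_(n < k) F n) (asum F)).
by apply: vgeD; [apply: asum_spec | apply: vge_sum].
Qed.

Lemma asum_eq0 F : (forall n, F n = 0) -> asum F = 0.
Proof.
move=> h; apply: asumE => [n|N]; first by rewrite h; apply: vge_zero.
by rewrite big1 ?subr0; [apply: vge_zero | move=> i _; apply: h].
Qed.

Lemma asum1 F : (forall n, (0 < n)%N -> F n = 0) -> asum F = F 0%N.
Proof.
move=> h; rewrite asum_recl ?asum_eq0 ?addr0 // => [n|[|n]]; first by rewrite h.
  exact: vge0r.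
by rewrite h //; apply: vge_zero.
Qed.

Lemma asum_single k F : (forall n, n != k -> F n = 0) -> vge k (F k) -> asum F = F k.
Proof.
move=> h hk; have hF n : vge n (F n).
  by have [->|/h->] := eqVneq n k; [exact: hk | exact: vge_zero].
apply: asum_unique => // N; exists (N + k.+1)%N; rewrite ?leq_addr //.
have kN : (k < N + k.+1)%N by rewrite addnS ltnS leq_addl.
rewrite (bigD1 (Ordinal kN)) //= big1 ?addr0 ?subrr => [|i ik]; first exact: vge_zero.
by rewrite h.
Qed.

(** The Cauchy product is read off polynomials: the sums truncated at N are
    the values at 1 of two polynomials f and g, and the coefficients of f g of
    index at least N have order at least N. *)
Lemma asumM F G : (forall n, vge n (F n)) -> (forall n, vge n (G n)) ->
  asum F * asum G = asum (fun n => \sum_(i < n.+1) F i * G (n - i)%N).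
Proof.
move=> hF hG.
have vC n : vge n (\sum_(i < n.+1) F i * G (n - i)%N).
  apply: vge_sum => i _; rewrite -{1}(subnKC (leq_ord i)); exact: vgeM.
apply/esym/asumE => // N.
pose f := \poly_(i < N) F i; pose g := \poly_(i < N) G i.
have fE : f.[1] = \sum_(i < N) F i.
  by rewrite horner_poly; apply: eq_bigr => i _; rewrite expr1n mulr1.
have gE : g.[1] = \sum_(i < N) G i.
  by rewrite horner_poly; apply: eq_bigr => i _; rewrite expr1n mulr1.
have -> : asum F * asum G - \sum_(n < N) \sum_(i < n.+1) F i * G (n - i)%N
  = (asum F - \sum_(n < N) F n) * asum G + (\sum_(n < N) F n) * (asum G - \sum_(n < N) G n)
    + ((\sum_(n < N) F n) * (\sum_(n < N) G n)
       - \sum_(n < N) \sum_(i < n.+1) F i * G (n - i)%N) by ring.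
apply: vgeD; first apply: vgeD.
- by apply: vgeMr; apply: asum_spec.
- by apply: vgeMl; apply: asum_spec.
have -> : \sum_(n < N) \sum_(i < n.+1) F i * G (n - i)%N = \sum_(n < N) (f * g)`_n.
  apply: eq_bigr => n _; rewrite coefM; apply: eq_bigr => i _; rewrite !coef_poly.
  by rewrite (leq_ltn_trans (leq_ord i) (ltn_ord n)) (leq_ltn_trans (leq_subr i n) (ltn_ord n)).
have -> : (\sum_(n < N) F n) * (\sum_(n < N) G n) = \sum_(n < N + size (f * g)) (f * g)`_n.
  rewrite -fE -gE -hornerM (horner_coef_wide 1 (leq_addl N (size (f * g)))).
  by apply: eq_bigr => i _; rewrite expr1n mulr1.
rewrite big_split_ord /= addrAC subrr add0r.
apply: vge_sum => i _; rewrite coefM; apply: vge_sum => j _; rewrite !coef_poly.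
case: ifP => _; last by rewrite mul0r; apply: vge_zero.
case: ifP => _; last by rewrite mulr0; apply: vge_zero.
apply: (@vge_leq _ _ _ (j + (N + i - j))); first by rewrite subnKC ?leq_addr ?leq_ord.
exact: vgeM.
Qed.

Lemma geom_inverse f : vge 1 (1 - f) -> f * asum (fun n => (1 - f) ^+ n) = 1.
Proof.
move=> h; have hX n : vge n ((1 - f) ^+ n) by apply: vgeX.
have e : asum (fun n => (1 - f) ^+ n) = 1 + (1 - f) * asum (fun n => (1 - f) ^+ n).
  rewrite {1}asum_recl // expr0 -asumMl //.
  by congr (1 + _); apply: eq_asum => n; rewrite exprS.
set S := asum _ in e *.
by rewrite -[LHS](_ : S - (1 - f) * S = _); [rewrite {1}e addrK | ring].
Qed.

End AdicTheory.

Section Csum.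
Variables (A : nzRingType) (K : fieldType) (B : adicAlgType K).
Variables (phi : {rmorphism A -> B}).
Implicit Types (f g : nat -> A) (z : B).

Definition csum f z : B := asum (fun n => phi (f n) * z ^+ n).

Lemma csum_term f z n : vge 1 z -> vge n (phi (f n) * z ^+ n).
Proof. by move=> h; apply: vgeMl; apply: vgeX. Qed.

Lemma csumD f g z : vge 1 z -> csum (fun n => f n + g n) z = csum f z + csum g z.
Proof.
move=> h; rewrite /csum -asumD; last 2 first.
- by move=> n; apply: csum_term.
- by move=> n; apply: csum_term.
by apply: eq_asum => n; rewrite rmorphD mulrDl.
Qed.

Lemma csumN f z : vge 1 z -> csum (fun n => - f n) z = - csum f z.
Proof.
move=> h; rewrite /csum -asumN; last by move=> n; apply: csum_term.
by apply: eq_asum => n; rewrite rmorphN mulNr.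
Qed.

Lemma csum_const (a : A) z : csum (fun n => a *+ (n == 0)%N) z = phi a.
Proof.
rewrite /csum asum1 /= ?expr0 ?mulr1 // => n n0.
by rewrite eqn0Ngt n0 mulr0n rmorph0 mul0r.
Qed.

Lemma csumM f g z : vge 1 z ->
  csum (fun n => \sum_(i < n.+1) f i * g (n - i)%N) z = csum f z * csum g z.
Proof.
move=> h; rewrite /csum asumM; first last.
- by move=> n; apply: csum_term.
- by move=> n; apply: csum_term.
apply: eq_asum => n; rewrite rmorph_sum mulr_suml; apply: eq_bigr => i _.
have -> : z ^+ n = z ^+ i * z ^+ (n - i) by rewrite -exprD subnKC ?leq_ord.
by rewrite rmorphM; ring.
Qed.

End Csum.

Definition adic_hom (K : fieldType) (B B' : adicAlgType K) (phi : B -> B') :=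
  (forall n f, vge n f -> vge n (phi f)) /\ forall c, phi (ac c) = ac c.

Section Continuity.
Variables (K K' : fieldType) (B : adicAlgType K) (B' : adicAlgType K').
Variable phi : B -> B'.
Hypothesis phiB : {morph phi : x y / x - y}.
Hypothesis phiv : forall n f, vge n f -> vge n (phi f).

(** Stated for maps that respect the filtrations without being K-linear, so
    that it also covers the extension of coefficients from Q to Q(s). *)
Lemma asum_morph (F : nat -> B) : (forall n, vge n (F n)) ->
  phi (asum F) = asum (fun n => phi (F n)).
Proof.
move=> hF; apply/esym/asumE => [n|N]; first exact: phiv.
have p0 : phi 0 = 0 by rewrite -(subrr 0) phiB subrr.
have pN x : phi (- x) = - phi x by rewrite -sub0r phiB p0 sub0r.
have pD x y : phi (x + y) = phi x + phi y by rewrite -{1}[y]opprK phiB pN opprK.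
have -> : \sum_(n < N) phi (F n) = phi (\sum_(n < N) F n).
  by apply/esym; apply: (big_morph _ pD p0).
by rewrite -phiB; apply: phiv; apply: asum_spec.
Qed.

End Continuity.

(** * Power series in one and two variables *)

Section PowserAdic.
Variable K : fieldType.
Implicit Types f g : powser K.

Lemma ps_coefD f g n : (f + g) n = f n + g n. Proof. by []. Qed.
Lemma ps_coefB f g n : (f - g) n = f n - g n. Proof. by []. Qed.
Lemma ps_coefM f g n : (f * g) n = \sum_(i < n.+1) f i * g (n - i)%N. Proof. by []. Qed.
Lemma ps_coef0 n : (0 : powser K) n = 0. Proof. by rewrite /= mul0rn. Qed.
Lemma ps_coef1 n : (1 : powser K) n = (n == 0)%N%:R. Proof. by []. Qed.
Lemma ps_coef_sum (J : Type) (s : seq J) (P : pred J) (F : J -> powser K) n :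
  (\sum_(j <- s | P j) F j) n = \sum_(j <- s | P j) F j n.
Proof.
apply: (big_morph (fun f : powser K => f n)) => [f g|]; [exact: ps_coefD | exact: ps_coef0].
Qed.

Lemma ps_coef_const (c : K) n : ps_const c n = c *+ (n == 0)%N. Proof. by []. Qed.
Lemma ps_coef_var n : ps_var K n = (n == 1)%N%:R. Proof. by []. Qed.

Lemma ps_const_zmod : zmod_morphism (@ps_const K).
Proof. by move=> x y; apply: powserP => n /=; rewrite mulrnBl. Qed.

Lemma ps_const_monoid : monoid_morphism (@ps_const K).
Proof.
split=> // x y; apply: powserP => n; rewrite ps_coefM.
rewrite big_ord_recl big1 ?addr0 /= => [|i _]; first by rewrite subn0 mulrnAr.
by rewrite mulr0n mul0r.
Qed.

Definition ps_vge n f := forall i, (i < n)%N -> f i = 0.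

Lemma ps_vgeM m n f g : ps_vge m f -> ps_vge n g -> ps_vge (m + n) (f * g).
Proof.
move=> hf hg i hi; rewrite ps_coefM big1 // => -[j /= hj] _.
have [jm|mj] := ltnP j m; first by rewrite hf ?mul0r.
by rewrite hg ?mulr0 //; lia.
Qed.

Lemma ps_vge_complete (F : nat -> powser K) : (forall n, ps_vge n (F n)) ->
  exists S, forall N, ps_vge N (S - \sum_(n < N) F n).
Proof.
move=> hF; exists (Powser (fun i => \sum_(n < i.+1) F n i)) => N i iN.
rewrite ps_coefB ps_coef_sum /= -(subnKC iN) big_split_ord /= opprD addrA subrr add0r.
by rewrite big1 ?oppr0 // => j _; apply: hF; rewrite ltnS leq_addr.
Qed.

Lemma ps_vge0r f : ps_vge 0 f. Proof. by []. Qed.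
Lemma ps_vge_leq m n f : (m <= n)%N -> ps_vge n f -> ps_vge m f.
Proof. by move=> mn hf i im; apply: hf; apply: leq_trans mn. Qed.
Lemma ps_vgeB n f g : ps_vge n f -> ps_vge n g -> ps_vge n (f - g).
Proof. by move=> hf hg i hi; rewrite ps_coefB hf ?hg ?subrr. Qed.
Lemma ps_vge_eq0 f : (forall n, ps_vge n f) -> f = 0.
Proof. by move=> h; apply: powserP => i; rewrite (h i.+1) // ps_coef0. Qed.

Lemma ps_vge_zero n : ps_vge n 0. Proof. by move=> i _; apply: ps_coef0. Qed.

HB.instance Definition _ := isAdicAlg.Build K (powser K)
  ps_const_zmod ps_const_monoid
  ps_vge_zero ps_vge0r ps_vge_leq ps_vgeB ps_vgeM ps_vge_eq0
  ps_vge_complete.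

Lemma ps_vgeP n f : vge n f <-> forall i, (i < n)%N -> f i = 0.
Proof. by []. Qed.

Lemma ps_coef_asum (F : nat -> powser K) N i : (forall n, vge n (F n)) -> (i < N)%N ->
  asum F i = \sum_(n < N) F n i.
Proof.
move=> hF iN; have /ps_vgeP/(_ i iN)/eqP := asum_spec hF N.
by rewrite ps_coefB subr_eq0 ps_coef_sum => /eqP.
Qed.

Lemma vge_var : vge 1 (ps_var K). Proof. by case. Qed.

Lemma ps_coefXn n i : (ps_var K ^+ n) i = (i == n)%:R.
Proof.
elim: n i => [|n IH] i; first by rewrite expr0 ps_coef1.
rewrite exprS ps_coefM; case: i => [|i]; first by rewrite big_ord1 /= mul0r.
rewrite big_ord_recl /= mul0r add0r big_ord_recl /= mul1r big1 ?addr0.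
  by rewrite /bump /= subSS subn0 IH.
by move=> j _; rewrite /= mul0r.
Qed.

End PowserAdic.

(** The coefficients here form a domain and not a field, so that K[[x,y]] can
    be built as K[[x]][[y]]. *)
Record fps (A : idomainType) := Fps { fcoef :> nat -> A }.

HB.instance Definition _ (A : idomainType) := gen_eqMixin (fps A).
HB.instance Definition _ (A : idomainType) := gen_choiceMixin (fps A).

Section FpsRing.
Variable A : idomainType.
Implicit Types f g h : fps A.

Lemma fpsP f g : (forall n, f n = g n) -> f = g.
Proof. by case: f g => [f] [g] /= fg; congr Fps; apply/funext. Qed.

Definition fps_const (c : A) : fps A := Fps (fun n => c *+ (n == 0)%N).
Definition fps_add f g := Fps (fun n => f n + g n).
Definition fps_opp f := Fps (fun n => - f n).
Definition fps_mul f g := Fps (fun n => \sum_(i < n.+1) f i * g (n - i)%N).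
Definition fps_trunc N f : {poly A} := \poly_(i < N) f i.

(** Ring laws for products reduce to those of polynomials, a coefficient of
    a product being determined by truncations. *)
Lemma fps_mul_coef N f g n : (n < N)%N ->
  fps_mul f g n = (fps_trunc N f * fps_trunc N g)`_n.
Proof.
move=> nN; rewrite coefM; apply: eq_bigr => i _; rewrite !coef_poly.
by rewrite (leq_ltn_trans (leq_ord i) nN) (leq_ltn_trans (leq_subr i n) nN).
Qed.

Lemma fps_addA : associative fps_add.
Proof. by move=> f g h; apply: fpsP => n /=; rewrite addrA. Qed.
Lemma fps_addC : commutative fps_add.
Proof. by move=> f g; apply: fpsP => n /=; rewrite addrC. Qed.
Lemma fps_add0 : left_id (fps_const 0) fps_add.
Proof. by move=> f; apply: fpsP => n /=; rewrite mul0rn add0r. Qed.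
Lemma fps_addN : left_inverse (fps_const 0) fps_opp fps_add.
Proof. by move=> f; apply: fpsP => n /=; rewrite addNr mul0rn. Qed.

HB.instance Definition _ :=
  GRing.isZmodule.Build (fps A) fps_addA fps_addC fps_add0 fps_addN.

Lemma fps_mulC : commutative fps_mul.
Proof. by move=> f g; apply: fpsP => n; rewrite !(fps_mul_coef _ _ (ltnSn n)) mulrC. Qed.

Lemma fps_mulA : associative fps_mul.
Proof.
have trE a b N i : (i < N)%N ->
    (fps_trunc N (fps_mul a b))`_i = (fps_trunc N a * fps_trunc N b)`_i.
  by move=> iN; rewrite coef_poly iN (fps_mul_coef _ _ iN).
move=> f g h; apply: fpsP => n; rewrite !(fps_mul_coef _ _ (ltnSn n)).
transitivity (fps_trunc n.+1 f * (fps_trunc n.+1 g * fps_trunc n.+1 h))`_n.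
  by rewrite !coefM; apply: eq_bigr => i _; rewrite trE ?ltnS ?leq_subr.
by rewrite mulrA !coefM; apply: eq_bigr => i _; rewrite trE.
Qed.

Lemma fps_mul1 : left_id (fps_const 1) fps_mul.
Proof.
move=> f; apply: fpsP => n /=.
rewrite big_ord_recl /= subn0 mul1r big1 ?addr0 // => i _.
by rewrite mulr0n mul0r.
Qed.

Lemma fps_mulDl : left_distributive fps_mul fps_add.
Proof.
move=> f g h; apply: fpsP => n /=; rewrite -big_split /=.
by apply: eq_bigr => i _; rewrite mulrDl.
Qed.

Lemma fps_1neq0 : fps_const 1 != 0.
Proof.
apply/eqP => /(congr1 (fun f : fps A => f 0%N)) /= /eqP.
by rewrite ?mulr0n ?mulr1n oner_eq0.
Qed.

HB.instance Definition _ := GRing.Zmodule_isComNzRing.Build (fps A)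
  fps_mulA fps_mulC fps_mul1 fps_mulDl fps_1neq0.

Definition fps_unit : pred (fps A) := fun f => `[< exists g, g * f = 1 >].
Definition fps_inv f : fps A := if fps_unit f then xget 0 [set g | g * f = 1] else f.

Lemma fps_mulV : {in fps_unit, left_inverse 1 fps_inv *%R}.
Proof.
move=> f uf; rewrite /fps_inv (_ : fps_unit f) //.
by case: xgetP => [//|nex]; have /asboolP[g gf] : fps_unit f := uf; case: (nex g).
Qed.
Lemma fps_unitP f g : g * f = 1 -> fps_unit f.
Proof. by move=> gf; apply/asboolP; exists g. Qed.
Lemma fps_inv_out : {in [predC fps_unit], fps_inv =1 id}.
Proof. by move=> f nuf; rewrite /fps_inv ifN. Qed.

HB.instance Definition _ := GRing.ComNzRing_hasMulInverse.Build (fps A)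
  fps_mulV fps_unitP fps_inv_out.

Lemma fps_coefD f g n : (f + g) n = f n + g n. Proof. by []. Qed.
Lemma fps_coefM f g n : (f * g) n = \sum_(i < n.+1) f i * g (n - i)%N. Proof. by []. Qed.
Lemma fps_coef0 n : (0 : fps A) n = 0. Proof. by rewrite /= mul0rn. Qed.

Lemma fps_order f : f != 0 -> exists2 n, f n != 0 & forall i, (i < n)%N -> f i = 0.
Proof.
move=> f0; have ex : exists n, f n != 0.
  apply: contrapT => nex; move/eqP: f0; apply; apply: fpsP => n; rewrite fps_coef0.
  by apply/eqP; apply: contrapT => fn; apply: nex; exists n; apply/negP.
exists (ex_minn ex); case: ex_minnP => // m _ mmin i lt_im.
by apply/eqP; apply: contraLR lt_im => /mmin; rewrite leqNgt.
Qed.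

Lemma fps_integral f g : f * g = 0 -> (f == 0) || (g == 0).
Proof.
move=> fg0; apply/norP => -[/fps_order[m fm fmin] /fps_order[p gp gmin]].
have := congr1 (fun h : fps A => h (m + p)%N) fg0.
rewrite fps_coef0 fps_coefM.
have lt_m : (m < (m + p).+1)%N by rewrite ltnS leq_addr.
rewrite (bigD1 (Ordinal lt_m)) //= addKn big1 ?addr0.
  by move/eqP; rewrite mulf_eq0 (negbTE fm) (negbTE gp).
move=> [i hi] ne_im; have [lt_im|le_mi] := ltnP i m; first by rewrite fmin ?mul0r.
by rewrite gmin ?mulr0 //=; move: ne_im; rewrite -val_eqE /=; lia.
Qed.

HB.instance Definition _ := GRing.ComUnitRing_isIntegral.Build (fps A) fps_integral.

Lemma fps_coef_sum (J : Type) (s : seq J) (P : pred J) (F : J -> fps A) n :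
  (\sum_(j <- s | P j) F j) n = \sum_(j <- s | P j) F j n.
Proof.
apply: (big_morph (fun f : fps A => f n)) => [f g|]; [exact: fps_coefD | exact: fps_coef0].
Qed.

End FpsRing.

Definition ps2 (K : fieldType) := fps (powser K).
HB.instance Definition _ K := GRing.IntegralDomain.on (ps2 K).

Section Ps2Adic.
Variable K : fieldType.
Implicit Types f g : ps2 K.

Definition cf f i j : K := fcoef f j i.

Lemma ps2P f g : (forall i j, cf f i j = cf g i j) -> f = g.
Proof. by move=> h; apply: fpsP => j; apply: powserP => i; apply: h. Qed.

Lemma cfD f g i j : cf (f + g) i j = cf f i j + cf g i j. Proof. by []. Qed.
Lemma cfN f i j : cf (- f) i j = - cf f i j. Proof. by []. Qed.
Lemma cfB f g i j : cf (f - g) i j = cf f i j - cf g i j. Proof. by []. Qed.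
Lemma cf0 i j : cf 0 i j = 0. Proof. by rewrite /cf fps_coef0 ps_coef0. Qed.
Lemma cf_sum (J : Type) (s : seq J) (P : pred J) (F : J -> ps2 K) i j :
  cf (\sum_(k <- s | P k) F k) i j = \sum_(k <- s | P k) cf (F k) i j.
Proof. by rewrite /cf fps_coef_sum ps_coef_sum. Qed.
Lemma cfM f g i j : cf (f * g) i j =
  \sum_(l < j.+1) \sum_(k < i.+1) cf f k l * cf g (i - k)%N (j - l)%N.
Proof. by rewrite /cf fps_coefM ps_coef_sum. Qed.

Definition ps2_const (c : K) : ps2 K := fps_const (ps_const c).

Lemma cf_const c i j : cf (ps2_const c) i j = c *+ ((i == 0) && (j == 0))%N.
Proof.
rewrite /cf; case: j => [|j]; first by rewrite andbT.
by rewrite andbF mulr0n; exact: ps_coef0.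
Qed.

Lemma ps2_const_zmod : zmod_morphism ps2_const.
Proof. by move=> x y; apply: ps2P => i j; rewrite cfB !cf_const mulrnBl. Qed.

Lemma ps2_const_monoid : monoid_morphism ps2_const.
Proof.
split=> // x y; apply: ps2P => i j; rewrite cfM cf_const.
rewrite big_ord_recl big_ord_recl !big1 ?addr0 => [|a _|a _].
- by rewrite (cf_const x 0 0) (cf_const y (i - 0) (j - 0)) mulr1n !subn0 mulrnAr.
- by rewrite big1 // => b _; rewrite (cf_const x b a.+1) andbF mulr0n mul0r.
by rewrite (cf_const x a.+1 0) mulr0n mul0r.
Qed.

Definition ps2_vge n f := forall i j, (i + j < n)%N -> cf f i j = 0.

Lemma ps2_vgeM m n f g : ps2_vge m f -> ps2_vge n g -> ps2_vge (m + n) (f * g).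
Proof.
move=> hf hg i j hij; rewrite cfM big1 // => -[l /= hl] _; rewrite big1 // => -[k /= hk] _.
have [km|mk] := ltnP (k + l) m; first by rewrite hf ?mul0r.
by rewrite hg ?mulr0 //; lia.
Qed.

Lemma ps2_vge_complete (F : nat -> ps2 K) : (forall n, ps2_vge n (F n)) ->
  exists S, forall N, ps2_vge N (S - \sum_(n < N) F n).
Proof.
move=> hF; exists (Fps (fun j => Powser (fun i => \sum_(n < (i + j).+1) cf (F n) i j))).
move=> N i j iN; rewrite cfB cf_sum {1}/cf /=.
rewrite -(subnKC iN) big_split_ord /= opprD addrA subrr add0r.
by rewrite big1 ?oppr0 // => k _; apply: hF; lia.
Qed.

Lemma ps2_vge_leq m n f : (m <= n)%N -> ps2_vge n f -> ps2_vge m f.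
Proof. by move=> mn hf i j h; apply: hf; apply: leq_trans mn. Qed.
Lemma ps2_vgeB n f g : ps2_vge n f -> ps2_vge n g -> ps2_vge n (f - g).
Proof. by move=> hf hg i j h; rewrite cfB hf ?hg ?subrr. Qed.
Lemma ps2_vge_eq0 f : (forall n, ps2_vge n f) -> f = 0.
Proof. by move=> h; apply: ps2P => i j; rewrite cf0 (h (i + j).+1). Qed.
Lemma ps2_vge_zero n : ps2_vge n 0. Proof. by move=> i j _; apply: cf0. Qed.
Lemma ps2_vge0r f : ps2_vge 0 f. Proof. by []. Qed.

HB.instance Definition _ := isAdicAlg.Build K (ps2 K)
  ps2_const_zmod ps2_const_monoid
  ps2_vge_zero ps2_vge0r ps2_vge_leq ps2_vgeB ps2_vgeM ps2_vge_eq0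
  ps2_vge_complete.

Lemma ps2_vgeP n f : vge n f <-> forall i j, (i + j < n)%N -> cf f i j = 0.
Proof. by []. Qed.

Lemma cf_asum (F : nat -> ps2 K) N i j : (forall n, vge n (F n)) -> (i + j < N)%N ->
  cf (asum F) i j = \sum_(n < N) cf (F n) i j.
Proof.
move=> hF iN; have /ps2_vgeP/(_ i j iN)/eqP := asum_spec hF N.
by rewrite cfB subr_eq0 cf_sum => /eqP.
Qed.

Definition mon (p q : nat) : ps2 K := Fps (fun j => Powser (fun i => ((i == p) && (j == q))%:R)).
Lemma cf_mon p q i j : cf (mon p q) i j = ((i == p) && (j == q))%:R.
Proof. by []. Qed.

Lemma cf_monM p q f i j : cf (mon p q * f) i j =
  if (p <= i)%N && (q <= j)%N then cf f (i - p) (j - q) else 0.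
Proof.
rewrite cfM; case: ifP => [/andP[pi qj]|npq].
  rewrite (bigD1 (Ordinal (qj : q < j.+1)%N)) //= (bigD1 (Ordinal (pi : p < i.+1)%N)) //=.
  rewrite cf_mon !eqxx mul1r !big1 ?addr0 // => [l lq|k kp]; last first.
    by rewrite cf_mon -(inj_eq val_inj) /= in kp *; rewrite (negbTE kp) mul0r.
  rewrite big1 // => k _; rewrite cf_mon -(inj_eq val_inj) /= in lq *.
  by rewrite (negbTE lq) andbF mul0r.
rewrite big1 // => l _; rewrite big1 // => k _; rewrite cf_mon.
case: (altP (k =P p :> nat)) => [kp|_]; last by rewrite mul0r.
case: (altP (l =P q :> nat)) => [lq|_]; last by rewrite mul0r.
by move: npq; rewrite -kp -lq !leq_ord.
Qed.

Definition xv : ps2 K := mon 1 0.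
Definition yv : ps2 K := mon 0 1.

Lemma monM p q p' q' : mon p q * mon p' q' = mon (p + p') (q + q').
Proof.
apply: ps2P => i j; rewrite cf_monM !cf_mon; case: ifP => h.
  by congr ((nat_of_bool _)%:R); apply/idP/idP; lia.
by case: (boolP (_ && _)) => //= h'; lia.
Qed.

Lemma mon_xy p q : mon p q = xv ^+ p * yv ^+ q.
Proof.
have e1 : mon 0 0 = 1 by apply: ps2P => i j; rewrite cf_mon; apply/esym/(cf_const 1 i j).
have -> : xv ^+ p = mon p 0.
  by elim: p => [|p IH]; rewrite ?expr0 ?e1 // exprS IH monM add1n addn0.
have -> : yv ^+ q = mon 0 q.
  by elim: q => [|q IH]; rewrite ?expr0 ?e1 // exprS IH monM add1n addn0.
by rewrite monM addn0 add0n.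
Qed.

Lemma vge_mon p q : vge (p + q) (mon p q).
Proof. by apply/ps2_vgeP => i j h; rewrite cf_mon; case: (boolP (_ && _)) => // /andP[/eqP ? /eqP ?]; lia. Qed.

Lemma cf_acM c f i j : cf (ac c * f) i j = c * cf f i j.
Proof.
rewrite cfM big_ord_recl big_ord_recl !big1 ?addr0 => [|a _|a _].
- by rewrite (cf_const c 0 0) mulr1n !subn0.
- by rewrite big1 // => b _; rewrite (cf_const c b a.+1) andbF mulr0n mul0r.
by rewrite (cf_const c a.+1 0) mulr0n mul0r.
Qed.

End Ps2Adic.

(* From here on, series are handled through the coefficient rules above only. *)
#[global] Opaque ps_add ps_opp ps_mul ps_const ps_var fps_add fps_opp fps_mul fps_const
  ps2_const mon cf.

(** * Substitutions, and the twisted functional equation *)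

Section Pcomp.
Variables (K0 K : fieldType) (B : adicAlgType K) (phi : {rmorphism K0 -> B}).
Variables (z : B) (hz : vge 1 z).

(** The proof that z has positive order is an argument so that the morphism
    structure of f |-> f(z) can be inferred. *)
Definition pscomp (_ : vge 1 z) (f : powser K0) : B := csum phi f z.

Lemma pscomp_zmod : zmod_morphism (pscomp hz).
Proof.
move=> f g; rewrite /pscomp -(csumN _ _ hz) -(csumD _ _ _ hz).
by congr csum.
Qed.

Lemma pscomp_monoid : monoid_morphism (pscomp hz).
Proof.
split; last by move=> f g; rewrite /pscomp -(csumM _ _ _ hz).
by rewrite -(rmorph1 phi) -(csum_const phi 1 z).
Qed.

HB.instance Definition _ := GRing.isZmodMorphism.Build _ _ (pscomp hz) pscomp_zmod.
HB.instance Definition _ := GRing.isMonoidMorphism.Build _ _ (pscomp hz) pscomp_monoid.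

Lemma pscompE f : pscomp hz f = asum (fun n => phi (f n) * z ^+ n). Proof. by []. Qed.

Lemma pscomp_vge n f : vge n f -> vge n (pscomp hz f).
Proof.
move=> hf; apply: vge_asum => m; first exact: csum_term.
have [mn|nm] := ltnP m n.
  by rewrite (iffLR (@ps_vgeP _ n f) hf) // rmorph0 mul0r; apply: vge_zero.
by apply: vge_leq nm _; apply: csum_term.
Qed.

Lemma pscomp_const c : pscomp hz (ac c) = phi c.
Proof. exact: csum_const. Qed.

Lemma pscomp_var : pscomp hz (ps_var K0) = z.
Proof.
rewrite pscompE (@asum_single _ _ 1) ?ps_coef_var ?rmorph1 ?mul1r ?expr1 // => n n1.
by rewrite ps_coef_var (negbTE n1) rmorph0 mul0r.
Qed.

End Pcomp.

Section Fcomp.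
Variables (A : idomainType) (K : fieldType) (B : adicAlgType K).
Variables (phi : {rmorphism A -> B}) (z : B) (hz : vge 1 z).

Definition fcomp (_ : vge 1 z) (f : fps A) : B := csum phi f z.

Lemma fcomp_zmod : zmod_morphism (fcomp hz).
Proof.
move=> f g; rewrite /fcomp -(csumN _ _ hz) -(csumD _ _ _ hz).
by congr csum.
Qed.

Lemma fcomp_monoid : monoid_morphism (fcomp hz).
Proof.
split; last by move=> f g; rewrite /fcomp -(csumM _ _ _ hz).
by rewrite -(rmorph1 phi) -(csum_const phi 1 z).
Qed.

HB.instance Definition _ := GRing.isZmodMorphism.Build _ _ (fcomp hz) fcomp_zmod.
HB.instance Definition _ := GRing.isMonoidMorphism.Build _ _ (fcomp hz) fcomp_monoid.
End Fcomp.

Section HomTheory.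
Variables (K : fieldType) (B B' : adicAlgType K).
Variables (phi : {rmorphism B -> B'}) (hphi : adic_hom phi).

Lemma adic_hom_asum (F : nat -> B) : (forall n, vge n (F n)) ->
  phi (asum F) = asum (fun n => phi (F n)).
Proof. by apply: asum_morph; [exact: rmorphB | exact: hphi.1]. Qed.

Lemma adic_hom_pscomp (z : B) (hz : vge 1 z) (hz' : vge 1 (phi z)) (f : powser K) :
  phi (pscomp (@ac K B) hz f) = pscomp (@ac K B') hz' f.
Proof.
rewrite !pscompE adic_hom_asum => [|n]; last exact: (csum_term (@ac K B) f).
by apply: eq_asum => n; rewrite rmorphM rmorphXn hphi.2.
Qed.
End HomTheory.

Lemma pscomp_adic (K : fieldType) (B : adicAlgType K) (z : B) (hz : vge 1 z) :
  adic_hom (pscomp (@ac K B) hz).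
Proof. by split => [n f|c]; [exact: pscomp_vge | exact: pscomp_const]. Qed.

Lemma ps_coef_acM (K : fieldType) (c : K) (f : powser K) n : (ac c * f) n = c * f n.
Proof.
rewrite ps_coefM big_ord_recl big1 ?addr0 => [|j _]; first by rewrite subn0 (ps_coef_const c 0).
by rewrite (ps_coef_const c j.+1) mul0r.
Qed.

Lemma pscomp_id (K : fieldType) (f : powser K) : pscomp (@ac K (powser K)) (vge_var K) f = f.
Proof.
apply: powserP => i; rewrite pscompE (@ps_coef_asum _ _ i.+1) // => [|n]; last first.
  by apply: (csum_term (@ac K (powser K)) f); exact: vge_var.
under eq_bigr => n _ do rewrite ps_coef_acM ps_coefXn.
rewrite big_ord_recr big1 /= => [|j _]; first by rewrite eqxx mulr1 add0r.
by rewrite gtn_eqF ?mulr0 //; apply: ltn_ord.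
Qed.

Section Subst2.
Variables (K : fieldType) (B : adicAlgType K) (X Y : B) (hX : vge 1 X) (hY : vge 1 Y).

(** f(X,Y), composing in x first and then in y. *)
Definition subst2 (f : ps2 K) : B :=
  fcomp (pscomp (@ac K B) hX) hY f.

Lemma subst2_zmod : zmod_morphism (subst2).
Proof. exact: (fcomp_zmod (pscomp (@ac K B) hX) hY). Qed.

Lemma subst2_monoid : monoid_morphism (subst2).
Proof. exact: (fcomp_monoid (pscomp (@ac K B) hX) hY). Qed.

HB.instance Definition _ := GRing.isZmodMorphism.Build _ _ (subst2) subst2_zmod.
HB.instance Definition _ := GRing.isMonoidMorphism.Build _ _ (subst2) subst2_monoid.

Lemma subst2E f : subst2 f =
  asum (fun j => asum (fun i => ac (cf f i j) * X ^+ i) * Y ^+ j).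
Proof. by []. Qed.

Lemma subst2_adic : adic_hom (subst2).
Proof.
split => [n f hf|c].
  rewrite subst2E; apply: vge_asum => j; first by apply: vgeMl; apply: vgeX.
  have hI i : vge i (ac (cf f i j) * X ^+ i) by apply: vgeMl; apply: vgeX.
  apply: (@vge_leq _ _ _ (n - j + j)); first lia.
  apply: vgeM; last exact: vgeX.
  apply: vge_asum => // i; have [ij|ij] := ltnP (i + j) n.
    by rewrite (iffLR (@ps2_vgeP _ n f) hf) // rmorph0 mul0r; apply: vge_zero.
  by apply: vge_leq (hI i); lia.
have -> : subst2 (ac c) = pscomp (@ac K B) hX (ac c) by exact: csum_const.
exact: pscomp_const.
Qed.

Lemma subst2_x : subst2 (xv K) = X.
Proof.
rewrite subst2E asum1 => [|j j0].
  rewrite expr0 mulr1 (@asum_single _ _ 1) ?cf_mon ?rmorph1 ?mul1r ?expr1 // => n n1.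
  by rewrite cf_mon (negbTE n1) rmorph0 mul0r.
by rewrite asum_eq0 ?mul0r // => i; rewrite cf_mon eqn0Ngt j0 andbF rmorph0 mul0r.
Qed.

Lemma subst2_y : subst2 (yv K) = Y.
Proof.
have hO (j : nat) : asum (fun i => ac (cf (yv K) i j) * X ^+ i) = (j == 1)%N%:R.
  rewrite asum1 => [|i i0]; last by rewrite cf_mon eqn0Ngt i0 rmorph0 mul0r.
  by rewrite cf_mon expr0 mulr1 rmorph_nat.
rewrite subst2E (@asum_single _ _ 1) ?hO ?mul1r ?expr1 // => n n1.
by rewrite hO (negbTE n1) mul0r.
Qed.

Lemma subst2_mon p q : subst2 (mon K p q) = X ^+ p * Y ^+ q.
Proof. by rewrite mon_xy rmorphM !rmorphXn /= subst2_x subst2_y. Qed.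

End Subst2.

Lemma monX (K : fieldType) p q n : mon K p q ^+ n = mon K (n * p) (n * q).
Proof. by rewrite !mon_xy exprMn -!exprM !(mulnC n). Qed.

Lemma mon_vge1 (K : fieldType) p q : (0 < p + q)%N -> vge 1 (mon K p q).
Proof. by move=> h; apply: vge_leq h (@vge_mon K p q). Qed.

Lemma cf_subst2_mon (K : fieldType) p q p' q'
    (hX : vge 1 (mon K p q)) (hY : vge 1 (mon K p' q')) f P Q N :
  (P + Q < N)%N ->
  cf (subst2 hX hY f) P Q = \sum_(j < N) \sum_(i < N)
    cf f i j * ((P == i * p + j * p') && (Q == i * q + j * q'))%N%:R.
Proof.
move=> hN; rewrite subst2E (@cf_asum _ _ N) //; last first.
  by move=> j; apply: vgeMl; apply: vgeX.
apply: eq_bigr => j _; rewrite mulrC -asumMl; last by move=> i; apply: vgeMl; apply: vgeX.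
rewrite (@cf_asum _ _ N) //; last by move=> i; do 2!apply: vgeMl; apply: vgeX.
apply: eq_bigr => i _; rewrite mulrCA cf_acM !monX monM cf_mon.
by congr (_ * (nat_of_bool (_ && _))%:R); congr (_ == _); rewrite addnC.
Qed.

Section Twist.
Variable K : fieldType.
Implicit Types (f g : ps2 K).

Lemma vge_iX : vge 1 (mon K 1 2). Proof. exact: mon_vge1. Qed.
Lemma vge_iY : vge 1 (mon K 1 0). Proof. exact: mon_vge1. Qed.
Lemma vge_tX : vge 1 (mon K 0 1). Proof. exact: mon_vge1. Qed.
Lemma vge_tY : vge 1 (mon K 2 1). Proof. exact: mon_vge1. Qed.

Fact iot_key : unit. Proof. by []. Qed.
Fact tau_key : unit. Proof. by []. Qed.
(** The substitutions (x,y) |-> (a b^2, a) and (x,y) |-> (b, a^2 b).  Both send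
    r = x y to (a b)^2, while x/y is sent to b^2 and to a^(-2), whose quotient is
    (a b)^2.  Both are locked, so that only the rules below apply to
    them. *)
Definition iot : ps2 K -> ps2 K := locked_with iot_key (subst2 vge_iX vge_iY).
Definition tau : ps2 K -> ps2 K := locked_with tau_key (subst2 vge_tX vge_tY).
Lemma iotE : iot = subst2 vge_iX vge_iY. Proof. by rewrite /iot unlock. Qed.
Lemma tauE : tau = subst2 vge_tX vge_tY. Proof. by rewrite /tau unlock. Qed.

Lemma iot_zmod : zmod_morphism iot. Proof. by rewrite iotE; exact: rmorphB. Qed.
Lemma tau_zmod : zmod_morphism tau. Proof. by rewrite tauE; exact: rmorphB. Qed.
Lemma iot_monoid : monoid_morphism iot. Proof. by rewrite iotE; exact: subst2_monoid. Qed.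
Lemma tau_monoid : monoid_morphism tau. Proof. by rewrite tauE; exact: subst2_monoid. Qed.
HB.instance Definition _ := GRing.isZmodMorphism.Build _ _ iot iot_zmod.
HB.instance Definition _ := GRing.isMonoidMorphism.Build _ _ iot iot_monoid.
HB.instance Definition _ := GRing.isZmodMorphism.Build _ _ tau tau_zmod.
HB.instance Definition _ := GRing.isMonoidMorphism.Build _ _ tau tau_monoid.

Lemma iot_adic : adic_hom iot. Proof. by rewrite iotE; exact: subst2_adic. Qed.
Lemma tau_adic : adic_hom tau. Proof. by rewrite tauE; exact: subst2_adic. Qed.

Lemma iot_mon p q : iot (mon K p q) = mon K (p + q) (2 * p).
Proof. by rewrite iotE subst2_mon !monX monM !muln1 muln0 addn0 mulnC. Qed.

Lemma tau_mon p q : tau (mon K p q) = mon K (2 * q) (p + q).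
Proof. by rewrite tauE subst2_mon !monX monM !muln1 muln0 add0n mulnC. Qed.

Lemma sum2_single (N : nat) (F : nat -> nat -> K) (C : nat -> nat -> bool) i0 j0 :
  (i0 < N)%N -> (j0 < N)%N -> C i0 j0 -> (forall i j, C i j -> i = i0 /\ j = j0) ->
  \sum_(j < N) \sum_(i < N) F i j * (C i j)%:R = F i0 j0.
Proof.
move=> hi hj hC hu; rewrite (bigD1 (Ordinal hj)) //= (bigD1 (Ordinal hi)) //=.
rewrite hC mulr1 !big1 ?addr0 // => [j jj|i ii].
  rewrite big1 // => i _; case: (boolP (C i j)) => [/hu[_ e]|_]; last by rewrite mulr0.
  by move: jj; rewrite -(inj_eq val_inj) /= e eqxx.
case: (boolP (C i j0)) => [/hu[e _]|_]; last by rewrite mulr0.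
by move: ii; rewrite -(inj_eq val_inj) /= e eqxx.
Qed.

Lemma sum2_none (N : nat) (F : nat -> nat -> K) (C : nat -> nat -> bool) :
  (forall i j, ~~ C i j) -> \sum_(j < N) \sum_(i < N) F i j * (C i j)%:R = 0.
Proof.
by move=> h; rewrite big1 // => j _; rewrite big1 // => i _; rewrite (negbTE (h _ _)) mulr0.
Qed.

Lemma cf_iot f i j : cf (iot f) (i + j) (2 * i) = cf f i j.
Proof.
rewrite iotE (@cf_subst2_mon _ _ _ _ _ _ _ _ _ _ (i + j + 2 * i).+1) //.
by rewrite (@sum2_single _ _ (fun i' j' => (i + j == i' * 1 + j' * 1) &&
  (2 * i == i' * 2 + j' * 0))%N i j) //; lia.
Qed.

Lemma cf_iot0 f P Q : (forall i j, P = i + j -> Q = 2 * i -> False)%N ->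
  cf (iot f) P Q = 0.
Proof.
move=> h; rewrite iotE (@cf_subst2_mon _ _ _ _ _ _ _ _ _ _ (P + Q).+1) //.
rewrite (@sum2_none _ _ (fun i' j' => (P == i' * 1 + j' * 1) &&
  (Q == i' * 2 + j' * 0))%N) // => i j; apply/negP => /andP[/eqP h1 /eqP h2].
by apply: (h i j); lia.
Qed.

Lemma cf_tau f i j : cf (tau f) (2 * j) (i + j) = cf f i j.
Proof.
rewrite tauE (@cf_subst2_mon _ _ _ _ _ _ _ _ _ _ (i + j + 2 * j).+1); last lia.
by rewrite (@sum2_single _ _ (fun i' j' => (2 * j == i' * 0 + j' * 2) &&
  (i + j == i' * 1 + j' * 1))%N i j) //; lia.
Qed.

Lemma cf_tau0 f P Q : (forall i j, P = 2 * j -> Q = i + j -> False)%N ->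
  cf (tau f) P Q = 0.
Proof.
move=> h; rewrite tauE (@cf_subst2_mon _ _ _ _ _ _ _ _ _ _ (P + Q).+1) //.
rewrite (@sum2_none _ _ (fun i' j' => (P == i' * 0 + j' * 2) &&
  (Q == i' * 1 + j' * 1))%N) // => i j; apply/negP => /andP[/eqP h1 /eqP h2].
by apply: (h i j); lia.
Qed.

(** The functional equation b^6 (iot f) = - lam (a b)^(2k) (tau f). *)
Definition twisted (lam : K) k f :=
  mon K 0 6 * iot f = - (ac lam * (mon K (2 * k) (2 * k) * tau f)).

(** The monomials x^i y^j of f satisfy i - j = e mod 6; supports are additive
    under products. *)
Definition supp6 e f := forall i j, (i != j + e %[mod 6])%N -> cf f i j = 0.

Lemma twisted_coef lam k f P Q : twisted lam k f ->
  (if (6 <= Q)%N then cf (iot f) P (Q - 6)%N else 0) =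
  - (lam * if (2 * k <= P)%N && (2 * k <= Q)%N then cf (tau f) (P - 2 * k)%N (Q - 2 * k)%N else 0).
Proof.
move=> hf; have eL := cf_monM 0 6 (iot f) P Q; rewrite /= subn0 in eL.
have eR := cf_monM (2 * k) (2 * k) (tau f) P Q.
have e : cf (mon K 0 6 * iot f) P Q = - (lam * cf (mon K (2 * k) (2 * k) * tau f) P Q).
  by rewrite -cf_acM -cfN hf.
exact: etrans (esym eL) (etrans e (congr1 (fun z => - (lam * z)) eR)).
Qed.

(** The monomial x^i y^j contributes to a^(i+j) b^(2i+6) on the left of the
    equation and to a^(2j+2k) b^(i+j+2k) on the right.  Comparing the difference
    of exponents, the coefficients with i - j = d on the left face those
    with i - j = d + 6 on the right, and each coefficient is faced by one only. *)
Lemma twisted_col_up lam k f d :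
  twisted lam k f -> lam != 0 ->
  (forall i j, (Posz i - Posz j)%R = d -> cf f i j = 0) ->
  (forall i j, (Posz i - Posz j)%R = d + 6 -> cf f i j = 0).
Proof.
move=> /twisted_coef hf lam0 hd i j hij.
have := hf (2 * j + 2 * k)%N (i + j + 2 * k)%N.
rewrite (leq_addl (2 * j) (2 * k)) (leq_addl (i + j) (2 * k)) (addnK (2 * k) (2 * j)).
rewrite (addnK (2 * k) (i + j)) (cf_tau f i j) => e.
apply/eqP; rewrite -(mulrI_eq0 _ (mulfI lam0)) -oppr_eq0 -e; apply/eqP.
case: ifP => // h6.
case: (pselect (exists i' j', 2 * j + 2 * k = i' + j' /\ i + j + 2 * k - 6 = 2 * i'))%N.
  move=> [i' [j' [e1 e2]]]; rewrite e1 e2 cf_iot; apply: hd; move: e1 e2 h6 hij; lia.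
by move=> h; apply: cf_iot0 => i' j' e1 e2; apply: h; exists i', j'.
Qed.

Lemma twisted_col_down lam k f d :
  twisted lam k f ->
  (forall i j, (Posz i - Posz j)%R = d + 6 -> cf f i j = 0) ->
  (forall i j, (Posz i - Posz j)%R = d -> cf f i j = 0).
Proof.
move=> /twisted_coef hf hd i j hij.
have := hf (i + j)%N (2 * i + 6)%N; rewrite (leq_addl (2 * i) 6) (addnK 6 (2 * i)) (cf_iot f i j) => ->.
case: ifP => [/andP[h1 h2]|_]; last by rewrite mulr0 oppr0.
case: (pselect (exists i' j', i + j - 2 * k = 2 * j' /\ 2 * i + 6 - 2 * k = i' + j'))%N.
  move=> [i' [j' [e1 e2]]]; rewrite e1 e2 cf_tau hd ?mulr0 ?oppr0 //.
  move: e1 e2 h1 h2 hij; lia.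
move=> h; rewrite cf_tau0 ?mulr0 ?oppr0 // => i' j' e1 e2; apply: h; exists i', j'.
by [].
Qed.

(** From i = j the vanishing propagates to all i = j mod 6, upwards and
    downwards in steps of 6. *)
Lemma twisted_eq0 lam k f : twisted lam k f -> lam != 0 -> supp6 0 f ->
  (forall m, cf f m m = 0) -> f = 0.
Proof.
move=> hf lam0 hs h0; apply: ps2P => i j; rewrite cf0.
have hup n : forall i j, (Posz i - Posz j)%R = (6 * n)%N%:Z -> cf f i j = 0.
  elim: n => [|n IH] i1 j1 e; last first.
    by apply: (twisted_col_up hf lam0 IH); rewrite e; lia.
  by rewrite (_ : i1 = j1) //; lia.
have hdn n : forall i j, (Posz i - Posz j)%R = - (6 * n)%N%:Z -> cf f i j = 0.
  elim: n => [|n IH] i1 j1 e; last first.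
    by apply: (twisted_col_down (d := - (6 * n.+1)%N%:Z) hf _ e) => i2 j2 e2; apply: IH; lia.
  by rewrite (_ : i1 = j1) //; lia.
have [/eqP e|/hs//] := boolP (i == j + 0 %[mod 6])%N; rewrite addn0 in e.
have [ij|ji] := leqP i j.
  by apply: (hdn ((j - i) %/ 6)%N); lia.
by apply: (hup ((i - j) %/ 6)%N); lia.
Qed.

End Twist.

(** * Restriction to the diagonal and proportionality of solutions *)

Section Ps2Evaluation.
Variable K : fieldType.
Implicit Types (f g : ps2 K) (phi : powser K).

(** The derivation x d/dx - y d/dy, which kills every series in r = x y. *)
Definition der f : ps2 K := Fps (fun j => Powser (fun i => (i%:R - j%:R) * cf f i j)).

Lemma cf_der f i j : cf (der f) i j = (i%:R - j%:R) * cf f i j.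
Proof. by []. Qed.

Lemma derB : {morph der : f g / f - g}.
Proof. by move=> f g; apply: ps2P => i j; rewrite cfB !cf_der cfB mulrBr. Qed.

Lemma der_vge n f : vge n f -> vge n (der f).
Proof. by move=> hf; apply/ps2_vgeP => i j h; rewrite cf_der (iffLR (@ps2_vgeP _ n f) hf) ?mulr0. Qed.

Lemma derM f g : der (f * g) = der f * g + f * der g.
Proof.
apply: ps2P => i j; rewrite cf_der cfD !cfM mulr_sumr -big_split; apply: eq_bigr => l _ /=.
rewrite mulr_sumr -big_split; apply: eq_bigr => k _ /=; rewrite !cf_der.
by rewrite !natrB ?leq_ord //; ring.
Qed.

Lemma der_ac c : der (ac c) = 0.
Proof.
apply: ps2P => i j; rewrite cf_der cf0 (cf_const c).
by case: i => [|i]; case: j => [|j]; rewrite ?subrr ?mul0r ?mulr0.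
Qed.

Lemma der_mon p q : der (mon K p q) = (p%:R - q%:R) * mon K p q.
Proof.
apply: ps2P => i j; rewrite cf_der -[X in _ = cf (X * _) _ _](_ : ac (p%:R - q%:R) = _).
  rewrite cf_acM cf_mon; case: (altP (i =P p)) => [->|_]; last by rewrite !mulr0.
  by case: (altP (j =P q)) => [->|_] //; rewrite !mulr0.
by rewrite rmorphB !rmorph_nat.
Qed.

Lemma der_asum (F : nat -> ps2 K) : (forall n, vge n (F n)) ->
  der (asum F) = asum (fun n => der (F n)).
Proof. by apply: asum_morph; [exact: derB | exact: der_vge]. Qed.

Fact diag_key : unit. Proof. by []. Qed.
(** Restriction to the line x = y = rho, where r = rho^2. *)
Definition diag : ps2 K -> powser K := locked_with diag_key (subst2 (vge_var K) (vge_var K)).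
Lemma diagE : diag = subst2 (vge_var K) (vge_var K). Proof. by rewrite /diag unlock. Qed.
Lemma diag_zmod : zmod_morphism diag. Proof. by rewrite diagE; exact: rmorphB. Qed.
Lemma diag_monoid : monoid_morphism diag. Proof. by rewrite diagE; exact: subst2_monoid. Qed.
HB.instance Definition _ := GRing.isZmodMorphism.Build _ _ diag diag_zmod.
HB.instance Definition _ := GRing.isMonoidMorphism.Build _ _ diag diag_monoid.
Lemma diag_adic : adic_hom diag. Proof. by rewrite diagE; exact: subst2_adic. Qed.
Lemma diag_mon p q : diag (mon K p q) = ps_var K ^+ (p + q).
Proof. by rewrite diagE subst2_mon exprD. Qed.

(** First derivative across the line x = y. *)
Definition diag1 f : powser K := diag (der f).

Lemma diag1M f g : diag1 (f * g) = diag1 f * diag g + diag f * diag1 g.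
Proof. by rewrite /diag1 derM rmorphD !rmorphM. Qed.

Lemma diag1B : {morph diag1 : f g / f - g}.
Proof. by move=> f g; rewrite /diag1 derB rmorphB. Qed.

Lemma diag1_asum (F : nat -> ps2 K) : (forall n, vge n (F n)) ->
  diag1 (asum F) = asum (fun n => diag1 (F n)).
Proof.
move=> hF; rewrite /diag1 der_asum // (adic_hom_asum diag_adic) // => n.
exact: der_vge.
Qed.

Lemma diag1_ac c : diag1 (ac c) = 0.
Proof. by rewrite /diag1 der_ac rmorph0. Qed.

Lemma diag1_mon p q : diag1 (mon K p q) = (p%:R - q%:R) * ps_var K ^+ (p + q).
Proof. by rewrite /diag1 der_mon rmorphM rmorphB !rmorph_nat /= diag_mon. Qed.

Lemma vge_r : vge 1 (mon K 1 1). Proof. exact: mon_vge1. Qed.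
Lemma vge_r2 : vge 1 (mon K 2 2). Proof. exact: mon_vge1. Qed.
Lemma vge_var2 : vge 1 (ps_var K ^+ 2).
Proof. by apply: (@vge_leq _ _ _ 2) => //; apply: vgeX; exact: vge_var. Qed.

Fact emb_key : unit. Proof. by []. Qed.
(** phi(r), with r = x y. *)
Definition emb : powser K -> ps2 K := locked_with emb_key (pscomp (@ac K (ps2 K)) vge_r).
Lemma embE : emb = pscomp (@ac K (ps2 K)) vge_r. Proof. by rewrite /emb unlock. Qed.
Lemma emb_zmod : zmod_morphism emb. Proof. by rewrite embE; exact: rmorphB. Qed.
Lemma emb_monoid : monoid_morphism emb. Proof. by rewrite embE; exact: pscomp_monoid. Qed.
HB.instance Definition _ := GRing.isZmodMorphism.Build _ _ emb emb_zmod.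
HB.instance Definition _ := GRing.isMonoidMorphism.Build _ _ emb emb_monoid.
Lemma emb_adic : adic_hom emb. Proof. by rewrite embE; exact: pscomp_adic. Qed.
Lemma emb_var : emb (ps_var K) = mon K 1 1. Proof. by rewrite embE; exact: pscomp_var. Qed.

Lemma embM phi psi : emb (phi * psi) = emb phi * emb psi. Proof. exact: rmorphM. Qed.

Fact dbl_key : unit. Proof. by []. Qed.
(** phi(rho^2), the restriction of phi(r) to the line x = y. *)
Definition dbl : powser K -> powser K := locked_with dbl_key (pscomp (@ac K (powser K)) vge_var2).
Lemma dblE : dbl = pscomp (@ac K (powser K)) vge_var2. Proof. by rewrite /dbl unlock. Qed.
Lemma dbl_zmod : zmod_morphism dbl. Proof. by rewrite dblE; exact: rmorphB. Qed.
Lemma dbl_monoid : monoid_morphism dbl. Proof. by rewrite dblE; exact: pscomp_monoid. Qed.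
HB.instance Definition _ := GRing.isZmodMorphism.Build _ _ dbl dbl_zmod.
HB.instance Definition _ := GRing.isMonoidMorphism.Build _ _ dbl dbl_monoid.
Lemma dbl_adic : adic_hom dbl. Proof. by rewrite dblE; exact: pscomp_adic. Qed.
Lemma dbl_var : dbl (ps_var K) = ps_var K ^+ 2. Proof. by rewrite dblE; exact: pscomp_var. Qed.

Lemma iot_emb phi : iot (emb phi) = pscomp (@ac K (ps2 K)) vge_r2 phi.
Proof.
have h : vge 1 (iot (mon K 1 1)) by rewrite iot_mon; exact: vge_r2.
rewrite embE (adic_hom_pscomp (iot_adic K) _ h) /pscomp.
by rewrite /= iot_mon.
Qed.

Lemma tau_emb phi : tau (emb phi) = pscomp (@ac K (ps2 K)) vge_r2 phi.
Proof.
have h : vge 1 (tau (mon K 1 1)) by rewrite tau_mon; exact: vge_r2.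
rewrite embE (adic_hom_pscomp (tau_adic K) _ h) /pscomp.
by rewrite /= tau_mon.
Qed.

Lemma diag_emb phi : diag (emb phi) = dbl phi.
Proof.
have h : vge 1 (diag (mon K 1 1)) by rewrite diag_mon; exact: vge_var2.
rewrite embE (adic_hom_pscomp diag_adic _ h) dblE /pscomp.
by rewrite /= diag_mon.
Qed.

Lemma diag1_emb phi : diag1 (emb phi) = 0.
Proof.
rewrite embE pscompE diag1_asum => [|n]; last first.
  by apply: (csum_term (@ac K (ps2 K)) phi); exact: vge_r.
apply: asum_eq0 => n; rewrite diag1M diag1_ac mul0r add0r monX diag1_mon.
by rewrite subrr mul0r mulr0.
Qed.

Lemma dbl_inj : injective dbl.
Proof.
move=> f g fg; apply: powserP => n.
have E h : dbl h (n + n)%N = h n.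
  rewrite dblE pscompE (@ps_coef_asum _ _ (n + n).+1) // => [|k]; last first.
    by apply: (csum_term (@ac K (powser K)) h); exact: vge_var2.
  have nn : (n < (n + n).+1)%N by rewrite ltnS leq_addr.
  rewrite (bigD1 (Ordinal nn)) //= big1 ?addr0 => [|i].
    by rewrite ps_coef_acM -exprM ps_coefXn mul2n addnn eqxx mulr1.
  rewrite -(inj_eq val_inj) /= => ni.
  rewrite ps_coef_acM -exprM ps_coefXn (_ : (n + n == 2 * i)%N = false) ?mulr0 //.
  by apply/eqP; move/eqP: ni; lia.
by rewrite -E fg E.
Qed.

Lemma cf_emb phi i j : cf (emb phi) i j = phi i * (i == j)%:R.
Proof.
rewrite embE pscompE (@cf_asum _ _ (i + j).+1) // => [|n]; last first.
  by apply: (csum_term (@ac K (ps2 K)) phi); exact: vge_r.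
have ii : (i < (i + j).+1)%N by rewrite ltnS leq_addr.
rewrite (bigD1 (Ordinal ii)) //= big1 ?addr0 => [|n].
  by rewrite cf_acM monX cf_mon !muln1 eqxx eq_sym.
rewrite -(inj_eq val_inj) /= => ni.
by rewrite cf_acM monX cf_mon !muln1 eq_sym (negbTE ni) mulr0.
Qed.

(** The coefficients with i = j, as a series in r; this map is linear over the
    series in r. *)
Definition ccol f : powser K := Powser (fun m => cf f m m).

Lemma ccolB f g : ccol (f - g) = ccol f - ccol g.
Proof. apply: powserP => m; rewrite ps_coefB; exact: cfB. Qed.

Lemma ccol_emb phi f : ccol (emb phi * f) = phi * ccol f.
Proof.
apply: powserP => m; rewrite ps_coefM -[LHS]/(cf (emb phi * f) m m) cfM.
apply: eq_bigr => l _; rewrite (bigD1 l) //= big1 ?addr0.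
  by rewrite cf_emb eqxx mulr1.
by move=> k kl; rewrite cf_emb (inj_eq val_inj) (negbTE kl) mulr0 mul0r.
Qed.

Lemma supp6B e f g : supp6 e f -> supp6 e g -> supp6 e (f - g).
Proof. by move=> hf hg i j h; rewrite cfB hf ?hg ?subrr. Qed.

Lemma supp6M e e' f g : supp6 e f -> supp6 e' g -> supp6 (e + e') (f * g).
Proof.
move=> hf hg i j h; rewrite cfM big1 // => l _; rewrite big1 // => k _.
have [kl|kl] := eqVneq (k %% 6)%N ((l + e) %% 6)%N; last by rewrite hf ?mul0r.
have [kl'|kl'] := eqVneq ((i - k) %% 6)%N ((j - l + e') %% 6)%N; last by rewrite hg ?mulr0.
case/negP: h; apply/eqP; have := leq_ord k; have := leq_ord l; lia.
Qed.

Lemma supp6_mod e e' f : (e = e' %[mod 6])%N -> supp6 e f -> supp6 e' f.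
Proof. by move=> ee hf i j h; apply: hf; lia. Qed.

Lemma supp6_asum e (F : nat -> ps2 K) : (forall n, vge n (F n)) ->
  (forall n, supp6 e (F n)) -> supp6 e (asum F).
Proof.
move=> hF hs i j h; rewrite (cf_asum hF (ltnSn (i + j))) big1 // => n _.
exact: hs.
Qed.

Lemma supp6_mon p q : supp6 (p + 5 * q) (mon K p q).
Proof.
move=> i j h; rewrite cf_mon; case: (boolP (_ && _)) => // /andP[/eqP ip /eqP jq].
by case/negP: h; apply/eqP; lia.
Qed.

Lemma supp6_ac c : supp6 0 (ac c : ps2 K).
Proof.
move=> i j h; rewrite (cf_const c); case: (boolP (_ && _)) => //= /andP[/eqP i0 /eqP j0].
by case/negP: h; rewrite i0 j0.
Qed.

Lemma supp6_emb phi : supp6 0 (emb phi).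
Proof.
move=> i j h; rewrite cf_emb; case: (boolP (i == j)) => [/eqP ij|]; last by rewrite mulr0.
by case/negP: h; rewrite ij addn0.
Qed.

Lemma twistedB lam k f g : twisted lam k f -> twisted lam k g -> twisted lam k (f - g).
Proof. by rewrite /twisted !rmorphB /= => hf hg; rewrite mulrBr hf hg; ring. Qed.

Lemma twisted_emb lam k phi f : twisted lam k f -> twisted lam k (emb phi * f).
Proof. by rewrite /twisted !rmorphM /= iot_emb tau_emb => hf; rewrite mulrCA hf; ring. Qed.

Section Wronskian.
Variables (lam : K) (k : nat) (f g : ps2 K).
Hypotheses (lam0 : lam != 0) (tf : twisted lam k f) (tg : twisted lam k g).
Hypotheses (sf : supp6 0 f) (sg : supp6 0 g).

(** The difference of the two sides is a solution again, since [iot] and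
    [tau] agree on series in r, and its coefficients with i = j vanish. *)
Lemma twisted_proportional : emb (ccol g) * f = emb (ccol f) * g.
Proof.
apply/eqP; rewrite -subr_eq0; apply/eqP.
apply: (@twisted_eq0 _ lam k _ _ lam0).
- by apply: twistedB; apply: twisted_emb.
- by apply: supp6B; rewrite -[0%N]addn0; apply: supp6M => //; apply: supp6_emb.
move=> m; have : ccol (emb (ccol g) * f - emb (ccol f) * g) = 0.
  by rewrite ccolB !ccol_emb mulrC subrr.
by move=> /(congr1 (fun h : powser K => h m)); rewrite ps_coef0.
Qed.

Lemma twisted_ccol_neq0 : g != 0 -> ccol g != 0.
Proof.
apply: contraNneq => c0; rewrite (twisted_eq0 tg) // => m.
by have := congr1 (fun h : powser K => h m) c0; rewrite ps_coef0.
Qed.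

(** Two proportional functions have the same logarithmic derivative; the
    factors of proportionality are series in r, which [der] kills. *)
Lemma twisted_wronskian : g != 0 -> diag1 f * diag g = diag1 g * diag f.
Proof.
move=> /twisted_ccol_neq0 g0.
have e := twisted_proportional.
have e1 : dbl (ccol g) * diag f = dbl (ccol f) * diag g.
  by rewrite -!diag_emb -!rmorphM e.
have e2 : dbl (ccol g) * diag1 f = dbl (ccol f) * diag1 g.
  by have := congr1 diag1 e; rewrite !diag1M !diag1_emb !mul0r !add0r !diag_emb.
have d0 : dbl (ccol g) != 0.
  by apply: contra g0 => /eqP h; apply/eqP/dbl_inj; rewrite h rmorph0.
apply: (mulfI d0); rewrite mulrA e2 mulrAC -e1 mulrAC mulrA.
by rewrite -mulrA.
Qed.

End Wronskian.
End Ps2Evaluation.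

Section HomRules.
Variable K : fieldType.

(** Closed forms of the morphism laws, one for each substitution, meant for
    rewriting large products. *)
Lemma iotB (f g : ps2 K) : iot (f - g) = iot f - iot g. Proof. exact: rmorphB. Qed.
Lemma iotN (f : ps2 K) : iot (- f) = - iot f. Proof. exact: rmorphN. Qed.
Lemma iotD (f g : ps2 K) : iot (f + g) = iot f + iot g. Proof. exact: rmorphD. Qed.
Lemma iotM (f g : ps2 K) : iot (f * g) = iot f * iot g. Proof. exact: rmorphM. Qed.
Lemma iotX (f : ps2 K) n : iot (f ^+ n) = iot f ^+ n. Proof. exact: rmorphXn. Qed.
Lemma iotac c : iot (ac c : ps2 K) = ac c. Proof. exact: (iot_adic K).2. Qed.
Definition iotS := (iotB, iotN, iotD, iotM, iotX, iotac).

Lemma tauB (f g : ps2 K) : tau (f - g) = tau f - tau g. Proof. exact: rmorphB. Qed.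
Lemma tauN (f : ps2 K) : tau (- f) = - tau f. Proof. exact: rmorphN. Qed.
Lemma tauD (f g : ps2 K) : tau (f + g) = tau f + tau g. Proof. exact: rmorphD. Qed.
Lemma tauM (f g : ps2 K) : tau (f * g) = tau f * tau g. Proof. exact: rmorphM. Qed.
Lemma tauX (f : ps2 K) n : tau (f ^+ n) = tau f ^+ n. Proof. exact: rmorphXn. Qed.
Lemma tauac c : tau (ac c : ps2 K) = ac c. Proof. exact: (tau_adic K).2. Qed.
Definition tauS := (tauB, tauN, tauD, tauM, tauX, tauac).

Lemma diagB (f g : ps2 K) : diag (f - g) = diag f - diag g. Proof. exact: rmorphB. Qed.
Lemma diagN (f : ps2 K) : diag (- f) = - diag f. Proof. exact: rmorphN. Qed.
Lemma diagD (f g : ps2 K) : diag (f + g) = diag f + diag g. Proof. exact: rmorphD. Qed.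
Lemma diagM (f g : ps2 K) : diag (f * g) = diag f * diag g. Proof. exact: rmorphM. Qed.
Lemma diagX (f : ps2 K) n : diag (f ^+ n) = diag f ^+ n. Proof. exact: rmorphXn. Qed.
Lemma diagac c : diag (ac c : ps2 K) = ac c. Proof. exact: (diag_adic K).2. Qed.
Definition diagS := (diagB, diagN, diagD, diagM, diagX, diagac).

Lemma dblB (f g : powser K) : dbl (f - g) = dbl f - dbl g. Proof. exact: rmorphB. Qed.
Lemma dblM (f g : powser K) : dbl (f * g) = dbl f * dbl g. Proof. exact: rmorphM. Qed.
Lemma dblX (f : powser K) n : dbl (f ^+ n) = dbl f ^+ n. Proof. exact: rmorphXn. Qed.
Lemma dbl1 : dbl (1 : powser K) = 1. Proof. exact: rmorph1. Qed.
Lemma dblac c : dbl (ac c : powser K) = ac c. Proof. exact: (dbl_adic K).2. Qed.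
Definition dblS := (dblB, dblM, dblX, dbl1, dblac, dbl_var).

End HomRules.

(** * Theta series *)

Definition tri n := (n * n.+1)./2.

Lemma tri0 : tri 0 = 0%N. Proof. by []. Qed.

Lemma triS n : tri n.+1 = (tri n + n.+1)%N.
Proof. rewrite /tri; nia. Qed.

Lemma tri_ge n : (n <= tri n)%N.
Proof. by elim: n => // n IH; rewrite triS; lia. Qed.

Section Theta.
Variables (K : fieldType) (B : adicAlgType K).
Implicit Types (X Y U V w z c : B).

Lemma vge_XY n a b c X Y : vge 1 X -> vge 1 Y -> (n <= a + b)%N ->
  vge n (c * (X ^+ a * Y ^+ b)).
Proof.
move=> hX hY nab; apply: vgeMl; apply: vge_leq nab _; apply: vgeM; exact: vgeX.
Qed.

Lemma vge_X n a c X : vge 1 X -> (n <= a)%N -> vge n (c * X ^+ a).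
Proof. by move=> hX na; apply: vgeMl; apply: vge_leq na _; exact: vgeX. Qed.

(** Ramanujan's theta function f(-X,-Y), with the opposite sign:
    minus the sum over m in Z of (-1)^m X^(m(m+1)/2) Y^(m(m-1)/2).  The terms
    m = n + 1 and m = - (n + 1) are paired, and the subtraction of 1 is
    the term m = 0. *)
Definition ram X Y : B :=
  asum (fun n => (-1) ^+ n * (X ^+ tri n.+1 * Y ^+ tri n + X ^+ tri n * Y ^+ tri n.+1)) - 1.

Lemma ram_term X Y n : vge 1 X -> vge 1 Y ->
  vge n ((-1) ^+ n * (X ^+ tri n.+1 * Y ^+ tri n + X ^+ tri n * Y ^+ tri n.+1)).
Proof.
by move=> hX hY; rewrite mulrDr; apply: vgeD; apply: vge_XY => //; have := tri_ge n; lia.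
Qed.

Lemma ramC X Y : ram X Y = ram Y X.
Proof.
congr (_ - _); apply: eq_asum => n; congr (_ * _).
by rewrite addrC; congr (_ + _); rewrite mulrC.
Qed.

(** The odd theta function: the bilateral sum over m in Z, with the terms
    m = n and m = - n - 1 paired. *)
Definition alt U V : B :=
  asum (fun n => (-1) ^+ n * (U ^+ (3 * tri n + n.+1) * V ^+ (3 * tri n - n)
                              - U ^+ (3 * tri n - n) * V ^+ (3 * tri n + n.+1))).

Lemma alt_term U V n : vge 1 U -> vge 1 V ->
  vge n ((-1) ^+ n * (U ^+ (3 * tri n + n.+1) * V ^+ (3 * tri n - n)
                              - U ^+ (3 * tri n - n) * V ^+ (3 * tri n + n.+1))).
Proof.
by move=> hX hY; rewrite mulrBr; apply: vgeB; apply: vge_XY => //; have := tri_ge n; lia.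
Qed.

Lemma altC U V : vge 1 U -> vge 1 V -> alt U V = - alt V U.
Proof.
move=> hU hV; rewrite -asumN => [|n]; last exact: alt_term.
by apply: eq_asum => n; ring.
Qed.

Lemma alt_diag U : alt U U = 0.
Proof. by apply: asum_eq0 => n; rewrite [X in _ - X]mulrC subrr mulr0. Qed.

(** Quasi-periodicity of the bilateral sum behind [alt]: for U = V w, the
    terms with exponents decreasing in w are shifted by one index and become the
    second half of [ram]. *)
Lemma alt_ram V w : vge 1 V -> vge 1 w -> alt (V * w) V = V * ram w (V ^+ 6 * w ^+ 2).
Proof.
move=> hV hw.
pose p n : B := (-1) ^+ n * (w ^+ (3 * tri n + n.+1) * V ^+ (6 * tri n)).
pose m n : B := (-1) ^+ n * (w ^+ (3 * tri n - n) * V ^+ (6 * tri n)).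
have hp n : vge n (p n) by apply: vge_XY => //; have := tri_ge n; lia.
have hm n : vge n (m n) by apply: vge_XY => //; have := tri_ge n; lia.
have hmS n : vge n (m n.+1) by apply: vge_leq (hm n.+1).
transitivity (V * (asum p - asum m)).
  rewrite -asumB // -asumMl => [|n]; last exact: vgeB.
  apply: eq_asum => n; rewrite !exprMn /p /m.
  have e1 : V ^+ (3 * tri n + n.+1) * V ^+ (3 * tri n - n) = V * V ^+ (6 * tri n).
    by rewrite -exprD -exprS; congr (_ ^+ _); have := tri_ge n; lia.
  have e2 : V ^+ (3 * tri n - n) * V ^+ (3 * tri n + n.+1) = V * V ^+ (6 * tri n).
    by rewrite mulrC.
  transitivity ((-1) ^+ n * (w ^+ (3 * tri n + n.+1) *
      (V ^+ (3 * tri n + n.+1) * V ^+ (3 * tri n - n)) -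
     w ^+ (3 * tri n - n) * (V ^+ (3 * tri n - n) * V ^+ (3 * tri n + n.+1)))); first ring.
  by rewrite e1 e2; ring.
congr (V * _); rewrite (asum_recl hm).
have -> : m 0%N = 1 by rewrite /m tri0 !muln0 subn0 !expr0 !mulr1.
rewrite opprD addrCA addrC; congr (_ - 1).
rewrite -asumB //; apply: eq_asum => n; rewrite /p /m mulrDr; congr (_ + _).
  congr (_ * _); rewrite exprMn -!exprM mulrCA mulrC -exprD; congr (_ ^+ _ * _ ^+ _); rewrite triS; lia.
rewrite exprS mulN1r mulNr opprK; congr (_ * _).
rewrite exprMn -!exprM mulrCA mulrC -exprD.
by congr (_ ^+ _ * _ ^+ _); rewrite triS; have := tri_ge n; lia.
Qed.

(** With q = z^3, one has T_0(q,q^3) = [thq], T_1(q,q^3) = 2 [dth] - [thq],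
    T_1(q^2,q^3) = - 2 [dth] - [thq], T_1(1,q^3) = 2 [odd_sum], and
    4 T_0(q,q^3) + 6 T_1(q,q^3) = 2 [lam_num]; with u = s z^(-2), also
    T_0(u,q) = u [G0] and T_1(u,q) = u ([G0] - 2 [G1]). *)
Definition thq z := ram (z ^+ 3) (z ^+ 6).
Definition dth z := asum (fun n => (-1) ^+ n * n.+1%:R *
  (z ^+ (3 * tri n.+1 + 6 * tri n) - z ^+ (3 * tri n + 6 * tri n.+1))).
Definition odd_sum z := asum (fun n => (-1) ^+ n * (2 * n + 1)%:R * z ^+ (9 * tri n)).
Definition lam_num z := 6%:R * dth z - thq z.
Definition G0 (s : K) z := asum (fun n => (-1) ^+ n *
  (ac (s ^+ n) * z ^+ (3 * tri n - 2 * n) - ac (s ^- n.+1) * z ^+ (3 * tri n + 2 * n.+1))).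
Definition G1 (s : K) z := asum (fun n => (-1) ^+ n *
  (- n%:R * ac (s ^+ n) * z ^+ (3 * tri n - 2 * n)
   - n.+1%:R * ac (s ^- n.+1) * z ^+ (3 * tri n + 2 * n.+1))).

Lemma dth_term z n : vge 1 z -> vge n ((-1) ^+ n * n.+1%:R *
  (z ^+ (3 * tri n.+1 + 6 * tri n) - z ^+ (3 * tri n + 6 * tri n.+1))).
Proof. by move=> hz; rewrite mulrBr; apply: vgeB; apply: vge_X => //; have := tri_ge n; lia. Qed.

Lemma odd_sum_term z n : vge 1 z -> vge n ((-1) ^+ n * (2 * n + 1)%:R * z ^+ (9 * tri n)).
Proof. by move=> hz; apply: vge_X => //; have := tri_ge n; lia. Qed.

Lemma G0_term s z n : vge 1 z -> vge n ((-1) ^+ n *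
  (ac (s ^+ n) * z ^+ (3 * tri n - 2 * n) - ac (s ^- n.+1) * z ^+ (3 * tri n + 2 * n.+1))).
Proof.
by move=> hz; apply: vgeMl; apply: vgeB; apply: vge_X => //; have := tri_ge n; lia.
Qed.

Lemma G1_term s z n : vge 1 z -> vge n ((-1) ^+ n *
  (- n%:R * ac (s ^+ n) * z ^+ (3 * tri n - 2 * n)
   - n.+1%:R * ac (s ^- n.+1) * z ^+ (3 * tri n + 2 * n.+1))).
Proof.
by move=> hz; apply: vgeMl; apply: vgeB; apply: vge_X => //; have := tri_ge n; lia.
Qed.

End Theta.

Lemma vgeXS (K : fieldType) (B : adicAlgType K) (z : B) n : vge 1 z -> vge 1 (z ^+ n.+1).
Proof. by move=> hz; apply: (@vge_leq _ _ 1 n.+1) => //; apply: vgeX. Qed.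

Section ThetaHom.
Variables (K K' : fieldType) (B : adicAlgType K) (B' : adicAlgType K').
Variable phi : {rmorphism B -> B'}.
Hypothesis hphi : forall n f, vge n f -> vge n (phi f).
Implicit Types (X Y U V z : B).

Let hasum (F : nat -> B) : (forall n, vge n (F n)) ->
  phi (asum F) = asum (fun n => phi (F n)).
Proof. by apply: asum_morph => //; exact: rmorphB. Qed.

Lemma ram_hom X Y : vge 1 X -> vge 1 Y -> phi (ram X Y) = ram (phi X) (phi Y).
Proof.
move=> hX hY; rewrite /ram rmorphB rmorph1 hasum => [|n]; last exact: ram_term.
by congr (_ - _); apply: eq_asum => n; rewrite rmorphM rmorphD !rmorphM !rmorphXn rmorphN1.
Qed.

Lemma alt_hom U V : vge 1 U -> vge 1 V -> phi (alt U V) = alt (phi U) (phi V).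
Proof.
move=> hX hY; rewrite /alt hasum => [|n]; last exact: alt_term.
by apply: eq_asum => n; rewrite rmorphM rmorphB !rmorphM !rmorphXn rmorphN1.
Qed.

Lemma thq_hom z : vge 1 z -> phi (thq z) = thq (phi z).
Proof. by move=> hz; rewrite /thq ram_hom ?rmorphXn //; exact: vgeXS. Qed.

Lemma dth_hom z : vge 1 z -> phi (dth z) = dth (phi z).
Proof.
move=> hz; rewrite /dth hasum => [|n]; last exact: dth_term.
by apply: eq_asum => n; rewrite !rmorphM rmorphB !rmorphXn rmorphN1 rmorph_nat.
Qed.

Lemma odd_sum_hom z : vge 1 z -> phi (odd_sum z) = odd_sum (phi z).
Proof.
move=> hz; rewrite /odd_sum hasum => [|n]; last exact: odd_sum_term.
by apply: eq_asum => n; rewrite !rmorphM !rmorphXn rmorphN1 rmorph_nat.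
Qed.

Lemma lam_num_hom z : vge 1 z -> phi (lam_num z) = lam_num (phi z).
Proof. by move=> hz; rewrite /lam_num rmorphB rmorphM rmorph_nat dth_hom // thq_hom. Qed.

End ThetaHom.

Section ThetaScalarHom.
Variables (K : fieldType) (B B' : adicAlgType K) (phi : {rmorphism B -> B'}).
Hypothesis hphi : adic_hom phi.
Implicit Types z : B.

Lemma G0_hom s z : vge 1 z -> phi (G0 s z) = G0 s (phi z).
Proof.
move=> hz; rewrite /G0 (adic_hom_asum hphi) => [|n]; last exact: G0_term.
by apply: eq_asum => n; rewrite rmorphM rmorphB !rmorphM !rmorphXn rmorphN1 !hphi.2.
Qed.

Lemma G1_hom s z : vge 1 z -> phi (G1 s z) = G1 s (phi z).
Proof.
move=> hz; rewrite /G1 (adic_hom_asum hphi) => [|n]; last exact: G1_term.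
apply: eq_asum => n; rewrite rmorphM rmorphB !rmorphM !rmorphXn !rmorphN1 rmorphN.
by rewrite !rmorph_nat !hphi.2.
Qed.
End ThetaScalarHom.

(** * The theta functions parametrising the kernel *)

Section Ainv.
Variables (K : fieldType) (B : adicAlgType K).
Implicit Types (f X Y : B).

(** The inverse of a series with constant term -1, by a geometric series. *)
Definition ainv f : B := - asum (fun n => (1 + f) ^+ n).

Lemma mul_ainv f : vge 1 (1 + f) -> f * ainv f = 1.
Proof.
move=> hf; rewrite /ainv mulrN -mulNr -[RHS](@geom_inverse _ _ (- f)) ?opprK //.
Qed.

Lemma not_vge1 : ~ vge 1 (1 : B).
Proof.
move=> h; have /eqP : (1 : B) = 0 by apply: vge_eq0 => n; rewrite -(expr1n _ n); exact: vgeX.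
by rewrite oner_eq0.
Qed.

Lemma nearN1_neq0 f : vge 1 (1 + f) -> f != 0.
Proof. by move=> hf; apply/eqP => f0; move: hf; rewrite f0 addr0; exact: not_vge1. Qed.

Lemma ram_near X Y : vge 1 X -> vge 1 Y -> vge 1 (1 + ram X Y).
Proof.
move=> hX hY; rewrite /ram addrCA subrr addr0; apply: vge_asum => n; first exact: ram_term.
rewrite mulrDr; apply: vgeD; apply: vge_XY => //; have := tri_ge n; rewrite triS; lia.
Qed.

End Ainv.

Section GradedSum.
Variable K : fieldType.

(** The generating function of a family of weighted words: an entry (c, a) of
    [w n] stands for a word of length n + a term c t^(n-a) X^a.  The exponent of t
    is lowered by that of X, which makes the sum converge for X of order 1 and
    matches the homogeneous form of the kernel. *)
Definition gterm (B : adicAlgType K) (w : nat -> seq (K * nat)) (t X : B) n : B :=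
  \sum_(p <- w n) ac p.1 * (t ^+ (n - p.2) * X ^+ p.2).

Definition gsum (B : adicAlgType K) (w : nat -> seq (K * nat)) (t X : B) : B :=
  asum (gterm w t X).

Lemma vge_gterm (B : adicAlgType K) w (t X : B) n : vge 1 t -> vge 1 X -> vge n (gterm w t X n).
Proof. by move=> ht hX; apply: vge_sum => p _; apply: vge_XY => //; lia. Qed.

Lemma gsum_hom (B B' : adicAlgType K) (phi : {rmorphism B -> B'}) w t X : adic_hom phi ->
  vge 1 t -> vge 1 X -> phi (gsum w t X) = gsum w (phi t) (phi X).
Proof.
move=> hphi ht hX; rewrite /gsum (adic_hom_asum hphi) => [|n]; last exact: vge_gterm.
apply: eq_asum => n; rewrite /gterm rmorph_sum; apply: eq_bigr => p _.
by rewrite !rmorphM !rmorphXn hphi.2.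
Qed.

Lemma supp6X e f n : supp6 e f -> supp6 (n * e) (f ^+ n : ps2 K).
Proof.
move=> hf; elim: n => [|n IH]; last by rewrite exprS mulSn; apply: supp6M.
by rewrite expr0 mul0n -(rmorph1 (@ac K (ps2 K))); exact: supp6_ac.
Qed.

Lemma supp60X f n : supp6 0 f -> supp6 0 (f ^+ n : ps2 K).
Proof. by move=> /(@supp6X _ _ n); rewrite muln0. Qed.

Lemma supp60M f g : supp6 0 f -> supp6 0 g -> supp6 0 (f * g : ps2 K).
Proof. exact: supp6M. Qed.

Lemma supp6N e f : supp6 e f -> supp6 e (- f : ps2 K).
Proof. by move=> hf i j h; rewrite cfN hf ?oppr0. Qed.

Lemma supp6D e f g : supp6 e f -> supp6 e g -> supp6 e (f + g : ps2 K).
Proof. by move=> hf hg i j h; rewrite cfD hf ?hg ?addr0. Qed.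

Lemma supp60_1 : supp6 0 (1 : ps2 K).
Proof. by rewrite -(rmorph1 (@ac K (ps2 K))); exact: supp6_ac. Qed.

Lemma supp60_sign n : supp6 0 ((-1) ^+ n : ps2 K).
Proof. by apply: supp60X; apply: supp6N; exact: supp60_1. Qed.

Lemma supp6_gsum w (t X : ps2 K) : vge 1 t -> vge 1 X -> supp6 0 t -> supp6 0 X ->
  supp6 0 (gsum w t X).
Proof.
move=> ht hX st sX; apply: supp6_asum => n; first exact: vge_gterm.
rewrite /gterm; apply: big_ind => [|f g|p _].
- by move=> i j _; exact: cf0.
- exact: supp6D.
by apply: supp60M; [exact: supp6_ac | apply: supp60M; exact: supp60X].
Qed.

Lemma supp6_ainv (f : ps2 K) : vge 1 (1 + f) -> supp6 0 f -> supp6 0 (ainv f).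
Proof.
move=> hf sf; apply: supp6N; apply: supp6_asum => n; first exact: vgeX.
by apply: supp60X; apply: supp6D => //; exact: supp60_1.
Qed.

Lemma supp6_ram (X Y : ps2 K) : vge 1 X -> vge 1 Y -> supp6 0 X -> supp6 0 Y ->
  supp6 0 (ram X Y).
Proof.
move=> hX hY sX sY; apply: supp6B; last exact: supp60_1.
apply: supp6_asum => n; first exact: ram_term.
apply: supp60M; first exact: supp60_sign.
by apply: supp6D; apply: supp60M; exact: supp60X.
Qed.

Lemma supp6_alt (X Y : ps2 K) : vge 1 X -> vge 1 Y -> supp6 3 X -> supp6 3 Y ->
  supp6 3 (alt X Y).
Proof.
move=> hX hY sX sY; apply: supp6_asum => n; first exact: alt_term.
rewrite -[3%N]add0n; apply: supp6M; first exact: supp60_sign.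
have e a b : (a + b = 6 * tri n + 1)%N -> supp6 3 (X ^+ a * Y ^+ b).
  move=> ab; apply: (@supp6_mod _ (a * 3 + b * 3)).
    by rewrite -mulnDl ab; lia.
  by apply: supp6M; exact: supp6X.
by apply: supp6B; apply: e; have := tri_ge n; lia.
Qed.
End GradedSum.

Section ThetaFunctions.
Variable K : fieldType.
Notation mon := (mon K).

Fact th1_key : unit. Proof. by []. Qed.
Fact th2_key : unit. Proof. by []. Qed.
Fact ph_key : unit. Proof. by []. Qed.
Fact Th0_key : unit. Proof. by []. Qed.
Fact Th1_key : unit. Proof. by []. Qed.
Fact Th2_key : unit. Proof. by []. Qed.
(** In terms of U = x^3 and V = y^3, these are the three theta functions
    f(-U^2,-U V^3), f(-V^2,-U^3 V) and its odd companion, and their three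
    common images under [iot] and [tau].  Separate locks keep the six functions apart. *)
Definition th1 : ps2 K := locked_with th1_key (ram (mon 6 0) (mon 3 9)).
Definition th2 : ps2 K := locked_with th2_key (ram (mon 0 6) (mon 9 3)).
Definition ph : ps2 K := locked_with ph_key (alt (mon 3 0) (mon 0 3)).
Definition Th0 : ps2 K := locked_with Th0_key (ram (mon 0 6) (mon 18 12)).
Definition Th1 : ps2 K := locked_with Th1_key (ram (mon 6 12) (mon 12 6)).
Definition Th2 : ps2 K := locked_with Th2_key (ram (mon 6 0) (mon 12 18)).
Lemma th1E : th1 = ram (mon 6 0) (mon 3 9). Proof. by rewrite /th1 unlock. Qed.
Lemma th2E : th2 = ram (mon 0 6) (mon 9 3). Proof. by rewrite /th2 unlock. Qed.
Lemma phE : ph = alt (mon 3 0) (mon 0 3). Proof. by rewrite /ph unlock. Qed.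
Lemma Th0E : Th0 = ram (mon 0 6) (mon 18 12). Proof. by rewrite /Th0 unlock. Qed.
Lemma Th1E : Th1 = ram (mon 6 12) (mon 12 6). Proof. by rewrite /Th1 unlock. Qed.
Lemma Th2E : Th2 = ram (mon 6 0) (mon 12 18). Proof. by rewrite /Th2 unlock. Qed.

Let hm p q := @mon_vge1 K p q.

Lemma iot_th1 : iot th1 = Th1.
Proof. by rewrite th1E Th1E (ram_hom (iot_adic K).1) /= ?iot_mon //; exact: hm. Qed.
Lemma iot_th2 : iot th2 = Th2.
Proof. by rewrite th2E Th2E (ram_hom (iot_adic K).1) /= ?iot_mon //; exact: hm. Qed.
Lemma tau_th1 : tau th1 = Th0.
Proof. by rewrite th1E Th0E (ram_hom (tau_adic K).1) /= ?tau_mon //; exact: hm. Qed.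
Lemma tau_th2 : tau th2 = Th1.
Proof. rewrite th2E Th1E (ram_hom (tau_adic K).1) /= ?tau_mon; [exact: ramC | exact: hm | exact: hm]. Qed.
(** Both substitutions send (U,V) to a pair (V' w, V'), up to exchange, so
    that [alt_ram] applies. *)
Lemma iot_ph : iot ph = mon 3 0 * Th0.
Proof.
rewrite phE Th0E (alt_hom (iot_adic K).1) /= ?iot_mon; try exact: hm.
have -> : mon (3 + 0) (2 * 3) = mon 3 0 * mon 0 6 by rewrite monM.
rewrite alt_ram; try exact: hm.
by rewrite !monX monM.
Qed.
Lemma tau_ph : tau ph = - (mon 0 3 * Th2).
Proof.
rewrite phE Th2E (alt_hom (tau_adic K).1) /= ?tau_mon; try exact: hm.
rewrite altC; try exact: hm.
have -> : mon (2 * 3) (0 + 3) = mon 0 3 * mon 6 0 by rewrite monM.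
rewrite alt_ram; try exact: hm.
by rewrite !monX monM.
Qed.

Lemma th1_near : vge 1 (1 + th1). Proof. by rewrite th1E; apply: ram_near; exact: hm. Qed.
Lemma th2_near : vge 1 (1 + th2). Proof. by rewrite th2E; apply: ram_near; exact: hm. Qed.
Lemma Th0_near : vge 1 (1 + Th0). Proof. by rewrite Th0E; apply: ram_near; exact: hm. Qed.
Lemma Th1_near : vge 1 (1 + Th1). Proof. by rewrite Th1E; apply: ram_near; exact: hm. Qed.
Lemma Th2_near : vge 1 (1 + Th2). Proof. by rewrite Th2E; apply: ram_near; exact: hm. Qed.

Lemma supp6_monE p q e : (p + 5 * q = e %[mod 6])%N -> supp6 e (mon p q).
Proof. by move=> h; apply: supp6_mod h _; exact: supp6_mon. Qed.

Lemma supp6_th1 : supp6 0 th1.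
Proof. by rewrite th1E; apply: supp6_ram; [exact: hm|exact: hm|exact: supp6_monE|exact: supp6_monE]. Qed.
Lemma supp6_th2 : supp6 0 th2.
Proof. by rewrite th2E; apply: supp6_ram; [exact: hm|exact: hm|exact: supp6_monE|exact: supp6_monE]. Qed.
Lemma supp6_ph : supp6 3 ph.
Proof. by rewrite phE; apply: supp6_alt; [exact: hm|exact: hm|exact: supp6_monE|exact: supp6_monE]. Qed.

Notation rho := (ps_var K).
Let hv2 := vge_var2 K.

Lemma diag_th1 : diag th1 = thq (rho ^+ 2).
Proof.
rewrite th1E (ram_hom (diag_adic K).1) /= ?diag_mon; try exact: hm.
by rewrite /thq -!exprM.
Qed.
Lemma diag_th2 : diag th2 = thq (rho ^+ 2).
Proof.
rewrite th2E (ram_hom (diag_adic K).1) /= ?diag_mon; try exact: hm.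
by rewrite /thq -!exprM.
Qed.
Lemma diag_ph : diag ph = 0.
Proof.
rewrite phE (alt_hom (diag_adic K).1) /= ?diag_mon; try exact: hm.
exact: alt_diag.
Qed.

Lemma diag1_sign n (f : ps2 K) : diag1 ((-1) ^+ n * f) = (-1) ^+ n * diag1 f.
Proof.
have e : (-1) ^+ n = ac ((-1) ^+ n) :> ps2 K by rewrite rmorphXn rmorphN1.
by rewrite diag1M e diag1_ac mul0r add0r -e rmorphXn rmorphN1.
Qed.

Lemma diag1D (f g : ps2 K) : diag1 (f + g) = diag1 f + diag1 g.
Proof.
have d0 : diag1 (0 : ps2 K) = 0 by rewrite -(subrr 0) diag1B subrr.
by rewrite -[g in LHS]opprK diag1B -(sub0r g) diag1B d0 sub0r opprK.
Qed.

(** A monomial contributes the difference of its two exponents, which is 6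
    times the index m of the theta term. *)
Lemma diag1_th1 : diag1 th1 = 6%:R * dth (rho ^+ 2).
Proof.
rewrite th1E /ram diag1B -(rmorph1 (@ac K (ps2 K))) diag1_ac subr0 diag1_asum; last first.
  by move=> n; apply: ram_term; exact: hm.
rewrite /dth -asumMl; last by move=> n; exact: dth_term.
apply: eq_asum => n; rewrite diag1_sign !monX !monM diag1D !diag1_mon -!exprM.
rewrite (_ : (tri n.+1 * 6 + tri n * 3 + (tri n.+1 * 0 + tri n * 9) =
   2 * (3 * tri n.+1 + 6 * tri n))%N); last lia.
rewrite (_ : (tri n * 6 + tri n.+1 * 3 + (tri n * 0 + tri n.+1 * 9) =
   2 * (3 * tri n + 6 * tri n.+1))%N); last lia.
rewrite triS !natrD !natrM !natrD; ring.
Qed.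

Lemma diag1_th2 : diag1 th2 = - (6%:R * dth (rho ^+ 2)).
Proof.
rewrite th2E /ram diag1B -(rmorph1 (@ac K (ps2 K))) diag1_ac subr0 diag1_asum; last first.
  by move=> n; apply: ram_term; exact: hm.
rewrite /dth -asumMl; last by move=> n; exact: dth_term.
rewrite -asumN; last by move=> n; apply: vgeMl; exact: dth_term.
apply: eq_asum => n; rewrite diag1_sign !monX !monM diag1D !diag1_mon -!exprM.
rewrite (_ : (tri n.+1 * 0 + tri n * 9 + (tri n.+1 * 6 + tri n * 3) =
   2 * (3 * tri n.+1 + 6 * tri n))%N); last lia.
rewrite (_ : (tri n * 0 + tri n.+1 * 9 + (tri n * 6 + tri n.+1 * 3) =
   2 * (3 * tri n + 6 * tri n.+1))%N); last lia.
rewrite triS !natrD !natrM !natrD; ring.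
Qed.

Lemma diag1_ph : diag1 ph = 6%:R * rho ^+ 3 * odd_sum (rho ^+ 2).
Proof.
rewrite phE /alt diag1_asum; last by move=> n; apply: alt_term; exact: hm.
rewrite /odd_sum -asumMl; last by move=> n; exact: odd_sum_term.
apply: eq_asum => n; rewrite diag1_sign !monX !monM diag1B !diag1_mon -!exprM.
rewrite !muln0 !addn0 !add0n.
rewrite (_ : ((3 * tri n - n) * 3 + (3 * tri n + n.+1) * 3 = 3 + 2 * (9 * tri n))%N); last first.
  by have := tri_ge n; lia.
rewrite (_ : ((3 * tri n + n.+1) * 3 + (3 * tri n - n) * 3 = 3 + 2 * (9 * tri n))%N); last first.
  by have := tri_ge n; lia.
rewrite exprD !natrM natrB; last by have := tri_ge n; lia.
by rewrite !(natrD, natrM) -?natr1; ring.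
Qed.

End ThetaFunctions.

(** * The companion solution and the two sides of the theta identity *)

Section Companion.
Variables (K : fieldType) (s : K).
Hypothesis s0 : s != 0.
Notation mon := (mon K).
Notation rho := (ps_var K).

(** The terms of index n >= 0 and n < 0 of the bilateral sum
    gB = sum over n in Z of (-s)^n x^(3n(n+1)/2 - 5n + 4) y^(3n(n+1)/2 + n + 4). *)
Definition gL n : ps2 K := ac ((- s) ^+ n) * mon (3 * tri n + 4 - 5 * n) (3 * tri n + n + 4).
Definition gR n : ps2 K :=
  ac ((-1) ^+ n * s ^- n.+1) * mon (3 * tri n + 5 * n + 9) (3 * tri n + 3 - n).
Definition gB : ps2 K := asum (fun n => gL n - gR n).

Lemma tri_5 n : (5 * n <= 3 * tri n + 4)%N.
Proof.
case: n => // n; rewrite triS; case: n => // n; rewrite triS; have := tri_ge n; case: n => // n.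
by rewrite triS; have := tri_ge n; lia.
Qed.

Lemma vge_gL n : vge n (gL n).
Proof.
apply: vgeMl; apply: vge_leq (@vge_mon K _ _); have := tri_5 n; have := tri_ge n; lia.
Qed.
Lemma vge_gR n : vge n (gR n).
Proof. by apply: vgeMl; apply: vge_leq (@vge_mon K _ _); have := tri_ge n; lia. Qed.
Lemma vge_gLR n : vge n (gL n - gR n).
Proof. by apply: vgeB; [exact: vge_gL | exact: vge_gR]. Qed.

Lemma supp6_gB : supp6 0 gB.
Proof.
apply: supp6_asum => n; first exact: vge_gLR.
apply: supp6B; rewrite -[0%N]addn0; apply: supp6M; try exact: supp6_ac; apply: supp6_monE.
  by have := tri_5 n; lia.
by have := tri_ge n; lia.
Qed.

Lemma ac_sL n : (-1) ^+ n * ac (s ^+ n) = ac ((- s) ^+ n) :> powser K.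
Proof. by rewrite -(rmorphN1 (@ac K (powser K))) -rmorphXn -rmorphM -exprMn mulN1r. Qed.

Lemma diag_gB : diag gB = rho ^+ 8 * G0 s (rho ^+ 2).
Proof.
rewrite /gB (adic_hom_asum (diag_adic K)); last exact: vge_gLR.
rewrite /G0 -asumMl; last by move=> n; apply: G0_term; exact: vge_var2.
apply: eq_asum => n; rewrite rmorphB !rmorphM /= !diag_mon !(diag_adic K).2.
rewrite -!exprM -ac_sL ?rmorphM ?rmorphXn ?rmorphN1.
rewrite (_ : (3 * tri n + 4 - 5 * n + (3 * tri n + n + 4) = 8 + 2 * (3 * tri n - 2 * n))%N); last first.
  by have := tri_5 n; have := tri_ge n; lia.
rewrite (_ : (3 * tri n + 5 * n + 9 + (3 * tri n + 3 - n) = 8 + 2 * (3 * tri n + 2 * n.+1))%N); last first.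
  by have := tri_ge n; lia.
by rewrite !exprD; ring.
Qed.

Lemma diag1_acM c (f : ps2 K) : diag1 (ac c * f) = ac c * diag1 f.
Proof. by rewrite diag1M diag1_ac mul0r add0r (diag_adic K).2. Qed.

Lemma diag1_gB : diag1 gB = 6%:R * rho ^+ 8 * G1 s (rho ^+ 2).
Proof.
rewrite /gB diag1_asum; last exact: vge_gLR.
rewrite /G1 -asumMl; last by move=> n; apply: G1_term; exact: vge_var2.
apply: eq_asum => n; rewrite diag1B !diag1_acM !diag1_mon.
rewrite -!exprM -ac_sL ?rmorphM ?rmorphXn ?rmorphN1.
rewrite (_ : (3 * tri n + 4 - 5 * n + (3 * tri n + n + 4) = 8 + 2 * (3 * tri n - 2 * n))%N); last first.
  by have := tri_5 n; have := tri_ge n; lia.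
rewrite (_ : (3 * tri n + 5 * n + 9 + (3 * tri n + 3 - n) = 8 + 2 * (3 * tri n + 2 * n.+1))%N); last first.
  by have := tri_ge n; lia.
rewrite !natrB ?tri_5 //; last by have := tri_ge n; lia.
by rewrite !exprD !(natrD, natrM) -natr1; ring.
Qed.

(** The n-th term of the left-hand side is the (n-1)-st term of the right-hand
    side: the equation shifts the index of the bilateral sum. *)
Lemma twisted_gB : twisted s 1 gB.
Proof.
rewrite /twisted /gB !(adic_hom_asum (iot_adic K), adic_hom_asum (tau_adic K)); try exact: vge_gLR.
pose iL n := mon 0 6 * iot (gL n); pose iR n := mon 0 6 * iot (gR n).
pose tL n := ac s * (mon 2 2 * tau (gL n)); pose tR n := ac s * (mon 2 2 * tau (gR n)).
have viL n : vge n (iL n) by apply: vgeMl; apply: (iot_adic K).1; exact: vge_gL.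
have viR n : vge n (iR n) by apply: vgeMl; apply: (iot_adic K).1; exact: vge_gR.
have vtL n : vge n (tL n) by do 2!apply: vgeMl; apply: (tau_adic K).1; exact: vge_gL.
have vtR n : vge n (tR n) by do 2!apply: vgeMl; apply: (tau_adic K).1; exact: vge_gR.
have hE c p q p' q' c' : c = c' -> (p = p')%N -> (q = q')%N ->
    ac c * mon p q = ac c' * mon p' q' :> ps2 K by move=> -> -> ->.
have iE c p q : mon 0 6 * iot (ac c * mon p q) = ac c * mon (p + q) (6 + 2 * p).
  by rewrite rmorphM /= iot_mon (iot_adic K).2 mulrCA monM.
have tE c p q : ac s * (mon 2 2 * tau (ac c * mon p q)) =
    ac (s * c) * mon (2 + 2 * q) (2 + (p + q)).
  by rewrite rmorphM /= tau_mon (tau_adic K).2 (mulrCA (mon 2 2)) monM mulrA -rmorphM.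
(* a shift of the index exchanges the two sides; the two halves meet in e0 *)
have eLS n : iL n.+1 = - tL n.
  rewrite /iL /tL /gL iE tE -mulNr -rmorphN; have := tri_5 n.+1; have := tri_5 n.
  by rewrite triS => h1 h2; apply: hE; [rewrite exprS mulNr | lia | lia].
have e0 : iL 0%N = tR 0%N.
  by rewrite /iL /tR /gL /gR iE tE; apply: hE; rewrite ?tri0 // !expr0 mul1r expr1 divff.
have eRS n : tR n.+1 = - iR n.
  rewrite /iR /tR /gR iE tE -mulNr -rmorphN; have := tri_ge n.+1; have := tri_ge n.
  rewrite triS => h1 h2; apply: hE; [|lia|lia].
  by rewrite exprS exprSr invfM; field; rewrite s0 expf_neq0.
transitivity (asum iL - asum iR).
  rewrite -asumB // -asumMl => [|n]; last by apply: (iot_adic K).1; exact: vge_gLR.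
  by apply: eq_asum => n; rewrite rmorphB mulrBr.
transitivity (- (asum tL - asum tR)).
  rewrite (asum_recl viL) (asum_recl vtR) e0 (eq_asum eLS) (eq_asum eRS) !asumN //; ring.
congr (- _); rewrite -asumB // -asumMl => [|n]; last by apply: (tau_adic K).1; exact: vge_gLR.
rewrite -asumMl => [|n]; last by apply: vgeMl; apply: (tau_adic K).1; exact: vge_gLR.
by apply: eq_asum => n; rewrite rmorphB !mulrBr.
Qed.

Lemma G0_near (B : adicAlgType K) (z : B) : vge 1 z -> vge 1 (1 - G0 s z).
Proof.
move=> hz; rewrite /G0 asum_recl => [|n]; last exact: G0_term.
rewrite tri0 muln0 subn0 !expr0 mul1r add0n rmorph1 mul1r !opprD opprK !addrA subrr add0r.
apply: vgeB; first by apply: vge_X => //; lia.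
apply: vge_asum => n; first by apply: vge_leq (@G0_term _ _ s _ n.+1 hz).
by apply: vge_leq (@G0_term _ _ s _ n.+1 hz).
Qed.

Lemma G0_neq0 : G0 s rho != 0.
Proof.
by rewrite -oppr_eq0; apply: nearN1_neq0; apply: G0_near; exact: vge_var.
Qed.

Lemma gB_neq0 : gB != 0.
Proof.
apply/eqP => g0; have := diag_gB; rewrite g0 rmorph0 => /esym/eqP.
rewrite mulf_eq0 expf_eq0 /= => /orP[/eqP r0|/eqP G00].
  have /eqP := congr1 (fun f : powser K => f 1%N) r0.
  by rewrite ps_coef0 ps_coef_var oner_eq0.
have e : dbl (G0 s rho) = G0 s (rho ^+ 2).
  by rewrite -dbl_var; exact: (G0_hom (dbl_adic K) s (vge_var K)).
case/eqP: G0_neq0; apply: dbl_inj; rewrite e G00.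
by apply/esym; rewrite rmorph0.
Qed.
End Companion.

Section KernelParametrisation.
Variable K : fieldType.
Notation mon := (mon K).
Notation rho := (ps_var K).

Lemma odd_sum_near (B : adicAlgType K) (z : B) : vge 1 z -> vge 1 (1 - odd_sum z).
Proof.
move=> hz; rewrite /odd_sum asum_recl => [|n]; last exact: odd_sum_term.
rewrite tri0 !muln0 !expr0 !mul1r opprD addrA subrr add0r; apply: vgeN.
apply: vge_asum => n; first by apply: vge_leq (@odd_sum_term _ _ _ n.+1 hz).
by apply: vge_leq (@odd_sum_term _ _ _ n.+1 hz).
Qed.

Lemma lam_num_near (B : adicAlgType K) (z : B) : vge 1 z -> vge 1 (1 - lam_num z).
Proof.
move=> hz; rewrite /lam_num opprB addrA; apply: vgeB.
  by apply: ram_near; exact: vgeXS.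
apply: vgeMl; apply: vge_asum => n; first exact: dth_term.
by rewrite mulrBr; apply: vgeB; apply: vge_X => //; rewrite triS; have := tri_ge n; lia.
Qed.

Lemma near1_neq0 (B : adicAlgType K) (f : B) : vge 1 (1 - f) -> f != 0.
Proof. by move=> h; rewrite -oppr_eq0; apply: nearN1_neq0. Qed.

(** The series t0 = t / r as a function of r. *)
Definition t0 : powser K := odd_sum rho * - ainv (- lam_num rho).

Lemma t0E : t0 * lam_num rho = odd_sum rho.
Proof.
rewrite /t0 -mulrA mulNr -mulrN (mulrC (ainv _)) mul_ainv ?mulr1 //.
by apply: lam_num_near; exact: vge_var.
Qed.

Lemma diag_neq0 (f : ps2 K) : diag f != 0 -> f != 0.
Proof. by apply: contra => /eqP->; rewrite rmorph0. Qed.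

Lemma emb_neq0 (f : powser K) : f != 0 -> emb f != 0.
Proof.
move=> f0; apply: diag_neq0; rewrite diag_emb; apply: contra f0 => /eqP e.
by apply/eqP/dbl_inj; rewrite e; apply/esym; rewrite rmorph0.
Qed.

Lemma mon_neq0 p q : mon p q != 0.
Proof.
apply/eqP => /(congr1 (fun f : ps2 K => cf f p q)) /eqP.
by rewrite cf_mon !eqxx cf0 oner_eq0.
Qed.

Definition Ncub : ps2 K := Th1 K ^+ 3 - mon 0 6 * Th2 K ^+ 3 - mon 6 0 * Th0 K ^+ 3.
(** The two sides of the theta identity
    odd_sum(r) (V th1^3 - U th2^3 - ph^3) = lam_num(r) ph th1 th2; [Ncub] is the
    common part of the images of [Nbi] under [iot] and [tau]. *)
Definition Nbi : ps2 K := mon 0 3 * th1 K ^+ 3 - mon 3 0 * th2 K ^+ 3 - ph K ^+ 3.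
Definition Pbi : ps2 K := ph K * th1 K * th2 K.

Lemma iot_V : iot (mon 0 3) = mon 3 0. Proof. by rewrite iot_mon. Qed.
Lemma iot_U : iot (mon 3 0) = mon 3 6. Proof. by rewrite iot_mon. Qed.
Lemma tau_V : tau (mon 0 3) = mon 6 3. Proof. by rewrite tau_mon. Qed.
Lemma tau_U : tau (mon 3 0) = mon 0 3. Proof. by rewrite tau_mon. Qed.
Lemma iot_r : iot (mon 1 1) = mon 2 2. Proof. by rewrite iot_mon. Qed.
Lemma tau_r : tau (mon 1 1) = mon 2 2. Proof. by rewrite tau_mon. Qed.
Definition theta_images := (iot_V, iot_U, tau_V, tau_U, iot_r, tau_r, iot_th1, iot_th2, iot_ph,
  tau_th1, tau_th2, tau_ph).

Lemma iot_Nbi : iot Nbi = mon 3 0 * Ncub.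
Proof. rewrite /Nbi !iotS !theta_images /Ncub !mon_xy; ring. Qed.

Lemma tau_Nbi : tau Nbi = - (mon 0 3 * Ncub).
Proof. rewrite /Nbi !tauS !theta_images /Ncub !mon_xy; ring. Qed.

Lemma iot_Pbi : iot Pbi = mon 3 0 * (Th0 K * Th1 K * Th2 K).
Proof. rewrite /Pbi !iotS !theta_images; ring. Qed.

Lemma tau_Pbi : tau Pbi = - (mon 0 3 * (Th0 K * Th1 K * Th2 K)).
Proof. rewrite /Pbi !tauS !theta_images; ring. Qed.

(** Both sides of the theta identity have two such images, the factors a^3 and
    - b^3 coming from ph; multiplied by V = y^3, both solve the same twisted
    equation with lam = 1. *)
Lemma twisted_V (f N : ps2 K) : iot f = mon 3 0 * N -> tau f = - (mon 0 3 * N) ->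
  twisted 1 0 (mon 0 3 * f).
Proof.
move=> hi ht; rewrite /twisted iotM tauM iot_V tau_V hi ht rmorph1 muln0.
by rewrite !mon_xy; ring.
Qed.

End KernelParametrisation.

(** * The cubic theta identity and the kernel curve *)

Section CubicIdentity.
Variable K : fieldType.
Hypothesis char0 : forall n, n.+1%:R != 0 :> K.
Notation mon := (mon K).
Notation rho := (ps_var K).
Notation th1 := (th1 K). Notation th2 := (th2 K). Notation ph := (ph K).
Notation Th0 := (Th0 K). Notation Th1 := (Th1 K). Notation Th2 := (Th2 K).
Notation Nbi := (Nbi K). Notation Pbi := (Pbi K). Notation Ncub := (Ncub K).
Notation t0 := (t0 K).

Lemma Th0_neq0 : Th0 != 0. Proof. exact: nearN1_neq0 (Th0_near K). Qed.
Lemma Th1_neq0 : Th1 != 0. Proof. exact: nearN1_neq0 (Th1_near K). Qed.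
Lemma Th2_neq0 : Th2 != 0. Proof. exact: nearN1_neq0 (Th2_near K). Qed.

Lemma diag1N (f : ps2 K) : diag1 (- f) = - diag1 f.
Proof.
have d0 : diag1 (0 : ps2 K) = 0 by rewrite -(subrr 0) diag1B subrr.
by rewrite -(sub0r f) diag1B d0 sub0r.
Qed.

Lemma diag1X2 (f : ps2 K) : diag1 (f ^+ 2) = 2%:R * diag f * diag1 f.
Proof. by rewrite expr2 diag1M; ring. Qed.

Lemma diag1X3 (f : ps2 K) : diag1 (f ^+ 3) = 3%:R * diag f ^+ 2 * diag1 f.
Proof. by rewrite exprS diag1M diag1X2 diagX; ring. Qed.

Definition diag1S := (diag1B, diag1N, diag1D, diag1X2, diag1X3, diag1M, diag1_mon, diag1_th1,
  diag1_th2, diag1_ph).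
Definition diag_theta := (diag_mon, diag_th1, diag_th2, diag_ph).

Notation z2 := (rho ^+ 2).

Lemma diag_Nbi : diag Nbi = 0.
Proof. by rewrite /Nbi !diagS !diag_theta; ring. Qed.

Lemma diag1_Nbi : diag1 Nbi = 6%:R * rho ^+ 3 * thq z2 ^+ 2 * lam_num z2.
Proof. by rewrite /Nbi !diag1S !diagS !diag_theta /lam_num; ring. Qed.

Lemma diag_Pbi : diag Pbi = 0.
Proof. by rewrite /Pbi !diagS !diag_theta; ring. Qed.

Lemma diag1_Pbi : diag1 Pbi = 6%:R * rho ^+ 3 * thq z2 ^+ 2 * odd_sum z2.
Proof. by rewrite /Pbi !diag1S !diagS !diag_theta; ring. Qed.

Lemma var_neq0 : rho != 0.
Proof.
apply/eqP => r0; have /eqP := congr1 (fun f : powser K => f 1%N) r0.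
by rewrite ps_coef0 ps_coef_var oner_eq0.
Qed.

Lemma natr_ps_neq0 n : n.+1%:R != 0 :> powser K.
Proof.
apply/eqP => /(congr1 (fun f : powser K => f 0%N)) /eqP; rewrite ps_coef0.
by rewrite -(rmorph_nat (@ac K (powser K))) [X in X == _](ps_coef_const _ 0) (negbTE (char0 n)).
Qed.

Lemma thq_neq0 (B : adicAlgType K) (z : B) : vge 1 z -> thq z != 0.
Proof. by move=> hz; apply: nearN1_neq0; apply: ram_near; exact: vgeXS. Qed.

Lemma dbl_lam : dbl (lam_num rho) = lam_num z2.
Proof.
by rewrite -dbl_var; exact: (lam_num_hom (dbl_adic K).1 (vge_var K)).
Qed.
Lemma dbl_odd : dbl (odd_sum rho) = odd_sum z2.
Proof.
by rewrite -dbl_var; exact: (odd_sum_hom (dbl_adic K).1 (vge_var K)).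
Qed.
Lemma emb_lam : emb (lam_num rho) = lam_num (mon 1 1).
Proof. by rewrite (lam_num_hom (emb_adic K).1) /= ?emb_var //; exact: vge_var. Qed.
Lemma emb_odd : emb (odd_sum rho) = odd_sum (mon 1 1).
Proof. by rewrite (odd_sum_hom (emb_adic K).1) /= ?emb_var //; exact: vge_var. Qed.

Lemma supp60_VNbi : supp6 0 (mon 0 3 * Nbi).
Proof.
apply: (@supp6_mod _ (3 + 3)) => //; apply: supp6M; first exact: supp6_monE.
have h1 : supp6 0 (th1 ^+ 3) by apply: supp60X; exact: supp6_th1.
have h2 : supp6 0 (th2 ^+ 3) by apply: supp60X; exact: supp6_th2.
apply: supp6B; last by apply: (@supp6_mod _ (3 * 3)) => //; apply: supp6X; exact: supp6_ph.
by apply: supp6B; rewrite -[3%N]addn0; apply: supp6M => //; exact: supp6_monE.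
Qed.

Lemma supp60_VPbi : supp6 0 (mon 0 3 * Pbi).
Proof.
apply: (@supp6_mod _ (3 + 3)) => //; apply: supp6M; first exact: supp6_monE.
rewrite -[3%N]addn0; apply: supp6M; last exact: supp6_th2.
by rewrite -[3%N]addn0; apply: supp6M; [exact: supp6_ph | exact: supp6_th1].
Qed.

(** Both sides, times V, solve the same twisted equation, hence they are
    proportional; both vanish on x = y, and the factor is found by comparing their
    first derivatives there. *)
Lemma cubic_identity_bi : odd_sum (mon 1 1) * Nbi = lam_num (mon 1 1) * Pbi.
Proof.
pose f := mon 0 3 * Nbi; pose g := mon 0 3 * Pbi.
have tf : twisted 1 0 f by apply: twisted_V (iot_Nbi K) (tau_Nbi K).
have tg : twisted 1 0 g by apply: twisted_V (iot_Pbi K) (tau_Pbi K).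
have g0 : g != 0.
  rewrite mulf_neq0 ?mon_neq0 //; apply/eqP => P0; have := iot_Pbi K; rewrite P0.
  move/esym/eqP; rewrite (_ : iot 0 = 0) ?rmorph0 // !mulf_eq0 (negbTE (mon_neq0 _ _ _)).
  by rewrite (negbTE Th0_neq0) (negbTE Th1_neq0) (negbTE Th2_neq0).
have cg0 := twisted_ccol_neq0 (oner_neq0 K) tg supp60_VPbi g0.
have e := twisted_proportional (oner_neq0 K) tf tg supp60_VNbi supp60_VPbi.
have e1 : dbl (ccol g) * lam_num z2 = dbl (ccol f) * odd_sum z2.
  have := congr1 (@diag1 K) e; rewrite (diag1M (emb (ccol g)) f) (diag1M (emb (ccol f)) g).
  rewrite !diag1_emb !mul0r !add0r !diag_emb (diag1M (mon 0 3) Nbi) (diag1M (mon 0 3) Pbi).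
  rewrite diag_Nbi diag_Pbi !mulr0 !add0r diag1_Nbi diag1_Pbi diag_mon => e2.
  have h0 : 6%:R * rho ^+ 6 * thq z2 ^+ 2 != 0.
    rewrite !mulf_neq0 ?expf_neq0 ?var_neq0 ?natr_ps_neq0 //; apply: thq_neq0; exact: vge_var2.
  apply: (mulIf h0); move: e2; rewrite (_ : (0 + 3)%N = 3%N) // => e2.
  move: e2; move: (dbl (ccol g)) (dbl (ccol f)) (thq z2) (lam_num z2) (odd_sum z2) => a b c d e2' h.
  transitivity (a * (rho ^+ 3 * (6%:R * rho ^+ 3 * c ^+ 2 * d))); first by ring.
  by rewrite h; ring.
have e3 : ccol g * lam_num rho = ccol f * odd_sum rho.
  by apply: dbl_inj; rewrite !dblM dbl_lam dbl_odd.
have e4 : emb (ccol g) * lam_num (mon 1 1) = emb (ccol f) * odd_sum (mon 1 1).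
  by have := congr1 (@emb K) e3; rewrite !rmorphM /= emb_lam emb_odd.
have c0 : emb (ccol g) * mon 0 3 != 0 by rewrite mulf_neq0 ?mon_neq0 ?emb_neq0.
apply: (mulfI c0).
transitivity ((emb (ccol g) * f) * odd_sum (mon 1 1)); first by rewrite /f; ring.
rewrite e -mulrA (mulrC g) mulrA -e4 /g; ring.
Qed.

Fact tA_key : unit. Proof. by []. Qed.
(** The series t0 evaluated at r = x y and, after either substitution, at
    r = (a b)^2. *)
Definition tA : ps2 K := locked_with tA_key (iot (emb t0)).
Fact tB_key : unit. Proof. by []. Qed.
Definition tB : ps2 K := locked_with tB_key (emb t0).
Lemma tAE : tA = iot (emb t0). Proof. by rewrite /tA unlock. Qed.
Lemma tBE : tB = emb t0. Proof. by rewrite /tB unlock. Qed.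
Lemma iot_tB : iot tB = tA. Proof. by rewrite tAE tBE. Qed.
Lemma tau_tB : tau tB = tA. Proof. by rewrite tAE tBE iot_emb tau_emb. Qed.

(** The image of the theta identity: it is the equation xi + ze + et = 1
    in the parametrisation below, cleared of denominators. *)
Lemma cubic_identity : tA * Ncub = Th0 * Th1 * Th2.
Proof.
have hr : vge 1 (mon 1 1) by exact: mon_vge1.
have ho : iot (odd_sum (mon 1 1)) = odd_sum (mon 2 2).
  by rewrite (odd_sum_hom (iot_adic K).1 hr) /= iot_r.
have hl : iot (lam_num (mon 1 1)) = lam_num (mon 2 2).
  by rewrite (lam_num_hom (iot_adic K).1 hr) /= iot_r.
have et : tA * lam_num (mon 2 2) = odd_sum (mon 2 2).
  by rewrite tAE -ho -hl -emb_odd -emb_lam -(t0E K) embM iotM.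
have e := congr1 (@iot K) cubic_identity_bi.
rewrite (iotM (odd_sum (mon 1 1)) Nbi) (iotM (lam_num (mon 1 1)) Pbi) in e.
rewrite ho hl iot_Nbi iot_Pbi -et in e.
have l0 : lam_num (mon 2 2) * mon 3 0 != 0.
  rewrite mulf_neq0 ?mon_neq0 //; apply: near1_neq0; apply: lam_num_near; exact: vge_r2.
by apply: (mulfI l0); rewrite -[RHS]mulrA -e; ring.
Qed.

Fact xiB_key : unit. Proof. by []. Qed.
(** The parametrisation xi = - t0 ph^2 / (th1 th2) of the kernel curve. *)
Definition xiB : ps2 K := locked_with xiB_key (- (tB * ph ^+ 2 * ainv th1 * ainv th2)).
Lemma xiBE : xiB = - (tB * ph ^+ 2 * ainv th1 * ainv th2). Proof. by rewrite /xiB unlock. Qed.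

Lemma xiB_th : xiB * (th1 * th2) = - (tB * ph ^+ 2).
Proof.
have := mul_ainv (th1_near K); have := mul_ainv (th2_near K); rewrite xiBE.
move: (ainv th1) (ainv th2) => i1 i2 h2 h1.
transitivity (- (tB * ph ^+ 2) * (th1 * i1) * (th2 * i2)); first by ring.
by rewrite h1 h2 !mulr1.
Qed.

Lemma ph_vge1 : vge 1 ph.
Proof.
rewrite phE; apply: vge_asum => n; first by apply: alt_term; exact: mon_vge1.
rewrite mulrBr; apply: vgeB; apply: vge_XY; (try exact: mon_vge1); have := tri_ge n; lia.
Qed.

Lemma xiB_vge1 : vge 1 xiB.
Proof.
rewrite xiBE; apply: vgeN; apply: vgeMr; apply: vgeMr; apply: vgeMl.
exact: vgeXS ph_vge1.
Qed.

Lemma supp6_xiB : supp6 0 xiB.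
Proof.
rewrite xiBE; apply: supp6N; apply: supp60M; last first.
  by apply: supp6_ainv; [exact: th2_near | exact: supp6_th2].
apply: supp60M; last by apply: supp6_ainv; [exact: th1_near | exact: supp6_th1].
apply: supp60M; first by rewrite tBE; exact: supp6_emb.
by apply: (@supp6_mod _ (2 * 3)) => //; apply: supp6X; exact: supp6_ph.
Qed.

Definition xiA := iot xiB.
Definition zeA := tau xiB.

Lemma xiA_Th : xiA * (Th1 * Th2) = - (tA * mon 6 0 * Th0 ^+ 2).
Proof.
have := congr1 (@iot K) xiB_th.
rewrite iotN !iotM ?iotX !theta_images iot_tB => ->.
by rewrite !mon_xy; ring.
Qed.

Lemma zeA_Th : zeA * (Th0 * Th1) = - (tA * mon 0 6 * Th2 ^+ 2).
Proof.
have := congr1 (@tau K) xiB_th.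
rewrite tauN !tauM ?tauX !theta_images tau_tB => ->.
by rewrite !mon_xy; ring.
Qed.

Definition etA := 1 - xiA - zeA.

(** The third coordinate is defined as 1 - xi - ze; by the cubic identity it
    has the same form as the other two. *)
Lemma etA_Th : etA * (Th0 * Th2) = tA * Th1 ^+ 2.
Proof.
apply: (mulIf Th1_neq0); have e := cubic_identity.
transitivity (Th0 * Th1 * Th2 - Th0 * (xiA * (Th1 * Th2)) - Th2 * (zeA * (Th0 * Th1))).
  by rewrite /etA; ring.
by rewrite xiA_Th zeA_Th -e /Ncub; ring.
Qed.

(** Each theta function occurs as often above as below in the product of
    the three coordinates. *)
Lemma xi_ze_et : xiA * zeA * etA = (tA * mon 2 2) ^+ 3.
Proof.
have h0 : (Th0 * Th1 * Th2) ^+ 2 != 0.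
  by rewrite expf_neq0 // !mulf_neq0 ?Th0_neq0 ?Th1_neq0 ?Th2_neq0.
apply: (mulIf h0).
transitivity ((xiA * (Th1 * Th2)) * (zeA * (Th0 * Th1)) * (etA * (Th0 * Th2))); first by ring.
rewrite xiA_Th zeA_Th etA_Th exprMn monX !mon_xy; ring.
Qed.

Lemma xiA_vge1 : vge 1 xiA. Proof. exact: (iot_adic K).1 xiB_vge1. Qed.
Lemma zeA_vge1 : vge 1 zeA. Proof. exact: (tau_adic K).1 xiB_vge1. Qed.

End CubicIdentity.

(** * The twisted equation for walks and its solution *)

(** The walks enter through two families of weighted words for which the
    kernel equation holds on the whole curve; everything else in this part is
    theta functions. *)
Section Solution.
Variables (K : fieldType) (s : K) (wF wH : nat -> seq (K * nat)).
Hypothesis char0 : forall n, n.+1%:R != 0 :> K.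
Hypothesis s0 : s != 0.
Hypothesis kernel_eq : forall t xi ze : ps2 K, vge 1 t -> vge 1 xi -> vge 1 ze ->
  xi * ze * (1 - xi - ze) = t ^+ 3 ->
  1 - (1 - xi - ze) * gsum wF t xi - (1 - xi - ze) * ze * gsum wH t ze
    + ac s * t * gsum wF t ze + ac s^-1 * t ^+ 2 * gsum wH t xi = 0.
Notation mon := (mon K).
Notation rho := (ps_var K).
Notation th1 := (th1 K). Notation th2 := (th2 K). Notation ph := (ph K).
Notation Th0 := (Th0 K). Notation Th1 := (Th1 K). Notation Th2 := (Th2 K).
Notation t0 := (t0 K).
Notation tA := (tA K). Notation tB := (tB K). Notation xiB := (xiB K).
Notation xiA := (xiA K). Notation zeA := (zeA K). Notation etA := (etA K).

Let tr := tB * mon 1 1.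
Let ta := tA * mon 2 2.

Lemma vge_tr : vge 1 tr. Proof. by apply: vgeMl; exact: mon_vge1. Qed.
Lemma vge_ta : vge 1 ta. Proof. by apply: vgeMl; exact: mon_vge1. Qed.
Lemma iot_tr : iot tr = ta. Proof. by rewrite /tr iotM iot_tB iot_r. Qed.
Lemma tau_tr : tau tr = ta. Proof. by rewrite /tr tauM tau_tB tau_r. Qed.

Fact walk_key : unit. Proof. by []. Qed.
Fact walk_key' : unit. Proof. by []. Qed.
Definition FB : ps2 K := locked_with walk_key (gsum wF tr xiB).
Definition HB : ps2 K := locked_with walk_key' (gsum wH tr xiB).
Lemma FBE : FB = gsum wF tr xiB. Proof. by rewrite /FB unlock. Qed.
Lemma HBE : HB = gsum wH tr xiB. Proof. by rewrite /HB unlock. Qed.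

Lemma kernel_A :
  1 - etA * iot FB - etA * zeA * tau HB + ac s * ta * tau FB + ac s^-1 * ta ^+ 2 * iot HB = 0.
Proof.
have hF := gsum_hom wF (iot_adic K) vge_tr (xiB_vge1 K).
have hF' := gsum_hom wF (tau_adic K) vge_tr (xiB_vge1 K).
have hH := gsum_hom wH (iot_adic K) vge_tr (xiB_vge1 K).
have hH' := gsum_hom wH (tau_adic K) vge_tr (xiB_vge1 K).
rewrite /= iot_tr in hF hH; rewrite /= tau_tr in hF' hH'.
rewrite FBE HBE hF hF' hH hH'.
apply: kernel_eq; [exact: vge_ta | exact: xiA_vge1 | exact: zeA_vge1 |].
exact: xi_ze_et.
Qed.

(** Combination of F and H that makes the four unknown values in the kernel
    equation a single pair iot W, tau W: the multiplier of each unknown is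
    the one of the kernel equation times Th0^2 Th2. *)
Definition WB : ps2 K := mon 2 2 * mon 0 3 * ph * th1 ^+ 2 * FB
  - tB * ac s^-1 * mon 1 1 * mon 3 0 * mon 0 3 * ph ^+ 2 * th2 * HB.

(** A particular solution: it satisfies the inhomogeneous equation of
    (1 - s^3) t0 W, so that the difference [OmB] solves the homogeneous one.
    The images of its three terms under [iot] and [tau] agree up to a cyclic
    permutation, and the coefficients 1, s^2, - s make all but one of them cancel,
    leaving the factor 1 - s^3. *)
Definition WpB : ps2 K := mon 2 2 * ph ^+ 2 * th2 + ac s ^+ 2 * mon 1 1 * mon 0 3 * ph * th1 ^+ 2
  - ac s * mon 3 0 * mon 0 3 * th1 * th2 ^+ 2.

Definition OmB : ps2 K := (1 - ac s ^+ 3) * tB * WB - WpB.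

Lemma iot_r2 : iot (mon 2 2) = mon 4 4. Proof. by rewrite iot_mon. Qed.
Lemma tau_r2 : tau (mon 2 2) = mon 4 4. Proof. by rewrite tau_mon. Qed.
Lemma iot1 : iot (1 : ps2 K) = 1. Proof. exact: rmorph1. Qed.
Lemma tau1 : tau (1 : ps2 K) = 1. Proof. exact: rmorph1. Qed.

Lemma iot_WB : iot WB = mon 6 0 * (mon 4 4 * Th0 * Th1 ^+ 2 * iot FB
  - tA * ac s^-1 * mon 8 8 * Th0 ^+ 2 * Th2 * iot HB).
Proof.
rewrite /WB iotB !iotM ?iotX !theta_images !iotac iot_tB iot_r2 !mon_xy; ring.
Qed.

Lemma tau_WB : tau WB = - (mon 6 6 * (mon 4 4 * Th0 ^+ 2 * Th2 * tau FB
  + tA * ac s^-1 * mon 2 8 * Th1 * Th2 ^+ 2 * tau HB)).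
Proof.
rewrite /WB tauB !tauM ?tauX !theta_images !tauac tau_tB tau_r2 !mon_xy; ring.
Qed.

Lemma iot_WpB : iot WpB = mon 6 0 * (mon 4 4 * Th0 ^+ 2 * Th2
  + ac s ^+ 2 * mon 2 2 * Th0 * Th1 ^+ 2 - ac s * mon 0 6 * Th1 * Th2 ^+ 2).
Proof.
rewrite /WpB iotB iotD !iotM ?iotX !theta_images !iotac iot_r2 !mon_xy; ring.
Qed.

Lemma tau_WpB : tau WpB = mon 0 6 * mon 4 4 * Th1 * Th2 ^+ 2
  - ac s ^+ 2 * mon 2 2 * mon 6 6 * Th2 * Th0 ^+ 2 - ac s * mon 6 6 * Th0 * Th1 ^+ 2.
Proof.
rewrite /WpB tauB tauD !tauM ?tauX !theta_images !tauac tau_r2 !mon_xy; ring.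
Qed.

(** The kernel equation multiplied by Th0^2 Th2, with et and ze expressed by
    theta functions. *)
Lemma WB_equation :
  tA * (mon 0 6 * iot WB + ac s * (mon 2 2 * tau WB)) = mon 10 10 * Th0 ^+ 2 * Th2.
Proof.
have e := kernel_A; have eE := etA_Th char0; have zE := zeA_Th K.
have ss : ac s * ac s^-1 = 1 :> ps2 K by rewrite -rmorphM divff ?rmorph1.
have key : Th0 ^+ 2 * Th2 = tA * Th0 * Th1 ^+ 2 * iot FB
    - tA ^+ 2 * mon 0 6 * Th1 * Th2 ^+ 2 * tau HB
    - ac s * ta * Th0 ^+ 2 * Th2 * tau FB - ac s^-1 * ta ^+ 2 * Th0 ^+ 2 * Th2 * iot HB.
  move: e zE eE; rewrite /ta; move: (iot FB) (tau FB) (iot HB) (tau HB) etA zeA => a b c d et ze.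
  move=> e zE eE.
  transitivity (Th0 ^+ 2 * Th2 - Th0 ^+ 2 * Th2 * (1 - et * a - et * ze * d +
      ac s * (tA * mon 2 2) * b + ac s^-1 * (tA * mon 2 2) ^+ 2 * c)).
    by rewrite e mulr0 subr0.
  transitivity (et * (Th0 * Th2) * Th0 * a + (et * (Th0 * Th2)) * (ze * Th0) * d
    - ac s * (tA * mon 2 2) * Th0 ^+ 2 * Th2 * b
    - ac s^-1 * (tA * mon 2 2) ^+ 2 * Th0 ^+ 2 * Th2 * c); first by ring.
  rewrite eE.
  transitivity (tA * Th1 ^+ 2 * Th0 * a + tA * Th1 * (ze * (Th0 * Th1)) * d
    - ac s * (tA * mon 2 2) * Th0 ^+ 2 * Th2 * b
    - ac s^-1 * (tA * mon 2 2) ^+ 2 * Th0 ^+ 2 * Th2 * c); first by ring.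
  by rewrite zE; ring.
rewrite iot_WB tau_WB -[RHS]mulrA key /ta.
move: (iot FB) (tau FB) (iot HB) (tau HB) (ac s) (ac s^-1) ss => a b c d S Si ss.
transitivity (tA * (mon 0 6 * (mon 6 0 * (mon 4 4 * Th0 * Th1 ^+ 2 * a
    - tA * Si * mon 8 8 * Th0 ^+ 2 * Th2 * c))
  - mon 2 2 * mon 6 6 * (S * mon 4 4 * Th0 ^+ 2 * Th2 * b
     + tA * (S * Si) * mon 2 8 * Th1 * Th2 ^+ 2 * d))); first by ring.
by rewrite ss !mon_xy; ring.
Qed.

Lemma twisted_OmB : twisted s 1 OmB.
Proof.
have e := WB_equation.
rewrite /twisted /OmB iotB tauB !(iotM _ WB) !(tauM _ WB) iot_WpB tau_WpB.
rewrite !(iotM _ tB) !(tauM _ tB) iot_tB tau_tB !(iotB 1) !(tauB 1) iot1 tau1.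
rewrite (iotX (ac s) 3) (tauX (ac s) 3) !iotac !tauac.
move: e; move: (iot WB) (tau WB) (ac s) => a b S e.
apply/eqP; rewrite -subr_eq0; apply/eqP.
transitivity ((1 - S ^+ 3) * (tA * (mon 0 6 * a + S * (mon 2 2 * b))
   - mon 10 10 * Th0 ^+ 2 * Th2)); last by rewrite e subrr mulr0.
by rewrite (_ : (2 * 1)%N = 2%N) // !mon_xy; ring.
Qed.

Lemma supp60_FB : supp6 0 FB.
Proof.
rewrite FBE; apply: supp6_gsum; [exact: vge_tr|exact: xiB_vge1| |exact: supp6_xiB].
by rewrite /tr tBE; apply: supp60M; [exact: supp6_emb | exact: supp6_monE].
Qed.

Lemma supp60_HB : supp6 0 HB.
Proof.
rewrite HBE; apply: supp6_gsum; [exact: vge_tr|exact: xiB_vge1| |exact: supp6_xiB].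
by rewrite /tr tBE; apply: supp60M; [exact: supp6_emb | exact: supp6_monE].
Qed.

Lemma supp60_OmB : supp6 0 OmB.
Proof.
have sph2 : supp6 0 (ph ^+ 2).
  by apply: (@supp6_mod _ (2 * 3)) => //; apply: supp6X; exact: supp6_ph.
have sVph : supp6 0 (mon 0 3 * ph).
  by apply: (@supp6_mod _ (3 + 3)) => //; apply: supp6M; [exact: supp6_monE | exact: supp6_ph].
have sUV : supp6 0 (mon 3 0 * mon 0 3) by rewrite monM; exact: supp6_monE.
have s1 := supp6_th1 K; have s2 := supp6_th2 K; have sF := supp60_FB; have sH := supp60_HB.
have sB : supp6 0 tB by rewrite tBE; exact: supp6_emb.
have sr : supp6 0 (mon 1 1) by exact: supp6_monE.
have sr2 : supp6 0 (mon 2 2) by exact: supp6_monE.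
have sac c : supp6 0 (ac c : ps2 K) by exact: supp6_ac.
have -> : OmB = (1 - ac s ^+ 3) * tB * (mon 2 2 * (mon 0 3 * ph) * th1 ^+ 2 * FB
    - tB * ac s^-1 * mon 1 1 * (mon 3 0 * mon 0 3) * ph ^+ 2 * th2 * HB)
  - (mon 2 2 * ph ^+ 2 * th2 + ac s ^+ 2 * mon 1 1 * (mon 0 3 * ph) * th1 ^+ 2
     - ac s * (mon 3 0 * mon 0 3) * th1 * th2 ^+ 2).
  by rewrite /OmB /WB /WpB; ring.
have sX2 f : supp6 0 f -> supp6 0 (f ^+ 2 : ps2 K) by exact: supp60X.
apply: supp6B; last first.
  apply: supp6B; last by do ?[apply: supp60M => //; try exact: sX2].
  by apply: supp6D; do ?[apply: supp60M => //; try exact: sX2].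
apply: supp60M; last by apply: supp6B; do ?[apply: supp60M => //; try exact: sX2].
by apply: supp60M => //; apply: supp6B; [exact: supp60_1 | exact: supp60X].
Qed.

Notation z2 := (rho ^+ 2).
Let Ez : powser K := gsum wF (t0 * rho) 0.

Lemma diag_xiB : diag xiB = 0.
Proof. by rewrite xiBE diagN !diagM ?diagX diag_ph ?expr0n /= ?(mulr0, mul0r) oppr0. Qed.

Lemma vge_t0rho : vge 1 (t0 * rho). Proof. by apply: vgeMl; exact: vge_var. Qed.

Lemma diag_tB : diag tB = dbl t0. Proof. by rewrite tBE diag_emb. Qed.

(** On the line x = y the function ph vanishes, so that xi = 0 and F is
    evaluated at 0. *)
Lemma diag_FB : diag FB = dbl Ez.
Proof.
have h : dbl Ez = gsum wF (dbl (t0 * rho)) (dbl 0).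
  exact: (gsum_hom wF (dbl_adic K) vge_t0rho (vge_zero 1)).
have h' : diag (gsum wF tr xiB) = gsum wF (diag tr) (diag xiB).
  exact: (gsum_hom wF (diag_adic K) vge_tr (xiB_vge1 K)).
have e1 : diag tr = dbl (t0 * rho) by rewrite /tr diagM diag_tB diag_mon dblM dbl_var.
have e2 : diag xiB = dbl 0 by rewrite diag_xiB rmorph0.
rewrite e1 in h'. rewrite e2 in h'. rewrite FBE. exact: etrans h' (esym h).
Qed.

Lemma diag_OmB : diag OmB = ac s * rho ^+ 6 * thq z2 ^+ 3.
Proof.
rewrite /OmB diagB (diagM _ WB) /WB /WpB !diagS !diag_theta; ring.
Qed.

Lemma diag1_OmB : diag1 OmB =
  6%:R * (1 - ac s ^+ 3) * dbl t0 * rho ^+ 10 * odd_sum z2 * thq z2 ^+ 2 * dbl Ez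
  - 6%:R * ac s ^+ 2 * rho ^+ 8 * odd_sum z2 * thq z2 ^+ 2
  - 6%:R * ac s * rho ^+ 6 * dth z2 * thq z2 ^+ 2.
Proof.
have dW : diag WB = 0 by rewrite /WB !diagS !diag_theta; ring.
have d1W : diag1 WB = 6%:R * rho ^+ 10 * odd_sum z2 * thq z2 ^+ 2 * dbl Ez.
  rewrite /WB diag1B.
  have -> : diag1 (mon 2 2 * mon 0 3 * ph * th1 ^+ 2 * FB) =
     rho ^+ 4 * rho ^+ 3 * diag1 ph * thq z2 ^+ 2 * dbl Ez.
    rewrite -diag_FB !diag1M !diagM !diag_theta; ring.
  have -> : diag1 (tB * ac s^-1 * mon 1 1 * mon 3 0 * mon 0 3 * ph ^+ 2 * th2 * HB) = 0.
    by rewrite !diag1M !diagM ?diag1X2 ?diagX !diag_theta; ring.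
  by rewrite diag1_ph subr0; ring.
have dWp : diag1 WpB = 6%:R * ac s ^+ 2 * rho ^+ 8 * odd_sum z2 * thq z2 ^+ 2
   + 6%:R * ac s * rho ^+ 6 * dth z2 * thq z2 ^+ 2.
  rewrite /WpB !diag1S !diag1_ac !diagS !diag_theta; ring.
rewrite /OmB diag1B (diag1M _ WB) dW mulr0 add0r d1W dWp diagM diagB rmorph1 diagX diagac diag_tB.
by move: (dbl t0) (odd_sum z2) (thq z2) (dbl Ez) (dth z2) (ac s) => a b c d f S; ring.
Qed.

(** The proportionality of [OmB] and [gB] on the line x = y, where the
    parameter is rho^2; as [dbl] is injective, rho^2 can be replaced by rho. *)
Lemma solution_in_nome :
  ((1 - ac s ^+ 3) * t0 * rho ^+ 2 * odd_sum rho * Ez - ac s ^+ 2 * rho * odd_sum rho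
    - ac s * dth rho) * G0 s rho = ac s * thq rho * G1 s rho.
Proof.
have gen a b c d f g h b' d' f' g' h' :
    dbl b = b' -> dbl d = d' -> dbl f = f' -> dbl g = g' -> dbl h = h' ->
    ((1 - ac s ^+ 3) * dbl a * z2 ^+ 2 * b' * dbl c
      - ac s ^+ 2 * z2 * b' - ac s * d') * f' = ac s * g' * h' ->
    ((1 - ac s ^+ 3) * a * rho ^+ 2 * b * c - ac s ^+ 2 * rho * b - ac s * d) * f = ac s * g * h.
  by move=> <- <- <- <- <- e; apply: dbl_inj; rewrite !dblS.
have hd := dbl_adic K.
have dth_d : dbl (dth rho) = dth z2 by rewrite -dbl_var; exact: (dth_hom hd.1 (vge_var K)).
have thq_d : dbl (thq rho) = thq z2 by rewrite -dbl_var; exact: (thq_hom hd.1 (vge_var K)).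
have G0_d : dbl (G0 s rho) = G0 s z2 by rewrite -dbl_var; exact: (G0_hom hd s (vge_var K)).
have G1_d : dbl (G1 s rho) = G1 s z2 by rewrite -dbl_var; exact: (G1_hom hd s (vge_var K)).
apply: (gen t0 _ Ez _ _ _ _ _ _ _ _ _ (dbl_odd K) dth_d G0_d thq_d G1_d).
have := twisted_wronskian s0 twisted_OmB (twisted_gB s0) supp60_OmB (supp6_gB s0) (gB_neq0 s0).
rewrite diag1_OmB diag_OmB (diag_gB s0) (diag1_gB s0) => e.
have h0 : 6%:R * rho ^+ 14 * thq z2 ^+ 2 != 0.
  rewrite !mulf_neq0 ?expf_neq0 ?var_neq0 ?natr_ps_neq0 //; apply: thq_neq0; exact: vge_var2.
apply: (mulIf h0); move: e.
move: (dbl t0) (odd_sum z2) (thq z2) (dbl Ez) (dth z2) (G0 s z2) (G1 s z2) (ac s) => a b c d f g h S e.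
transitivity ((6%:R * (1 - S ^+ 3) * a * rho ^+ 10 * b * c ^+ 2 * d -
      6%:R * S ^+ 2 * rho ^+ 8 * b * c ^+ 2 - 6%:R * S * rho ^+ 6 * f * c ^+ 2) *
     (rho ^+ 8 * g)); first by ring.
by rewrite e; ring.
Qed.

End Solution.

(** * Walks in sector coordinates and the kernel equation *)

(** (a, b, k) stands for the vertex omega^k (w + a + b omega^2) with
    w = (1 - omega)/3; k is an integer and not a class modulo 3, since it records
    the turns made so far. *)
Definition state := (nat * nat * int)%type.
(** The direction of a step relative to the current sector, that is (i - k)
    modulo 3. *)
Definition rdir (k : int) (i : 'I_3) : nat := `|(i%:Z - k) %% 3|%Z%N.

(** Direction 1 decreases both coordinates.  When b = 0 it crosses
    into the next sector, and when a = 0 < b into the previous one; there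
    the roles of the two coordinates are exchanged. *)
Definition sector_move (st : state) (d : nat) : state :=
  let: (a, b, k) := st in
  match d with
  | 0 => (a.+1, b, k)
  | 1 => if b is b'.+1 then
           if a is a'.+1 then (a', b', k) else (b', 0%N, k - 1)
         else (0%N, a, k + 1)
  | _ => (a, b.+1, k)
  end.

Definition step (st : state) (i : 'I_3) : state := sector_move st (rdir st.2 i).
Definition run (st : state) (w : seq 'I_3) : state := foldl step st w.

Lemma sum_rdir (V : nmodType) (k : int) (G : nat -> V) :
  \sum_(i < 3) G (rdir k i) = G 0%N + G 1%N + G 2%N.
Proof.
rewrite !big_ord_recl big_ord0 addr0 /= /rdir /bump /=.
have : (k %% 3)%Z = 0 \/ (k %% 3)%Z = 1 \/ (k %% 3)%Z = 2 by lia.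
case=> [|[]] h.
- have -> : `|(0%:Z - k) %% 3|%Z%N = 0%N by lia.
  have -> : `|((1 + 0)%N%:Z - k) %% 3|%Z%N = 1%N by lia.
  have -> : `|((1 + (1 + 0))%N%:Z - k) %% 3|%Z%N = 2%N by lia.
  by rewrite addrA.
- have -> : `|(0%:Z - k) %% 3|%Z%N = 2%N by lia.
  have -> : `|((1 + 0)%N%:Z - k) %% 3|%Z%N = 0%N by lia.
  have -> : `|((1 + (1 + 0))%N%:Z - k) %% 3|%Z%N = 1%N by lia.
  by rewrite addrC.
have -> : `|(0%:Z - k) %% 3|%Z%N = 1%N by lia.
have -> : `|((1 + 0)%N%:Z - k) %% 3|%Z%N = 2%N by lia.
have -> : `|((1 + (1 + 0))%N%:Z - k) %% 3|%Z%N = 0%N by lia.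
by rewrite addrA addrC addrA.
Qed.

Lemma sum_rcons_tuple (V : nmodType) (T : finType) n (f : seq T -> V) :
  \sum_(w : n.+1.-tuple T) f w = \sum_(w : n.-tuple T) \sum_(i : T) f (rcons w i).
Proof.
rewrite pair_big /=.
pose h (p : n.-tuple T * T) := [tuple of rcons p.1 p.2].
have hinj : injective h.
  move=> [w i] [w' i'] /(congr1 val) /= /eqP; rewrite eqseq_rcons => /andP[/eqP ww /eqP ->].
  by congr pair; apply: val_inj.
have hbij : bijective h.
  by apply: inj_card_bij hinj _; rewrite card_prod !card_tuple expnS mulnC.
by rewrite (reindex h) //; apply: onW_bij.
Qed.

Section WalkSeries.
Variables (K : fieldType) (s : K) (st0 : state).
Hypothesis s0 : s != 0.
Hypothesis st00 : (st0.1.1 + st0.1.2 = 0)%N.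

Definition sweight (st : state) : K := s ^ (st.2 - st0.2).

(** The words of length n ending on the side b = 0, and those of length n + 1
    ending on the side a = 0 < b, for which the exponent is b - 1. *)
Definition wF n : seq (K * nat) :=
  [seq (sweight (run st0 w), (run st0 w).1.1)
     | w : n.-tuple 'I_3 <- enum {: n.-tuple 'I_3} & (run st0 w).1.2 == 0%N].
Definition wH n : seq (K * nat) :=
  [seq (sweight (run st0 w), (run st0 w).1.2.-1)
     | w : n.+1.-tuple 'I_3 <- enum {: n.+1.-tuple 'I_3}
     & ((run st0 w).1.1 == 0%N) && ((run st0 w).1.2 != 0%N)].

Lemma sector_move_size st d : ((sector_move st d).1.1 + (sector_move st d).1.2 <= (st.1.1 + st.1.2).+1)%N.
Proof. by case: st => [[a b] k]; case: d => [|[|d]] /=; case: b => [|b]; case: a => [|a] /=; lia. Qed.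

Lemma run_size w : ((run st0 w).1.1 + (run st0 w).1.2 <= size w)%N.
Proof.
elim/last_ind: w => [|w i IH]; first by rewrite st00.
rewrite /run foldl_rcons -/(run st0 w) size_rcons.
by apply: leq_trans (sector_move_size _ _) _; rewrite ltnS.
Qed.

Section Kernel.
Variables (B : adicAlgType K) (t xi ze : B).
Hypotheses (ht : vge 1 t) (hxi : vge 1 xi) (hze : vge 1 ze).
Let et := 1 - xi - ze.
Hypothesis curve : xi * ze * et = t ^+ 3.

Definition wt n (st : state) : B :=
  ac (sweight st) * (t ^+ (n - st.1.1 - st.1.2) * (xi ^+ st.1.1 * ze ^+ st.1.2)).

(** The defect of the naive kernel equation at the boundary: on the two
    sides of a sector, direction 1 is replaced by a crossing into another sector. *)
Definition corr n (st : state) : B :=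
  (if st.1.2 == 0%N then ac (sweight st) * (ac s * t * (t ^+ (n - st.1.1) * ze ^+ st.1.1)
      - et * (t ^+ (n - st.1.1) * xi ^+ st.1.1)) else 0)
  + (if (st.1.1 == 0%N) && (st.1.2 != 0%N) then
      ac (sweight st) * (ac s^-1 * t ^+ 2 * (t ^+ (n - st.1.2) * xi ^+ st.1.2.-1)
        - et * ze * (t ^+ (n - st.1.2) * ze ^+ st.1.2.-1)) else 0).

Lemma sweightS a b k a' b' : sweight (a, b, k + 1) = sweight (a', b', k) * s.
Proof. by rewrite /sweight /= addrAC (expfzDr _ 1) // expr1z. Qed.

Lemma sweightP a b k a' b' : sweight (a, b, k - 1) = sweight (a', b', k) * s^-1.
Proof. by rewrite /sweight /= addrAC (expfzDr _ (-1)). Qed.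

(** On the curve, the three directions multiply the weight t^(n-a-b) xi^a ze^b
    by xi, ze and et = t^3 / (xi ze), whose sum is 1. *)
Lemma wt_step n st : (st.1.1 + st.1.2 <= n)%N ->
  \sum_(i < 3) wt n.+1 (step st i) = wt n st + corr n st.
Proof.
case: st => [[a b] k] /= h.
rewrite (sum_rdir k (fun d => wt n.+1 (sector_move (a, b, k) d))) /wt /corr /=.
have e1 : t ^+ (n.+1 - a.+1 - b) * (xi ^+ a.+1 * ze ^+ b) = xi * (t ^+ (n - a - b) * (xi ^+ a * ze ^+ b)).
  by rewrite subSS exprS; ring.
have e2 : t ^+ (n.+1 - a - b.+1) * (xi ^+ a * ze ^+ b.+1) = ze * (t ^+ (n - a - b) * (xi ^+ a * ze ^+ b)).
  by rewrite -!subnDA addnS subSS exprS; ring.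
rewrite e1 e2 {e1 e2}.
case: b h => [|b] h.
  rewrite /= (sweightS 0 a k a 0) andbF addr0 !subn0 !expr0 !mul1r !mulr1.
  have -> : t ^+ (n.+1 - a) = t * t ^+ (n - a) by rewrite -exprS subSn //; lia.
  by rewrite rmorphM /sweight /= /et; ring.
case: a h => [|a] h /=.
  rewrite (sweightP b 0 k 0 b.+1) rmorphM !subn0 expr0 add0r !mul1r mulr1.
  have -> : t ^+ (n.+1 - b) = t ^+ 2 * t ^+ (n - b.+1) by rewrite -exprD; congr (_ ^+ _); lia.
  by rewrite /sweight /= exprS /et; ring.
rewrite !addr0.
have -> : t ^+ (n.+1 - a - b) * (xi ^+ a * ze ^+ b) = et * (t ^+ (n - a.+1 - b.+1) * (xi ^+ a.+1 * ze ^+ b.+1)).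
  transitivity (t ^+ (n - a.+1 - b.+1) * t ^+ 3 * (xi ^+ a * ze ^+ b)).
    by rewrite -exprD; congr (_ ^+ _ * _); lia.
  by rewrite -curve !exprS; ring.
by rewrite /sweight /= /et; ring.
Qed.

Definition Zw n : B := \sum_(w : n.-tuple 'I_3) wt n (run st0 w).

Lemma big_tuple0 (V : nmodType) (T : finType) (f : seq T -> V) :
  \sum_(w : 0.-tuple T) f w = f [::].
Proof.
rewrite (big_pred1 [tuple]) //= => w.
by apply/esym/eqP; exact: tuple0.
Qed.

Lemma Zw0 : Zw 0 = 1.
Proof.
rewrite /Zw (big_tuple0 (fun w => wt 0 (run st0 w))) /wt /= /sweight subrr expr0z rmorph1.
by case: st0 st00 => [[[|a] [|b]] k] //= _; rewrite !expr0 !mulr1.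
Qed.

Lemma ZwS n : Zw n.+1 = Zw n + \sum_(w : n.-tuple 'I_3) corr n (run st0 w).
Proof.
rewrite /Zw (sum_rcons_tuple _ (fun w => wt n.+1 (run st0 w))) -big_split /=.
apply: eq_bigr => w _; rewrite -wt_step; last by have := run_size w; rewrite size_tuple.
by apply: eq_bigr => i _; rewrite /run foldl_rcons.
Qed.

Lemma gterm_wF n X : gterm wF t X n =
  \sum_(w : n.-tuple 'I_3 | (run st0 w).1.2 == 0%N)
     ac (sweight (run st0 w)) * (t ^+ (n - (run st0 w).1.1) * X ^+ (run st0 w).1.1).
Proof. by rewrite /gterm /wF big_map big_filter big_enum_cond. Qed.

Lemma gterm_wH n X : gterm wH t X n =
  \sum_(w : n.+1.-tuple 'I_3 | ((run st0 w).1.1 == 0%N) && ((run st0 w).1.2 != 0%N))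
     ac (sweight (run st0 w)) * (t ^+ (n.+1 - (run st0 w).1.2) * X ^+ (run st0 w).1.2.-1).
Proof.
rewrite /gterm /wH big_map big_filter big_enum_cond; apply: eq_bigr => w hw /=.
congr (_ * (_ ^+ _ * _)); move: hw; case: (run st0 w).1.2 => [|b _]; last by rewrite subSS.
by rewrite /= !andbF.
Qed.

Lemma sum_corr n : \sum_(w : n.+1.-tuple 'I_3) corr n.+1 (run st0 w) =
  ac s * t * gterm wF t ze n.+1 - et * gterm wF t xi n.+1
  + (ac s^-1 * t ^+ 2 * gterm wH t xi n - et * ze * gterm wH t ze n).
Proof.
rewrite big_split /= -big_mkcond -[X in _ + X]big_mkcond !gterm_wF !gterm_wH.
rewrite !big_distrr /= -!sumrB; congr (_ + _); apply: eq_bigr => w _; ring.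
Qed.

Lemma sum_corr0 : \sum_(w : 0.-tuple 'I_3) corr 0 (run st0 w) =
  ac s * t * gterm wF t ze 0 - et * gterm wF t xi 0.
Proof.
rewrite big_split /= -big_mkcond [X in _ + X]big1 => [|w _]; last first.
  rewrite (tuple0 w) /=; case: st0 st00 => [[a b] k] /= /eqP; rewrite addn_eq0.
  by case/andP => _ /eqP->; rewrite andbF.
rewrite addr0 !gterm_wF !big_distrr /= -!sumrB; apply: eq_bigr => w _; ring.
Qed.

Lemma Zw_sum N : Zw N.+1 = 1
  + (ac s * t * \sum_(n < N.+1) gterm wF t ze n - et * \sum_(n < N.+1) gterm wF t xi n)
  + (ac s^-1 * t ^+ 2 * \sum_(n < N) gterm wH t xi n - et * ze * \sum_(n < N) gterm wH t ze n).
Proof.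
elim: N => [|N IH]; first by rewrite ZwS Zw0 sum_corr0 !big_ord0 !big_ord1 !mulr0 subr0 addr0.
rewrite ZwS IH sum_corr !(big_ord_recr N.+1) !(big_ord_recr N) /=; ring.
Qed.

Lemma vge_wt n st : (st.1.1 + st.1.2 <= n)%N -> vge n (wt n st).
Proof.
move=> h; apply: vgeMl; apply: (@vge_leq _ _ _ (n - st.1.1 - st.1.2 + (st.1.1 + st.1.2))); first lia.
by apply: vgeM; first exact: vgeX; apply: vgeM; exact: vgeX.
Qed.

(** The total weight of the words of length N is 1 plus the accumulated
    boundary corrections, by telescoping; as it has order at least N, the
    full sum of the corrections is -1. *)
Lemma kernel_identity :
  1 - et * gsum wF t xi - et * ze * gsum wH t ze + ac s * t * gsum wF t ze
    + ac s^-1 * t ^+ 2 * gsum wH t xi = 0.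
Proof.
apply: vge_eq0 => N.
have hF X (hX : vge 1 X) : vge N (gsum wF t X - \sum_(n < N.+1) gterm wF t X n).
  apply: (@vge_leq _ _ N N.+1) => //; apply: asum_spec => n; exact: vge_gterm.
have hH X (hX : vge 1 X) : vge N (gsum wH t X - \sum_(n < N) gterm wH t X n).
  by apply: asum_spec => n; exact: vge_gterm.
have hZ : vge N (Zw N.+1).
  apply: (@vge_leq _ _ N N.+1) => //; apply: vge_sum => w _; apply: vge_wt.
  by have := run_size w; rewrite size_tuple.
have := Zw_sum N; move: (hF _ hxi) (hF _ hze) (hH _ hxi) (hH _ hze).
move: (gsum wF t xi) (gsum wF t ze) (gsum wH t xi) (gsum wH t ze).
move: (\sum_(n < N.+1) gterm wF t xi n) (\sum_(n < N.+1) gterm wF t ze n).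
move: (\sum_(n < N) gterm wH t xi n) (\sum_(n < N) gterm wH t ze n).
move=> a b c d a' b' c' d' h1 h2 h3 h4 e.
rewrite (_ : _ + _ = Zw N.+1 - et * (a' - c) - et * ze * (d' - b)
   + ac s * t * (b' - d) + ac s^-1 * t ^+ 2 * (c' - a)); last by rewrite e; ring.
apply: vgeD; last exact: vgeMl.
apply: vgeD; last exact: vgeMl.
apply: vgeB; last exact: vgeMl.
by apply: vgeB; last exact: vgeMl.
Qed.

End Kernel.

Lemma gsum_wF_0 (B : adicAlgType K) (t : B) : gsum wF t 0 =
  asum (fun n => ac (\sum_(w : n.-tuple 'I_3 | ((run st0 w).1.1 == 0%N) && ((run st0 w).1.2 == 0%N))
     sweight (run st0 w)) * t ^+ n).
Proof.
apply: eq_asum => n; rewrite gterm_wF rmorph_sum big_distrl /=.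
rewrite [RHS](eq_bigl (fun w : n.-tuple 'I_3 => ((run st0 w).1.2 == 0%N) && ((run st0 w).1.1 == 0%N))).
  rewrite [RHS]big_mkcondr; apply: eq_bigr => w _; case: eqP => [->|/eqP a0].
    by rewrite subn0 expr0 mulr1.
  by rewrite expr0n (negbTE a0) /= !mulr0.
by move=> w; rewrite andbC.
Qed.
End WalkSeries.

(** * Values of T as series in the nome *)

Lemma kap_pow_low (F : fieldType) (a c : F) n m : c != 0 -> (2 * n <= m)%N ->
  c ^+ m * (a * c ^- 2) ^+ n.+1 = (a * c ^- 2) * (a ^+ n * c ^+ (m - 2 * n)).
Proof.
move=> c0 nm; rewrite exprS exprMn exprVn -exprM mulrCA; congr (_ * _).
by rewrite mulrCA -{1}(subnK nm) exprD mulfK ?expf_neq0.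
Qed.

Lemma kap_pow_high (F : fieldType) (a c : F) n m : a != 0 -> c != 0 ->
  c ^+ m * (a * c ^- 2) ^- n = (a * c ^- 2) * (a ^- n.+1 * c ^+ (m + 2 * n.+1)).
Proof.
move=> a0 c0; rewrite exprMn invfM exprVn -exprM invrK (exprS a n) mulnS !exprD.
move: (a ^+ n) (expf_neq0 n a0) (c ^+ m) (c ^+ (2 * n)) => X X0 Y Z.
by field; rewrite X0 a0 c0.
Qed.

Section TValues.
Variable K : fieldType.
Implicit Types (f g r : powser K) (F : nat -> powser K).
Notation rho := (ps_var K).

Lemma ps_coef_XnM N g i : (rho ^+ N * g) i = if (N <= i)%N then g (i - N)%N else 0.
Proof.
rewrite ps_coefM; case: ifP => h.
  rewrite (bigD1 (Ordinal (h : N < i.+1)%N)) //= ps_coefXn eqxx mul1r big1 ?addr0 // => j.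
  by rewrite -(inj_eq val_inj) /= => /negbTE jN; rewrite ps_coefXn jN mul0r.
rewrite big1 // => j _; rewrite ps_coefXn (_ : _ == _ = false) ?mul0r //.
by apply/eqP => jN; have := leq_ord j; rewrite jN h.
Qed.

Lemma vge_dvd N f : vge N f -> exists g, f = rho ^+ N * g.
Proof.
move=> /(iffLR (@ps_vgeP _ N f)) h; exists (Powser (fun i => f (i + N)%N)).
apply: powserP => i; rewrite ps_coef_XnM; case: leqP => iN; last exact: h.
by rewrite /= subnK.
Qed.

Lemma tofrac_sum (J : Type) (s : seq J) (P : pred J) (F : J -> powser K) :
  (\sum_(j <- s | P j) F j)%:L = \sum_(j <- s | P j) (F j)%:L.
Proof. exact: rmorph_sum. Qed.

(** The partial sums defining T are those of a sum in K[[t]] up to a common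
    factor c, which may have a pole: e bounds its order. *)
Lemma T_asum k (u q c : laurent K) F e p :
  c * (rho ^+ e)%:L = p%:L -> (forall n, vge n (F n)) ->
  (forall n, (-1) ^+ n * (2 * n + 1)%:R ^+ k * q ^+ (n * n.+1)./2
     * (u ^+ n.+1 - (-1) ^+ k * u ^- n) = c * (F n)%:L) ->
  T k u q = c * (asum F)%:L.
Proof.
move=> hc hF hT; apply: tsumE => N; exists (e + N)%N => m hm.
have [g hg] := vge_dvd (asum_spec hF m).
exists (p * (rho ^+ (m - e - N) * g)).
rewrite (eq_bigr (fun n : 'I_m => c * (F n)%:L)) => [|n _]; last exact: hT.
rewrite -mulr_sumr -mulrBr -tofrac_sum -tofracB hg.
rewrite (_ : m = e + (N + (m - e - N)))%N; last lia.
rewrite !exprD !tofracM (mulrA c) (mulrA c) hc.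
rewrite (_ : (e + (N + (m - e - N)) - e - N = m - e - N)%N); last lia.
by rewrite ?tofracM; ring.
Qed.

Lemma T_asum1 k (u q : laurent K) F : (forall n, vge n (F n)) ->
  (forall n, (-1) ^+ n * (2 * n + 1)%:R ^+ k * q ^+ (n * n.+1)./2
     * (u ^+ n.+1 - (-1) ^+ k * u ^- n) = (F n)%:L) ->
  T k u q = (asum F)%:L.
Proof.
move=> hF hT; rewrite (@T_asum k u q 1 F 0 1) ?mul1r // => n.
by rewrite mul1r hT.
Qed.

Lemma asum_shift F G : (forall n, vge n (F n)) -> (forall n, vge n (G n)) ->
  asum (fun n => F n - G n) = asum (fun n => F n - G n.+1) - G 0%N.
Proof.
move=> hF hG; have hS n : vge n (G n.+1) by apply: vge_leq (hG n.+1).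
by rewrite !asumB // (asum_recl hG); ring.
Qed.

Variable r : powser K.
Hypotheses (hr : vge 1 r) (r0 : r != 0).
Let rL := r%:L.

Lemma rL0 : rL != 0. Proof. by rewrite tofrac_eq0. Qed.

Lemma expVB (x : laurent K) a b : x != 0 -> (b <= a)%N -> x ^+ a * x ^- b = x ^+ (a - b).
Proof. by move=> x0 ab; rewrite -{1}(subnK ab) exprD mulfK ?expf_neq0. Qed.

Lemma tofrac_term k n m e :
  ((-1) ^+ n * m%:R ^+ k * r ^+ e)%:L = (-1) ^+ n * m%:R ^+ k * rL ^+ e.
Proof. by rewrite !tofracM !tofracXn tofracN tofrac1 (rmorph_nat (@tofrac _)). Qed.

Lemma tofrac_subsign k f g : (f - (-1) ^+ k * g)%:L = f%:L - (-1) ^+ k * g%:L.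
Proof. by rewrite tofracB tofracM tofracXn tofracN tofrac1. Qed.

Lemma rL9 n : ((rL ^+ 3) ^+ 3) ^+ n = rL ^+ (9 * n).
Proof. by rewrite -!exprM; congr (_ ^+ _); lia. Qed.

Lemma T_one : T 1 1 ((rL ^+ 3) ^+ 3) = (2%:R * odd_sum r)%:L.
Proof.
rewrite /odd_sum -asumMl => [|n]; last exact: odd_sum_term.
apply: T_asum1 => n; first by apply: vgeMl; exact: odd_sum_term.
rewrite rL9 -/(tri n) !expr1n invr1 !expr1 tofracM.
have := tofrac_term 1 n (2 * n + 1) (9 * tri n); rewrite !expr1 => ->.
by rewrite (rmorph_nat (@tofrac _)); ring.
Qed.

Definition Tlow k u n : powser K := (-1) ^+ n * (2 * n + 1)%:R ^+ k * r ^+ (9 * tri n + u * n.+1).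
Definition Thigh k u n : powser K := (-1) ^+ n * (2 * n + 1)%:R ^+ k * r ^+ (9 * tri n - u * n).

Lemma vge_Tlow k u n : vge n (Tlow k u n).
Proof. by apply: vge_X => //; have := tri_ge n; lia. Qed.
Lemma vge_Thigh k u n : (u <= 6)%N -> vge n (Thigh k u n).
Proof. by move=> u6; apply: vge_X => //; have := tri_ge n; nia. Qed.

(** The second halves of the terms are shifted by one index, their instance
    n = 0 being the constant (-1)^k: this is the pairing used in [thq] and
    [dth]. *)
Lemma T_power k u : (u <= 6)%N -> T k (rL ^+ u) ((rL ^+ 3) ^+ 3) =
  (asum (fun n => Tlow k u n - (-1) ^+ k * Thigh k u n.+1) - (-1) ^+ k)%:L.
Proof.
move=> u6; have hH n := @vge_Thigh k u n u6.
rewrite (_ : asum _ - _ = asum (fun n => Tlow k u n - (-1) ^+ k * Thigh k u n)); last first.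
  rewrite (asum_shift (vge_Tlow k u) (G := fun n => (-1) ^+ k * Thigh k u n)); last first.
    by move=> n; exact: vgeMl.
  by congr (_ - _); rewrite /Thigh muln0 expr0 tri0 muln0 muln0 add0n expr1n !mulr1.
apply: T_asum1 => n; first by apply: vgeB; [exact: vge_Tlow | apply: vgeMl].
have eL : (Tlow k u n)%:L = _ := tofrac_term k n (2 * n + 1) _.
have eH : (Thigh k u n)%:L = _ := tofrac_term k n (2 * n + 1) _.
rewrite rL9 -/(tri n) -(exprM rL u n.+1) -(exprM rL u n).
rewrite [RHS](tofrac_subsign k (Tlow k u n) (Thigh k u n)) eL eH.
have e1 : rL ^+ (9 * tri n + u * n.+1) = rL ^+ (9 * tri n) * rL ^+ (u * n.+1) by rewrite exprD.
have e2 : rL ^+ (9 * tri n - u * n) = rL ^+ (9 * tri n) * rL ^- (u * n).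
  by rewrite expVB ?rL0 //; have := tri_ge n; nia.
by rewrite e1 e2; ring.
Qed.

Lemma thq_asum : thq r = asum (fun n => Tlow 0 3 n - Thigh 0 3 n.+1) - 1.
Proof.
rewrite /thq /ram; congr (_ - _); apply: eq_asum => n.
rewrite /Tlow /Thigh !expr0 !mulr1 [(-1) ^+ n.+1]exprS mulN1r mulNr opprK -mulrDr -!exprM -!exprD triS.
by congr (_ * (_ ^+ _ + _ ^+ _)); lia.
Qed.

Lemma vge_ThighS k u n : (u <= 6)%N -> vge n (Thigh k u n.+1).
Proof. by move=> u6; apply: vge_leq (@vge_Thigh k u n.+1 u6). Qed.

Lemma T0_q : T 0 (rL ^+ 3) ((rL ^+ 3) ^+ 3) = (thq r)%:L.
Proof.
rewrite T_power // thq_asum; congr ((_ - _)%:L); apply: eq_asum => n.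
by rewrite expr0 mul1r.
Qed.

Lemma T1_q : T 1 (rL ^+ 3) ((rL ^+ 3) ^+ 3) = (2%:R * dth r - thq r)%:L.
Proof.
rewrite T_power //; congr (_%:L).
rewrite thq_asum /dth -asumMl => [|n]; last exact: dth_term.
rewrite opprB addrA addrAC -asumB => [|n|n]; first last.
- by apply: vgeB; [exact: vge_Tlow | exact: vge_ThighS].
- by apply: vgeMl; exact: dth_term.
rewrite expr1 opprK; congr (_ + 1); apply: eq_asum => n.
rewrite /Tlow /Thigh triS !expr1 !expr0 !mulr1 [(-1) ^+ n.+1]exprS.
rewrite (_ : (3 * (tri n + n.+1) + 6 * tri n = 9 * tri n + 3 * n.+1)%N); last lia.
rewrite (_ : (3 * tri n + 6 * (tri n + n.+1) = 9 * (tri n + n.+1) - 3 * n.+1)%N); last lia.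
by rewrite !(natrD, natrM) -!natr1; ring.
Qed.

Lemma T1_q2 : T 1 (rL ^+ 6) ((rL ^+ 3) ^+ 3) = (- (2%:R * dth r) - thq r)%:L.
Proof.
rewrite T_power //; congr (_%:L).
rewrite thq_asum /dth -asumMl => [|n]; last exact: dth_term.
rewrite -asumN => [|n]; last by apply: vgeMl; exact: dth_term.
rewrite opprB addrA addrAC -asumB => [|n|n]; first last.
- by apply: vgeB; [exact: vge_Tlow | exact: vge_ThighS].
- by apply: vgeN; apply: vgeMl; exact: dth_term.
rewrite expr1 opprK; congr (_ + 1); apply: eq_asum => n.
rewrite /Tlow /Thigh triS !expr1 !expr0 !mulr1 [(-1) ^+ n.+1]exprS.
rewrite (_ : (3 * (tri n + n.+1) + 6 * tri n = 9 * tri n + 3 * n.+1)%N); last lia.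
rewrite (_ : (3 * tri n + 6 * (tri n + n.+1) = 9 * tri n + 6 * n.+1)%N); last lia.
rewrite (_ : (9 * (tri n + n.+1) - 3 * n.+1 = 9 * tri n + 6 * n.+1)%N); last lia.
rewrite (_ : (9 * (tri n + n.+1) - 6 * n.+1 = 9 * tri n + 3 * n.+1)%N); last lia.
by rewrite !(natrD, natrM) -!natr1; ring.
Qed.

(** The argument u = s q^(-2/3) has a pole, whose order is at most 2 because
    r w = t. *)
Section Kappa.
Variable s : K.
Hypothesis s0 : s != 0.
Let sL' : laurent K := (ps_const s)%:L.

Lemma tofrac_acX a : (ac (s ^+ a) : powser K)%:L = sL' ^+ a.
Proof. by rewrite rmorphXn tofracXn. Qed.

Lemma sL'_neq0 : sL' != 0.
Proof. by rewrite tofrac_eq0 -(rmorph0 (@ac K (powser K))) (inj_eq (fmorph_inj (@ac K (powser K)))). Qed.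

Lemma tofrac_acV a : (ac (s ^- a) : powser K)%:L = sL' ^- a.
Proof.
have h : (ac (s ^- a) : powser K)%:L * sL' ^+ a = 1.
  by rewrite -tofrac_acX -tofracM -rmorphM mulVf ?expf_neq0 ?rmorph1 ?tofrac1.
by rewrite -[LHS](mulfK (expf_neq0 a sL'_neq0)) h mul1r.
Qed.

Variable w : powser K.
Hypothesis rw : r * w = ps_var K.
Let kap := sL' * rL ^- 2.

Lemma kap_pole : kap * (rho ^+ 2)%:L = (ac s * w ^+ 2)%:L.
Proof.
have -> : (rho ^+ 2)%:L = rL ^+ 2 * w%:L ^+ 2 by rewrite -rw tofracXn tofracM exprMn.
by rewrite /kap -mulrA mulKf ?expf_neq0 ?rL0 // tofracM tofracXn.
Qed.

Lemma kap_low n : rL ^+ (3 * tri n) * kap ^+ n.+1 = kap * (sL' ^+ n * rL ^+ (3 * tri n - 2 * n)).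
Proof. by apply: kap_pow_low; [exact: rL0 | have := tri_ge n; lia]. Qed.

Lemma kap_high n : rL ^+ (3 * tri n) * kap ^- n =
  kap * (sL' ^- n.+1 * rL ^+ (3 * tri n + 2 * n.+1)).
Proof. by apply: kap_pow_high; [exact: sL'_neq0 | exact: rL0]. Qed.

Lemma tofrac_pair n (a b : powser K) (c d : powser K) :
  ((-1) ^+ n * (a * c - b * d))%:L = (-1) ^+ n * (a%:L * c%:L - b%:L * d%:L).
Proof. by rewrite tofracM tofracB !tofracM tofracXn tofracN tofrac1. Qed.

Lemma T0_kap : T 0 kap (rL ^+ 3) = kap * (G0 s r)%:L.
Proof.
apply: (T_asum kap_pole) => n; first exact: G0_term.
rewrite tofrac_pair tofrac_acX tofrac_acV !tofracXn -/rL -/(tri n) -(exprM rL 3) !expr0 mulr1 mul1r.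
rewrite -mulrA mulrBr kap_low kap_high; ring.
Qed.

Lemma T1_kap : T 1 kap (rL ^+ 3) = kap * (G0 s r - 2%:R * G1 s r)%:L.
Proof.
rewrite /G0 /G1 -asumMl => [|n]; last exact: G1_term.
rewrite -asumB => [|n|n]; first last.
- by apply: vgeMl; exact: G1_term.
- exact: G0_term.
apply: (T_asum kap_pole) => n.
  by apply: vgeB; [exact: G0_term | apply: vgeMl; exact: G1_term].
rewrite (_ : _ - _ = (-1) ^+ n * ((2 * n + 1)%:R * ac (s ^+ n) * r ^+ (3 * tri n - 2 * n)
   - (- (2 * n + 1)%:R * ac (s ^- n.+1)) * r ^+ (3 * tri n + 2 * n.+1))); last first.
  by rewrite -!natr1 !(natrD, natrM); ring.
rewrite tofrac_pair !tofracM tofracN (rmorph_nat (@tofrac _)) tofrac_acX tofrac_acV !tofracXn.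
rewrite -/rL -/(tri n) -(exprM rL 3) !expr1.
transitivity ((-1) ^+ n * (2 * n + 1)%:R * (rL ^+ (3 * tri n) * kap ^+ n.+1
    + rL ^+ (3 * tri n) * kap ^- n)); first by ring.
by rewrite kap_low kap_high; ring.
Qed.

End Kappa.

End TValues.

(** * The nome as a power series in t *)

Section Inversion.
Variable K : fieldType.
Implicit Types (f r : powser K).
Notation rho := (ps_var K).
Notation A := (@ac K (powser K)).

(** Composition as a total function of the inner series, so that the
    iteration [rseq] can be defined before its terms are known to have positive
    order. *)
Definition cs f r : powser K := csum A f r.

Lemma csE f r (hr : vge 1 r) : cs f r = pscomp A hr f. Proof. by []. Qed.

(** Composition does not increase distances, so that r |-> t vq(r) is a
    contraction: this gives both the existence and the uniqueness of r. *)
Lemma cs_lip f r r' n : vge 1 r -> vge 1 r' -> vge n (r - r') -> vge n (cs f r - cs f r').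
Proof.
move=> hr hr' h; rewrite /cs /csum -asumB => [|k|k]; first last.
- exact: csum_term.
- exact: csum_term.
apply: vge_asum => k; first by apply: vgeB; exact: csum_term.
by rewrite -mulrBr subrXX; apply: vgeMl; apply: vgeMr.
Qed.

(** The reciprocal of t0, so that t = r t0(r) reads r = t vq(r). *)
Definition vq : powser K := lam_num rho * - ainv (- odd_sum rho).

Lemma vq_odd : vq * odd_sum rho = lam_num rho.
Proof.
rewrite /vq -mulrA mulNr -mulrN (mulrC (ainv _)) mul_ainv ?mulr1 //.
by apply: odd_sum_near; exact: vge_var.
Qed.

Definition nome_eqn r := r * odd_sum r = rho * lam_num r.

Lemma odd_sum_neq0 (B : adicAlgType K) (z : B) : vge 1 z -> odd_sum z != 0.
Proof. by move=> hz; apply: near1_neq0; exact: odd_sum_near. Qed.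

Lemma lam_num_neq0 (B : adicAlgType K) (z : B) : vge 1 z -> lam_num z != 0.
Proof. by move=> hz; apply: near1_neq0; exact: lam_num_near. Qed.

Lemma cs_vq r : vge 1 r -> cs vq r * odd_sum r = lam_num r.
Proof.
move=> hr; have hd := pscomp_adic hr.
have e1 := odd_sum_hom hd.1 (vge_var K); rewrite /= pscomp_var in e1.
have e2 := lam_num_hom hd.1 (vge_var K); rewrite /= pscomp_var in e2.
by rewrite -e1 -e2 (csE _ hr) -rmorphM vq_odd.
Qed.

Lemma nome_fix r : vge 1 r -> nome_eqn r <-> r = rho * cs vq r.
Proof.
move=> hr; rewrite /nome_eqn; split => [e|e].
  by apply: (mulIf (odd_sum_neq0 hr)); rewrite -mulrA cs_vq.
by rewrite {1}e -mulrA cs_vq.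
Qed.

Lemma nome_unique r r' : vge 1 r -> vge 1 r' -> nome_eqn r -> nome_eqn r' -> r = r'.
Proof.
move=> hr hr' /(nome_fix hr) e /(nome_fix hr') e'.
apply/eqP; rewrite -subr_eq0; apply/eqP/vge_eq0; elim=> [|n IH]; first exact: vge0r.
by rewrite e e' -mulrBr -add1n; apply: vgeM; [exact: vge_var | exact: cs_lip].
Qed.

Fixpoint rseq n : powser K := if n is m.+1 then rho * cs vq (rseq m) else 0.

Lemma vge_rseq n : vge 1 (rseq n).
Proof. by case: n => [|n] /=; [exact: vge_zero | apply: vgeMr; exact: vge_var]. Qed.

Lemma rseq_cauchy n : vge n (rseq n.+1 - rseq n).
Proof.
elim: n => [|n IH]; first exact: vge0r.
have -> : rseq n.+2 - rseq n.+1 = rho * (cs vq (rseq n.+1) - cs vq (rseq n)) by rewrite mulrBr.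
rewrite -add1n; apply: vgeM; first exact: vge_var.
by apply: cs_lip IH; exact: vge_rseq.
Qed.

Lemma nome_exists : exists2 r, vge 1 r & nome_eqn r.
Proof.
pose r := asum (fun n => rseq n.+1 - rseq n).
have hN N : vge N (r - rseq N).
  have := asum_spec rseq_cauchy N; rewrite -/r.
  have -> // : \sum_(n < N) (rseq n.+1 - rseq n) = rseq N.
  by elim: N => [|N IH]; rewrite ?big_ord0 // big_ord_recr IH /=; ring.
have hr : vge 1 r by rewrite -(subrK (rseq 1) r); apply: vgeD; [exact: hN | exact: vge_rseq].
exists r => //; apply/(nome_fix hr); apply/eqP; rewrite -subr_eq0; apply/eqP/vge_eq0 => N.
have -> : r - rho * cs vq r = (r - rseq N.+1) - rho * (cs vq r - cs vq (rseq N)).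
  by rewrite mulrBr opprB addrA subrK.
apply: vgeB; first by apply: vge_leq (hN N.+1).
by apply: vgeMl; apply: cs_lip => //; exact: vge_rseq.
Qed.

(** The second terms of the series [odd_sum], [thq] and [dth] have order at
    least 9; this precision determines r^3 up to t^9. *)
Lemma vq_expansion : vge 9 (vq - (1 + 5%:R * rho ^+ 3 - 7%:R * rho ^+ 6)).
Proof.
set p := 1 + _ - _.
have hv := vge_var K.
have hodd : vge 9 (1 - odd_sum rho).
  rewrite /odd_sum asum_recl => [|n]; last exact: odd_sum_term.
  rewrite tri0 !muln0 !expr0 !mul1r opprD addrA subrr add0r; apply: vgeN.
  apply: vge_asum => n; first by apply: vge_leq (@odd_sum_term _ _ _ n.+1 hv).
  by apply: vge_X => //; rewrite triS; lia.
have hth : vge 9 (thq rho - (rho ^+ 3 + rho ^+ 6 - 1)).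
  have hterm := fun n => @ram_term _ _ (rho ^+ 3) (rho ^+ 6) n (vgeXS 2 hv) (vgeXS 5 hv).
  rewrite /thq /ram (asum_recl hterm) tri0 (_ : tri 1 = 1%N) // !expr0 !expr1 mulr1 !mul1r.
  rewrite [X in vge _ X](_ : _ = asum (fun n => (-1) ^+ n.+1 * ((rho ^+ 3) ^+ tri n.+2 * (rho ^+ 6) ^+ tri n.+1 + (rho ^+ 3) ^+ tri n.+1 * (rho ^+ 6) ^+ tri n.+2))); last by ring.
  apply: vge_asum => n; first by apply: vge_leq (hterm n.+1).
  by rewrite -!exprM mulrDr; apply: vgeD; rewrite -exprD; apply: vge_X => //; rewrite !triS; lia.
have hdt : vge 9 (dth rho - (rho ^+ 3 - rho ^+ 6)).
  have hterm := fun n => @dth_term _ _ _ n hv.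
  rewrite /dth (asum_recl hterm) tri0 (_ : tri 1 = 1%N) // !muln0 !muln1 addn0 add0n expr0 !mul1r.
  rewrite addrAC subrr add0r; apply: vge_asum => n; first by apply: vge_leq (hterm n.+1).
  by rewrite mulrBr; apply: vgeB; apply: vge_X => //; rewrite !triS; lia.
have hlam : vge 9 (lam_num rho - p).
  rewrite /lam_num (_ : _ - p = 6%:R * (dth rho - (rho ^+ 3 - rho ^+ 6))
    - (thq rho - (rho ^+ 3 + rho ^+ 6 - 1))); last by rewrite /p; ring.
  by apply: vgeB => //; apply: vgeMl.
have h : vge 9 ((vq - p) * odd_sum rho).
  rewrite mulrBl vq_odd (_ : _ - _ = (lam_num rho - p) + p * (1 - odd_sum rho)); last by ring.
  by apply: vgeD => //; apply: vgeMl.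
have hi : odd_sum rho * - ainv (- odd_sum rho) = 1.
  by rewrite mulrN -mulNr mul_ainv //; apply: odd_sum_near.
by rewrite -[X in vge 9 X]mulr1 -hi mulrA; apply: vgeMr.
Qed.

Lemma nome_w_expansion r : vge 1 r -> nome_eqn r ->
  exists2 e, vge 9 e & r = rho * (1 + 5%:R * r ^+ 3 - 7%:R * r ^+ 6 + e).
Proof.
move=> hr /(nome_fix hr) er.
exists (cs vq r - (1 + 5%:R * r ^+ 3 - 7%:R * r ^+ 6)); last first.
  rewrite [LHS]er; congr (_ * _); ring.
have := pscomp_vge A hr vq_expansion.
rewrite rmorphB rmorphB rmorphD (rmorphM _ 5%:R) (rmorphM _ 7%:R) !rmorphXn rmorph1 !rmorph_nat.
by rewrite /= pscomp_var -csE.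
Qed.

Lemma nome_coef r : vge 1 r -> nome_eqn r -> r 0%N = 0 /\ r 1%N = 1.
Proof.
move=> hr /(nome_w_expansion hr)[e he er]; split; first exact: (iffLR (@ps_vgeP _ 1 r) hr).
have h2 : vge 2 (r - rho).
  rewrite {1}er (_ : _ - rho = rho * (5%:R * r ^+ 3 - 7%:R * r ^+ 6 + e)); last by ring.
  apply: (@vgeM _ _ 1 1); first exact: vge_var.
  apply: vgeD; last by apply: vge_leq he.
  by apply: vgeB; apply: vgeMl; exact: vgeXS.
have := iffLR (@ps_vgeP _ 2 _) h2 1%N isT.
by rewrite ps_coefB ps_coef_var => /eqP; rewrite subr_eq0 => /eqP.
Qed.

(** With q = r^3 and E = 5 q - 7 q^2 + ..., one has q = t^3 (1 + E)^3; each
    substitution of this equation into itself gains three orders. *)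
Lemma nome_expansion r : vge 1 r -> nome_eqn r ->
  exists h, r ^+ 3 = rho ^+ 3 + 15%:R * rho ^+ 6 + 279%:R * rho ^+ 9 + rho ^+ 10 * h.
Proof.
move=> hr /(nome_w_expansion hr)[e he er].
pose q := r ^+ 3; pose E := 5%:R * q - 7%:R * q ^+ 2 + e.
have hv := vge_var K.
have hq : vge 3 q by exact: vgeX.
have hv3 : vge 3 (rho ^+ 3) by exact: vgeX.
have hE : vge 3 E.
  apply: vgeD; last by apply: vge_leq he.
  apply: vgeB; first exact: vgeMl.
  by apply: vgeMl; rewrite expr2; exact: vgeMl.
have qE : q = rho ^+ 3 * (1 + E) ^+ 3.
  rewrite /q [in LHS]er exprMn; congr (_ * _ ^+ 3); rewrite /E /q -exprM; ring.
pose a := q - rho ^+ 3.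
have ha : vge 6 a.
  rewrite /a qE (_ : _ - _ = rho ^+ 3 * (E * (3%:R + 3%:R * E + E ^+ 2))); last by ring.
  by apply: (@vgeM _ _ 3 3) => //; exact: vgeMr.
have h6 (f g : powser K) : vge 3 f -> vge 3 g -> vge 6 (f * g) by exact: (@vgeM _ _ 3 3).
have h9 (f g : powser K) : vge 6 f -> vge 3 g -> vge 9 (f * g) by exact: (@vgeM _ _ 6 3).
have ha' : vge 9 (a - 15%:R * rho ^+ 6).
  rewrite {1}/a qE.
  rewrite (_ : _ - _ = rho ^+ 3 * (15%:R * a - 21%:R * (q * q) + 3%:R * e
      + E * E * (3%:R + E))); last by rewrite /a /E; ring.
  apply: (@vgeM _ _ 3 6) => //; apply: vgeD; last by apply: vgeMr; exact: h6.
  apply: vgeD; last by apply: vgeMl; apply: vge_leq he.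
  by apply: vgeB; apply: vgeMl => //; exact: h6.
suff h : vge 10 (q - (rho ^+ 3 + 15%:R * rho ^+ 6 + 279%:R * rho ^+ 9)).
  by have [g hg] := vge_dvd h; exists g; rewrite -hg /q; ring.
rewrite {1}qE (_ : _ - _ = rho ^+ 3 * (15%:R * (a - 15%:R * rho ^+ 6)
    + 54%:R * (a * (2%:R * rho ^+ 3 + a)) + 3%:R * e + 3%:R * ((E - 5%:R * q) * (E + 5%:R * q))
    + E * E * E)); last by rewrite /a /E; ring.
apply: (@vge_leq _ _ _ (3 + 9)) => //; apply: vgeM => //.
have h5 : vge 6 (E - 5%:R * q).
  rewrite (_ : _ - _ = e - 7%:R * (q * q)); last by rewrite /E; ring.
  by apply: vgeB; [apply: vge_leq he | apply: vgeMl; exact: h6].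
apply: vgeD; last by apply: h9 => //; exact: h6.
apply: vgeD; last first.
  by apply: vgeMl; apply: h9 => //; apply: vgeD => //; exact: vgeMl.
apply: vgeD; last exact: vgeMl.
apply: vgeD; first exact: vgeMl.
apply: vgeMl; apply: h9 => //; apply: vgeD; first exact: vgeMl.
by apply: vge_leq ha.
Qed.

End Inversion.

(** * The closed form over the field of rational functions of s *)

HB.instance Definition _ := GRing.RMorphism.copy Qs_of_rat (@tofrac {poly rat} \o polyC).

Lemma Qs_natr_neq0 n : n.+1%:R != 0 :> Qs.
Proof. by rewrite -(rmorph_nat Qs_of_rat) fmorph_eq0 pnatr_eq0. Qed.

Lemma svar_neq0 : svar != 0.
Proof. by rewrite tofrac_eq0 polyX_eq0. Qed.

Lemma svar3_neq1 : 1 - svar ^+ 3 != 0.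
Proof.
rewrite subr_eq0 /svar -tofracXn -tofrac1 tofrac_eq eq_sym.
by apply/eqP => /(congr1 (fun p : {poly rat} => size p)); rewrite size_polyXn size_poly1.
Qed.

Section RatToQs.
Implicit Types f g : powser rat.

Definition psQ f : powser Qs := Powser (fun n => Qs_of_rat (f n)).

Lemma psQ_zmod : zmod_morphism psQ.
Proof. by move=> f g; apply: powserP => n; rewrite ps_coefB /= ps_coefB rmorphB. Qed.

Lemma psQ_monoid : monoid_morphism psQ.
Proof.
split; first by apply: powserP => n; rewrite ps_coef1 /= ps_coef1 rmorph_nat.
move=> f g; apply: powserP => n; rewrite ps_coefM [LHS]/= ps_coefM rmorph_sum.
by apply: eq_bigr => i _; rewrite rmorphM.
Qed.

HB.instance Definition _ := GRing.isZmodMorphism.Build _ _ psQ psQ_zmod.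
HB.instance Definition _ := GRing.isMonoidMorphism.Build _ _ psQ psQ_monoid.

Lemma psQ_inj : injective psQ.
Proof.
move=> f g fg; apply: powserP => n.
by apply: (fmorph_inj Qs_of_rat); have := congr1 (fun h : powser Qs => h n) fg.
Qed.

Lemma psQ_vge n f : vge n f -> vge n (psQ f).
Proof.
move=> /(iffLR (@ps_vgeP _ n f)) h; apply/ps_vgeP => i hi.
by rewrite /= h // rmorph0.
Qed.

Lemma psQ_var : psQ (ps_var rat) = ps_var Qs.
Proof. by apply: powserP => n; rewrite /= !ps_coef_var rmorph_nat. Qed.

Lemma QtoLE f : QtoL f = (psQ f)%:L. Proof. by []. Qed.

Lemma psQ_nome f : vge 1 f -> nome_eqn (psQ f) <-> nome_eqn f.
Proof.
move=> hf; rewrite /nome_eqn -(odd_sum_hom (@psQ_vge) hf) -(lam_num_hom (@psQ_vge) hf) -psQ_var -!rmorphM.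
by split => [/psQ_inj|->].
Qed.

Lemma q_equationE r : vge 1 r -> r != 0 -> q_equation (r ^+ 3) r <-> nome_eqn r.
Proof.
move=> hr r0; have hr' := psQ_vge hr; rewrite -psQ_nome // /q_equation /nome_eqn.
have r0' : psQ r != 0 by rewrite -(rmorph0 psQ) (inj_eq psQ_inj).
rewrite !QtoLE rmorphXn tofracXn T_one // T0_q // T1_q //.
set R := psQ r in hr' r0' *; set o := odd_sum R; set d := dth R; set h := thq R.
have l0 : (2%:R * lam_num R)%:L != 0.
  by rewrite tofrac_eq0 mulf_neq0 ?lam_num_neq0 // natr_ps_neq0 //; exact: Qs_natr_neq0.
have -> : 4%:R * h%:L + 6%:R * (2%:R * d - h)%:L = (2%:R * lam_num R)%:L.
  have nat_tofrac n : n%:R = (n%:R : powser Qs)%:L by rewrite rmorph_nat.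
  by rewrite !nat_tofrac -!tofracM -tofracD; congr (_%:L); rewrite /lam_num -/d -/h; ring.
have two : 2%:R != 0 :> powser Qs by apply: natr_ps_neq0; exact: Qs_natr_neq0.
split => [e|e].
  have := congr1 (fun x => x * (2%:R * lam_num R)%:L) e.
  rewrite /= mulrA divfK // -!tofracM => /eqP; rewrite tofrac_eq => /eqP e'.
  by apply: (mulfI two); rewrite mulrCA -e'; ring.
apply: (mulIf l0); rewrite mulrA divfK // -!tofracM; congr (_%:L).
by rewrite mulrCA -e; ring.
Qed.

Lemma is_cbrt_vge q r : is_cbrt q r -> vge 1 r /\ r != 0.
Proof.
case=> _ r0 r1; split; first by apply/ps_vgeP => -[].
by apply/eqP => e; move: r1; rewrite e ps_coef0 => /eqP; rewrite eq_sym oner_eq0.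
Qed.

(** The defining equation of q, cleared of denominators, in terms of the
    cube root r. *)
Lemma is_qP q : is_q q <-> exists2 r, vge 1 r & nome_eqn r /\ q = r ^+ 3.
Proof.
split => [[q0 [r hr he]]|[r hr [he ->]]].
  have [h1 h0] := is_cbrt_vge hr; exists r => //; case: hr => e _ _.
  split; last by rewrite e.
  by apply/(q_equationE h1 h0); rewrite e.
have [r0 r1] := nome_coef hr he.
have rn0 : r != 0 by apply/eqP => e; move: r1; rewrite e ps_coef0 => /eqP; rewrite eq_sym oner_eq0.
split; first exact: (iffLR (@ps_vgeP _ 3 _) (vgeX 3 hr)).
by exists r => //; apply/q_equationE.
Qed.

(** If r and r' differ then r^2 + r r' + r'^2 = 0, but its coefficient
    of index 2 is 3. *)
Lemma is_cbrt_unique q r r' : is_cbrt q r -> is_cbrt q r' -> r = r'.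
Proof.
move=> [e r0 r1] [e' r0' r1'].
have : (r - r') * (r ^+ 2 + r * r' + r' ^+ 2) = 0.
  by transitivity (r ^+ 3 - r' ^+ 3); [ring | rewrite e e' subrr].
move/eqP; rewrite mulf_eq0 subr_eq0 => /orP[/eqP //|/eqP h].
have := congr1 (fun f : powser rat => f 2%N) h; rewrite ps_coef0 !expr2.
have c2 (f g : powser rat) : f 0%N = 0 -> g 0%N = 0 -> f 1%N = 1 -> g 1%N = 1 -> (f * g) 2%N = 1.
  move=> f0 g0 f1 g1; rewrite ps_coefM !big_ord_recl big_ord0 /= /bump /= f0 mul0r.
  by rewrite (_ : (2 - (1 + 0) = 1)%N) // (_ : (2 - (1 + (1 + 0)) = 0)%N) // f1 g1 g0 mulr0 !addr0 add0r mulr1.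
by rewrite !ps_coefD !c2.
Qed.

Lemma exists_unique_q : exists! q : powser rat, is_q q.
Proof.
have [r hr he] := nome_exists rat; exists (r ^+ 3); split; first by apply/is_qP; exists r.
by move=> q /is_qP[r' hr' [he' ->]]; rewrite (nome_unique hr hr').
Qed.

Lemma q_expansion q : is_q q -> exists h : powser rat,
  q = ps_var rat ^+ 3 + 15%:R * ps_var rat ^+ 6 + 279%:R * ps_var rat ^+ 9 + ps_var rat ^+ 10 * h.
Proof. by move=> /is_qP[r hr [he ->]]; exact: nome_expansion. Qed.

End RatToQs.

Lemma transport_equation (A B : comNzRingType) (C : {rmorphism A -> B})
    z S a b c d f g h r S' a' b' c' d' f' g' h' :
  C S = S' -> C z = r -> C a * r = a' -> C b = b' -> C c = c' -> C d = d' ->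
  C f = f' -> C g = g' -> C h = h' ->
  ((1 - S ^+ 3) * a * z ^+ 2 * b * c - S ^+ 2 * z * b - S * d) * f = S * g * h ->
  ((1 - S' ^+ 3) * a' * r * b' * c' - S' ^+ 2 * r * b' - S' * d') * f' = S' * g' * h'.
Proof.
move=> <- <- <- <- <- <- <- <- <- e; have := congr1 C e.
by rewrite !(rmorphM, rmorphB, rmorphXn, rmorph1) => <-; ring.
Qed.

Lemma tofrac_equation (A : idomainType) (S t r a c d f g h : A) :
  ((1 - S ^+ 3) * t * r * a * c - S ^+ 2 * r * a - S * d) * f = S * g * h ->
  ((1 - tofrac S ^+ 3) * tofrac t * tofrac r * tofrac a * tofrac c
    - tofrac S ^+ 2 * tofrac r * tofrac a - tofrac S * tofrac d) * tofrac f
  = tofrac S * tofrac g * tofrac h.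
Proof. by move/(congr1 (@tofrac _)); rewrite !(tofracM, tofracB, tofracXn, tofrac1). Qed.

Lemma closed_form_algebra (F : fieldType) (c s t x a b f g k kap : F) :
  a != 0 -> b != 0 -> t != 0 -> s != 0 -> 1 - s ^+ 3 != 0 -> x != 0 -> 2%:R != 0 :> F ->
  kap != 0 ->
  ((1 - s ^+ 3) * t * x * a * c - s ^+ 2 * x * a - s * f) * b = s * g * k ->
  c = s / ((1 - s ^+ 3) * t) * (s - x^-1 * ((- (2%:R * f) - g) / (2%:R * a))
        - x^-1 * ((g * (kap * (b - 2%:R * k))) / ((2%:R * a) * (kap * b)))).
Proof.
move=> a0 b0 t00 s00 s30 x0 two k0 e.
have -> : c = (s * g * k / b + s ^+ 2 * x * a + s * f) / ((1 - s ^+ 3) * t * x * a).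
  by rewrite -e; field; rewrite a0 b0 t00 x0 s30.
by field; rewrite a0 b0 t00 x0 s30 two k0.
Qed.

Section ClosedForm.
Variables (st0 : state) (r : powser Qs).
Hypothesis st00 : (st0.1.1 + st0.1.2 = 0)%N.
Hypotheses (hr : vge 1 r) (er : nome_eqn r).
Notation S := (ac svar : powser Qs).
Notation rho := (ps_var Qs).

Let W : powser Qs := gsum (wF svar st0) rho 0.

(** Composition with r = r(t) sends t0 rho to t, by the equation of the nome. *)
Lemma walk_equation :
  ((1 - S ^+ 3) * rho * r * odd_sum r * W - S ^+ 2 * r * odd_sum r - S * dth r) * G0 svar r
    = S * thq r * G1 svar r.
Proof.
have ker := @kernel_identity Qs svar st0 svar_neq0 st00 (ps2 Qs).
have sol := solution_in_nome Qs_natr_neq0 svar_neq0 ker.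
have hd := pscomp_adic hr; set C := pscomp (@ac Qs (powser Qs)) hr in hd.
have Cv : C rho = r by exact: pscomp_var.
have Ct : C (t0 Qs) * r = rho.
  have e : C (t0 Qs) * C (lam_num rho) = C (odd_sum rho) by rewrite -(t0E Qs); apply/esym; exact: rmorphM.
  have e1 := odd_sum_hom hd.1 (vge_var Qs); have e2 := lam_num_hom hd.1 (vge_var Qs).
  rewrite /= -/C Cv in e1 e2; rewrite e1 e2 in e.
  apply: (mulIf (lam_num_neq0 hr)); rewrite mulrAC e mulrC; exact: er.
have CW : C (gsum (wF svar st0) (t0 Qs * rho) 0) = W.
  have h : C (gsum (wF svar st0) (t0 Qs * rho) 0)
      = gsum (wF svar st0) (C (t0 Qs * rho)) (C 0).
    exact: (gsum_hom (wF svar st0) hd (vge_t0rho Qs) (vge_zero 1)).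
  have c1 : C (t0 Qs * rho) = rho.
    by have -> : C (t0 Qs * rho) = C (t0 Qs) * C rho by [exact: rmorphM]; rewrite Cv Ct.
  have c0 : C 0 = 0 by exact: rmorph0.
  by rewrite c1 c0 in h.
have e1 := odd_sum_hom hd.1 (vge_var Qs); have e2 := dth_hom hd.1 (vge_var Qs).
have e3 := thq_hom hd.1 (vge_var Qs).
have e4 := G0_hom hd svar (vge_var Qs); have e5 := G1_hom hd svar (vge_var Qs).
rewrite /= -/C Cv in e1 e2 e3 e4 e5.
have CS : C S = S by exact: pscomp_const.
exact: (@transport_equation _ _ (C : {rmorphism _ -> _}) _ _ _ _ _ _ _ _ _ _ _ _ _ _ _ _ _ _ CS Cv Ct e1 CW e2 e4 e3 e5 sol).
Qed.

Lemma closed_form (q1 rL : laurent Qs) : q1 = (r ^+ 3)%:L -> rL = r%:L ->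
  W%:L = sL / ((1 - sL ^+ 3) * tL)
          * (sL - rL^-1 * (T 1 (q1 ^+ 2) (q1 ^+ 3) / T 1 1 (q1 ^+ 3))
             - rL^-1 * ((T 0 q1 (q1 ^+ 3) * T 1 (sL * rL ^- 2) q1)
                        / (T 1 1 (q1 ^+ 3) * T 0 (sL * rL ^- 2) q1))).
Proof.
have [r00 r01] := nome_coef hr er.
have r0 : r != 0.
  by apply/eqP => e; move: r01; rewrite e ps_coef0 => /eqP; rewrite eq_sym oner_eq0.
have [w rw] : exists w, r * w = rho.
  have [g rg] := vge_dvd hr; rewrite expr1 in rg.
  exists (- ainv (- g)); rewrite rg -mulrA mulrN -mulNr mul_ainv ?mulr1 //.
  apply/ps_vgeP => -[|//] _; rewrite ps_coefB ps_coef1.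
  have := ps_coef_XnM 1 g 1; rewrite expr1 -rg r01 leqnn subnn => <-.
  by rewrite subrr.
move=> -> ->; rewrite tofracXn -exprM.
rewrite T_one // T0_q // T1_q2 // (T0_kap hr r0 svar_neq0 rw) (T1_kap hr r0 svar_neq0 rw).
have e := walk_equation.
set R := r%:L; set o := odd_sum r in e *; set d := dth r in e *; set h := thq r in e *.
set g0 := G0 svar r in e *; set g1 := G1 svar r in e *.
have R0 : R != 0 by rewrite tofrac_eq0.
have o0 : o%:L != 0 by rewrite tofrac_eq0; exact: odd_sum_neq0.
have g00 : g0%:L != 0 by rewrite tofrac_eq0; exact: near1_neq0 (G0_near _ hr).
have t0' : tL != 0 by rewrite tofrac_eq0; exact: var_neq0.
have s0' : sL != 0 by exact: sL'_neq0 svar_neq0.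
have s3 : 1 - sL ^+ 3 != 0.
  rewrite -tofracXn -tofrac1 -tofracB tofrac_eq0.
  have := svar3_neq1; rewrite -(inj_eq (fmorph_inj (@ac Qs (powser Qs)))).
  by rewrite rmorphB rmorphXn rmorph1 rmorph0.
have two : 2%:R != 0 :> laurent Qs.
  by rewrite -(rmorph_nat (@tofrac _)) tofrac_eq0; exact: natr_ps_neq0 Qs_natr_neq0 1.
have nat2 : (2%:R : powser Qs)%:L = 2%:R by rewrite (rmorph_nat (@tofrac _)).
have e' : ((1 - sL ^+ 3) * tL * R * o%:L * W%:L - sL ^+ 2 * R * o%:L - sL * d%:L) * g0%:L
   = sL * h%:L * g1%:L.
  exact: tofrac_equation e.
have nat2M (x : powser Qs) : (2%:R * x)%:L = 2%:R * x%:L by rewrite tofracM nat2.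
have E1 (x y : powser Qs) : (- (2%:R * x) - y)%:L = - (2%:R * x%:L) - y%:L.
  by rewrite tofracB tofracN nat2M.
have E2 (x y : powser Qs) : (x - 2%:R * y)%:L = x%:L - 2%:R * y%:L by rewrite tofracB nat2M.
rewrite (E1 d h) (E2 g0 g1) (nat2M o).
have k0 : sL * R ^- 2 != 0.
  by apply: mulf_neq0 s0' _; rewrite invr_eq0; exact: expf_neq0 R0.
exact: (closed_form_algebra o0 g00 t0' s0' s3 R0 two k0 e').
Qed.
End ClosedForm.

(** * Arguments of complex numbers and winding angles *)

Section Polar.
Import numFieldNormedType.Exports.
Local Open Scope complex_scope.
Local Notation Re := (@complex.Re _).
Local Notation Im := (@complex.Im _).
Variable R : realType.
Implicit Types (x y p f g : R) (z e : R[i]).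

Lemma complex_ext z z' : Re z = Re z' -> Im z = Im z' -> z = z'.
Proof. by case: z z' => [a b] [a' b'] /= -> ->. Qed.

Lemma cisD x y : cis (x + y) = cis x * cis y.
Proof. by apply: complex_ext; rewrite /= ?cosD ?sinD; ring. Qed.

Lemma cis0 : cis 0 = 1 :> R[i].
Proof. by rewrite /cis cos0 sin0. Qed.

Lemma norm_cis x : `|cis x| = 1.
Proof. by rewrite normc_def /= cos2Dsin2 sqrtr1. Qed.

(** By cos x = 1 - 2 sin(x/2)^2, as sin(x/2) does not vanish for
    0 < |x| < 2 pi. *)
Lemma cos_eq1 x : cos x = 1 -> `|x| < pi *+ 2 -> x = 0.
Proof.
move=> e h; apply/eqP; rewrite -normr_eq0; set y := `|x| in h *.
have cy : cos y = 1 by rewrite /y; case: ger0P; rewrite ?cosN.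
have := normr_ge0 x; rewrite -/y le_eqVlt eq_sym => /orP[//|y0].
have : 0 < sin (y / 2).
  apply: sin_gt0_pi; rewrite divr_gt0 //= ltr_pdivrMr //.
  by move: h; rewrite mulr2n; lra.
have e2 : y / 2 *+ 2 = y by rewrite mulr2n; lra.
have := cos_mulr2n (y / 2); rewrite e2 cy cos2sin2.
move=> e1; have : sin (y / 2) ^+ 2 = 0 by move: e1; rewrite mulr2n; lra.
by move/eqP; rewrite sqrf_eq0 => /eqP ->; rewrite ltxx.
Qed.

Lemma cis_inj x y : cis x = cis y -> `|x - y| < pi *+ 2 -> x = y.
Proof.
move=> [ec es] h; apply/eqP; rewrite -subr_eq0; apply/eqP; apply: cos_eq1 h.
by rewrite cosB ec es -!expr2 cos2Dsin2.
Qed.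

(** Stated with a positive modulus, and not with the norm, so that
    it also says that z does not vanish. *)
Definition is_arg z f := exists2 p : R, 0 < p & z = p%:C * cis f.

Lemma is_arg_norm z f : is_arg z f -> z = `|z| * cis f.
Proof.
by case=> p p0 ->; rewrite normrM norm_cis mulr1 ger0_norm // lecR ltW.
Qed.

Lemma is_arg_cis z f g : is_arg z f -> z = `|z| * cis g -> cis f = cis g.
Proof.
case=> p p0 ->; rewrite normrM norm_cis mulr1 ger0_norm ?lecR ?ltW //.
by apply: mulfI; rewrite eq_complex /= eqxx andbT gt_eqF.
Qed.

Lemma is_arg_rot z f g : is_arg z g -> is_arg (cis f * z) (f + g).
Proof. by case=> p p0 ->; exists p => //; rewrite cisD mulrCA. Qed.

(** The scalar product of z with the unit vector of argument f. *)
Definition proj f z : R := Re z * cos f + Im z * sin f.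

(** The argument of z that lies within pi/2 of f.  It is meaningful, and
    continuous in z, on the half-plane where [proj f] is positive. *)
Definition argd f z : R := f + atan ((Im z * cos f - Re z * sin f) / proj f z).

Lemma polar_re (F : fieldType) (a b u v c : F) : c != 0 -> a * u + b * v != 0 ->
  (a * u + b * v) / c * (u * c - v * ((b * u - a * v) / (a * u + b * v) * c))
    = a * u ^+ 2 + a * v ^+ 2.
Proof. by move=> c0 p0; field; rewrite c0 p0. Qed.

Lemma polar_im (F : fieldType) (a b u v c : F) : c != 0 -> a * u + b * v != 0 ->
  (a * u + b * v) / c * (u * ((b * u - a * v) / (a * u + b * v) * c) + v * c)
    = b * u ^+ 2 + b * v ^+ 2.
Proof. by move=> c0 p0; field; rewrite c0 p0. Qed.

Lemma argd_is_arg f z : 0 < proj f z -> is_arg z (argd f z).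
Proof.
move=> h; have hn : proj f z != 0 by rewrite gt_eqF.
set y := (Im z * cos f - Re z * sin f) / proj f z.
have cp : 0 < cos (atan y).
  by rewrite cos_atan invr_gt0 sqrtr_gt0; have := sqr_ge0 y; lra.
have cn : cos (atan y) != 0 by rewrite gt_eqF.
have sE : sin (atan y) = y * cos (atan y) by rewrite -{2}(atanK y) /tan divfK.
exists (proj f z / cos (atan y)); first exact: divr_gt0.
rewrite /argd -/y cisD; apply: complex_ext; rewrite /= sE /y !mul0r ?subr0 ?addr0.
  rewrite polar_re // -mulrDr cos2Dsin2 mulr1 //.
by rewrite polar_im // -mulrDr cos2Dsin2 mulr1.
Qed.

Lemma argd_near f z : `|argd f z - f| < pi / 2.
Proof. by rewrite /argd addrC addKr ltr_norml atan_gtNpi2 atan_ltpi2. Qed.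

(** Both arguments are within pi/2 of f and of g, so that they differ by
    less than 2 pi. *)
Lemma argd_agree f g z : 0 < proj f z -> 0 < proj g z -> `|f - g| < pi ->
  argd f z = argd g z.
Proof.
move=> hf hg h; apply: cis_inj.
  exact: is_arg_cis (argd_is_arg hf) (is_arg_norm (argd_is_arg hg)).
have := argd_near f z; have := argd_near g z; move: h.
rewrite !ltr_norml => /andP[h1 h2] /andP[h3 h4] /andP[h5 h6].
by apply/andP; split; lra.
Qed.

Lemma proj_rot f g z : proj (f + g) (cis f * z) = proj g z.
Proof.
case: z => a b; rewrite /proj /= cosD sinD.
transitivity ((cos f ^+ 2 + sin f ^+ 2) * (a * cos g + b * sin g)); first by ring.
by rewrite cos2Dsin2 mul1r.
Qed.

Lemma argd_rot f g z : argd (f + g) (cis f * z) = f + argd g z.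
Proof.
rewrite /argd proj_rot -addrA; case: z => a b /=; congr (_ + (_ + atan (_ / _))).
rewrite cosD sinD.
transitivity ((cos f ^+ 2 + sin f ^+ 2) * (b * cos g - a * sin g)); first by ring.
by rewrite cos2Dsin2 mul1r.
Qed.

(** Freezing the parameter outside [0, 1] makes the determinations below
    continuous on the whole line, so that they can be added without gluing
    conditions. *)
Definition clamp x : R := Num.min (Num.max x 0) 1.

Lemma clamp_id x : 0 <= x <= 1 -> clamp x = x.
Proof. by case/andP=> x0 x1; rewrite /clamp (max_idPl x0) (min_idPl x1). Qed.

Lemma clamp_itv x : 0 <= clamp x <= 1.
Proof. by rewrite /clamp le_min ler01 le_max lexx orbT ge_min lexx orbT. Qed.

Lemma clamp_continuous : continuous clamp.
Proof.
move=> x; rewrite (_ : clamp = ((fun u : R => u) \max (fun=> 0)) \min (fun=> 1)); last exact/funext.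
by apply: continuous_min; [apply: continuous_max => // |]; exact: cst_continuous.
Qed.

Definition edge z e x : R[i] := z + x%:C * e.

Lemma proj_edge f z e x : proj f (edge z e x) = proj f z + x * proj f e.
Proof. by rewrite /proj /edge; case: z e => [a b] [c d] /=; ring. Qed.

(** A half-plane is convex. *)
Lemma proj_edge_gt0 f z e x : 0 < proj f z -> 0 < proj f (z + e) -> 0 <= x <= 1 ->
  0 < proj f (edge z e x).
Proof.
have -> : z + e = edge z e 1 by rewrite /edge mul1r.
rewrite !proj_edge mul1r => h0 h1 /andP[x0 x1].
rewrite (_ : _ + _ = (1 - x) * proj f z + x * (proj f z + proj f e)); last by ring.
have [->|xn] := eqVneq x 1; first by rewrite subrr mul0r add0r mul1r.
by apply: ltr_wpDr; [apply: mulr_ge0 => //; exact: ltW | apply: mulr_gt0 => //; lra].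
Qed.

Lemma edge_arg f z e : 0 < proj f z -> 0 < proj f (z + e) ->
  exists g : R -> R, [/\ continuous g, g 0 = argd f z, g 1 = argd f (z + e)
    & forall x, 0 <= x <= 1 -> is_arg (edge z e x) (g x)].
Proof.
move=> h0 h1; exists (fun x => argd f (edge z e (clamp x))).
have pos x : 0 < proj f (edge z e (clamp x)) by apply: proj_edge_gt0 => //; exact: clamp_itv.
split.
- move=> x; rewrite /argd.
  have cc : {for x, continuous clamp} by exact: clamp_continuous.
  have aff (a b : R) : {for x, continuous (fun u => a + clamp u * b)}.
    by apply: cvgD; [exact: cvg_cst | apply: cvgM; [exact: cc | exact: cvg_cst]].
  apply: cvgD; first exact: cvg_cst.
  apply: (@continuous_comp _ _ _ (fun u => (Im (edge z e (clamp u)) * cos f - Re (edge z e (clamp u)) * sin f)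
     / proj f (edge z e (clamp u))) (@atan R)); last exact: continuous_atan.
  rewrite (_ : (fun u => _) = fun u => ((Im z * cos f - Re z * sin f) + clamp u * (Im e * cos f - Re e * sin f))
      / (proj f z + clamp u * proj f e)); last first.
    apply/funext => u; rewrite proj_edge; congr (_ / _).
    by rewrite /edge; case: (z) (e) => [a b] [c d] /=; ring.
  apply: cvgM; first exact: aff.
  apply: cvgV; last exact: aff.
  by rewrite -proj_edge gt_eqF.
- by rewrite clamp_id ?lexx ?ler01 // /edge mul0r addr0.
- by rewrite clamp_id ?lexx ?ler01 // /edge mul1r.
by move=> x hx; rewrite clamp_id //; apply: argd_is_arg; exact: proj_edge_gt0.
Qed.

Lemma itv_decomp n x : 0 <= x <= n.+1%:R -> exists2 j : 'I_n.+1, 0 <= x - j%:R <= 1 & x = j%:R + (x - j%:R).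
Proof.
have e (j : nat) : x = j%:R + (x - j%:R) by rewrite addrC subrK.
elim: n => [|n IH] hx; first by exists ord0; rewrite ?subr0 ?add0r.
have [le|lt] := lerP x n.+1%:R.
  have [|j hj _] := IH; first by case/andP: hx => ->.
  by exists (widen_ord (leqnSn _) j) => //; exact: e.
exists ord_max; last exact: e.
by rewrite subr_ge0 (ltW lt) lerBlDl natr1; case/andP: hx.
Qed.

(** Two continuous determinations differ by a continuous function with values
    in the multiples of 2 pi, which is constant by the intermediate value
    theorem. *)
Lemma winding_unique z0 n (w : n.-tuple 'I_3) (th : R -> R) a :
  continuous th ->
  (forall (j : 'I_n) x, 0 <= x <= 1 ->
     is_arg (edge (walk_vertex z0 w j) (omega R ^+ tnth w j) x) (th (j%:R + x))) ->
  winding_angle z0 w a -> a = th n%:R - th 0.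
Proof.
case: n w => [|n] w cth hth [th' [cth' hth' ->]]; first by rewrite !subrr.
pose d x := th' x - th x.
have cd : {within `[0, n.+1%:R], continuous d}.
  by apply: within_continuousB => //; exact: continuous_subspaceT.
have per x : 0 <= x <= n.+1%:R -> cis (d x) = 1.
  case/itv_decomp => j hj ->; have := is_arg_cis (hth j _ hj) (hth' j _ hj).
  rewrite /d cisD => <-; rewrite -cisD subrr; exact: cis0.
suff : d n.+1%:R = d 0 by rewrite /d => e; lra.
apply/eqP; rewrite -subr_eq0; apply: contraT => ne.
have [D eD] : exists D, D = d n.+1%:R - d 0 by eexists.
(* a value of d at distance strictly between 0 and 2 pi from d 0 *)
have [eps eeps] : exists eps, eps = D / (1 + `|D|) by eexists.
have hD : 0 < 1 + `|D| by rewrite ltr_pwDl.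
have [|c hc dc] := @IVT R d 0 n.+1%:R (d 0 + eps) (ler0n _ _) cd.
  rewrite eeps; have -> : d n.+1%:R = d 0 + D by rewrite eD addrC subrK.
  have [D0|D0] := ger0P D.
    rewrite (min_idPl _) ?(max_idPr _) ?lerDl // lerD2l.
    by rewrite divr_ge0 /=; [rewrite ler_pdivrMr ?mulrDr; nra | | lra].
  rewrite (min_idPr _) ?(max_idPl _) ?gerDl ?(ltW D0) // lerD2l.
  rewrite ler_pdivlMr ?ler_pdivrMr; first by apply/andP; split; nra.
    lra.
  lra.
have p1 : 1 < pi :> R by have := pi_ge2 R; lra.
suff e0 : eps = 0.
  move/eqP: e0; rewrite eeps mulf_eq0 invr_eq0 (gt_eqF hD) orbF eD.
  by rewrite (negbTE ne).
have := per c; rewrite in_itv /= in hc; move/(_ hc); rewrite dc cisD per ?lexx ?ler0n // mul1r.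
move=> e; apply: (cis_inj (y := 0)); first by rewrite e cis0.
rewrite subr0 eeps normrM normfV (gtr0_norm hD) ltr_pdivrMr //.
rewrite mulr2n; nra.
Qed.

End Polar.

(** * The winding number in sector coordinates *)

Section Geometry.
Import numFieldNormedType.Exports.
Local Open Scope complex_scope.
Local Notation Re := (@complex.Re _).
Local Notation Im := (@complex.Im _).
Variable R : realType.
Implicit Types (z e : R[i]) (st : state) (k : int).
Notation om := (omega R).

Definition rot k : R[i] := cis (2 * pi * k%:~R / 3).

Lemma rotD k l : rot (k + l) = rot k * rot l.
Proof. by rewrite /rot -cisD intrD mulrDr mulrDl. Qed.

Lemma rot0 : rot 0 = 1.
Proof. by rewrite /rot mulr0 mul0r cis0. Qed.

Lemma rot1 : rot 1 = om.
Proof. by rewrite /rot mulr1. Qed.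

Lemma om3 : om ^+ 3 = 1.
Proof.
rewrite !exprS expr0 mulr1 /omega -!cisD /cis.
have -> : 2 * pi / 3 + (2 * pi / 3 + 2 * pi / 3) = pi *+ 2 :> R by lra.
by rewrite cos2pi sin2pi.
Qed.

Let h : R := sin (2 * pi / 3).

Lemma h_gt0 : 0 < h.
Proof. by apply: sin_gt0_pi; have := pi_gt0 R => p0; apply/andP; split; lra. Qed.

(** Read off the equation omega^2 + omega + 1 = 0, knowing that the imaginary
    part of omega is positive. *)
Lemma om_coord : om = (- (1 / 2)) +i* h /\ h ^+ 2 = 3 / 4.
Proof.
have h0 := h_gt0; rewrite /omega /cis -/h; set c := cos _.
have : (om - 1) * (om ^+ 2 + om + 1) = 0.
  by transitivity (om ^+ 3 - 1); [ring | rewrite om3 subrr].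
move/eqP; rewrite mulf_eq0 => /orP[/eqP/(congr1 Im)|].
  by rewrite /= -/h; lra.
rewrite expr2 /omega /cis -/h -/c eq_complex /= => /andP[/eqP e1 /eqP e2].
have : h * (2 * c + 1) = 0 by move: e2; lra.
move/eqP; rewrite mulf_eq0 (gt_eqF h0) /= => /eqP e3.
have e4 : c = - (1 / 2) by lra.
by split; [rewrite e4 | move: e1; rewrite e4 expr2; lra].
Qed.

Lemma h_sq : h * h = 3 / 4.
Proof. by rewrite -expr2 om_coord.2. Qed.

Lemma omE : om = (- (1 / 2)) +i* h.
Proof. exact: om_coord.1. Qed.

Lemma om_sum : om ^+ 2 = - 1 - om.
Proof. by rewrite expr2 omE; apply: complex_ext => /=; have := h_sq; lra. Qed.

Lemma rot_nat n : rot n%:Z = om ^+ n.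
Proof.
elim: n => [|n IH]; first by rewrite rot0 expr0.
by rewrite -addn1 PoszD rotD IH rot1 exprD expr1.
Qed.

Lemma rot_3 m : rot (3 * m) = 1.
Proof.
have e (n : nat) : rot (3 * n%:Z) = 1 by rewrite -PoszM rot_nat exprM om3 expr1n.
case: m => n; first exact: e.
have := rotD (3 * n.+1%:Z) (3 * Negz n); rewrite e mul1r => <-.
by rewrite NegzE mulrN subrr rot0.
Qed.

Lemma rot_rdir k (i : 'I_3) : rot k * om ^+ rdir k i = om ^+ i.
Proof.
have [m em] : exists m, k + (rdir k i)%:Z = i%:Z + 3 * m.
  by exists (- ((i%:Z - k) %/ 3)%Z); rewrite /rdir; lia.
by rewrite -!rot_nat -rotD em rotD rot_3 mulr1.
Qed.

Lemma rotN1 : rot (-1) = om ^+ 2.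
Proof. by rewrite (_ : -1 = 2%:Z + 3 * (-1)) // rotD rot_3 mulr1 rot_nat. Qed.

Lemma cis_sixth : cis (pi / 3) = - om ^+ 2 :> R[i].
Proof.
have e : cis (pi / 3) * om = - 1.
  rewrite /omega -cisD /cis (_ : _ + _ = pi); last by lra.
  by rewrite cospi sinpi; apply: complex_ext; rewrite /= ?oppr0.
by rewrite -[LHS]mulr1 -om3 exprS mulrA e mulN1r.
Qed.

Lemma cis_sixthN : cis (- (pi / 3)) = - om :> R[i].
Proof.
have e : cis (- (pi / 3)) * cis (pi / 3) = 1 :> R[i] by rewrite -cisD addNr cis0.
rewrite cis_sixth in e; have e3 := om3.
move: (cis (- (pi / 3))) e => c e.
by transitivity (c * om ^+ 3); [rewrite e3 mulr1 | transitivity (- om * (c * - om ^+ 2)); [ring | rewrite e mulr1]].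
Qed.

Definition corner : R[i] := (1 - om) / 3.

Lemma cornerE : corner = (1 / 2) +i* (- (h / 3)).
Proof.
rewrite /corner omE; apply: (mulIf (_ : 3 != 0 :> R[i])); first by rewrite pnatr_eq0.
by rewrite divfK ?pnatr_eq0 //; apply: complex_ext => /=; lra.
Qed.

(** The vertex (a, b) of the sector of index k = 0. *)
Definition sector a b : R[i] := corner + a%:R + b%:R * om ^+ 2.
Definition vertex st : R[i] := rot st.2 * sector st.1.1 st.1.2.

Lemma natc (n : nat) : n%:R = n%:R +i* 0 :> R[i].
Proof. by rewrite -(rmorph_nat (real_complex R)). Qed.

Lemma sectorE a b : sector a b = (a%:R - b%:R / 2 + 1 / 2) +i* (- (h / 3) - b%:R * h).
Proof.
rewrite /sector om_sum cornerE omE !natc; apply: complex_ext => /=; lra.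
Qed.

(** The argument - pi/6 of the corner: the sector lies in the half-plane
    around this direction. *)
Definition corner_angle : R := argd 0 corner.

Lemma corner_arg : is_arg corner corner_angle.
Proof. by apply: argd_is_arg; rewrite /proj cos0 sin0 cornerE /=; lra. Qed.

Lemma proj_gt0 d f z : is_arg d f -> 0 < Re z * Re d + Im z * Im d -> 0 < proj f z.
Proof.
case=> p p0 ->; rewrite /= !mul0r subr0 addr0 => e.
rewrite -(pmulr_rgt0 _ p0) /proj; move: e; congr (_ < _); ring.
Qed.

Lemma proj_sector a b : 0 < proj corner_angle (sector a b).
Proof.
apply: proj_gt0 corner_arg _; rewrite sectorE cornerE /=.
move: (h_sq) (congr1 ( *%R a%:R) h_sq) (congr1 ( *%R b%:R) h_sq) (ler0n R a) (ler0n R b).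
by move: (a%:R) (b%:R) => x y; lra.
Qed.

Lemma om_corner : om * corner = corner + om.
Proof. by rewrite cornerE omE; apply: complex_ext => /=; move: h_sq; lra. Qed.

Lemma om2_corner : om ^+ 2 * corner = corner - 1.
Proof. by rewrite om_sum cornerE omE; apply: complex_ext => /=; move: h_sq; lra. Qed.

(** The half-planes around the directions at plus and minus a sixth of a
    turn from the corner contain the edges that cross into the next and the
    previous sector. *)
Lemma dir_up : cis (pi / 3) * corner = (1 / 2) +i* (h / 3).
Proof.
rewrite cis_sixth om_sum cornerE omE; apply: complex_ext => /=.
  by move: h_sq; lra.
lra.
Qed.

Lemma dir_down : cis (- (pi / 3)) * corner = 0 +i* (- (2 * h / 3)).
Proof.
by rewrite cis_sixthN cornerE omE; apply: complex_ext => /=; move: h_sq; lra.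
Qed.

Lemma sector_up a : om * sector 0 a = a%:R +i* (2 * h / 3).
Proof.
rewrite sectorE omE; apply: complex_ext => /=; move: h_sq (congr1 ( *%R a%:R) h_sq); lra.
Qed.

Lemma sector_down b : om ^+ 2 * sector b 0 = (- (1 / 2 + b%:R / 2)) +i* (- (h / 3) - b%:R * h).
Proof.
rewrite om_sum sectorE omE; apply: complex_ext => /=; move: h_sq (congr1 ( *%R b%:R) h_sq); lra.
Qed.

Lemma proj_up a : 0 < proj (pi / 3 + corner_angle) (sector a 0).
Proof.
apply: proj_gt0 (is_arg_rot (pi / 3) corner_arg) _.
by rewrite dir_up sectorE /=; move: h_sq (ler0n R a); lra.
Qed.

Lemma proj_up' a : 0 < proj (pi / 3 + corner_angle) (om * sector 0 a).
Proof.
apply: proj_gt0 (is_arg_rot (pi / 3) corner_arg) _.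
by rewrite dir_up sector_up /=; move: h_sq (ler0n R a); lra.
Qed.

Lemma proj_down b : 0 < proj (- (pi / 3) + corner_angle) (sector 0 b).
Proof.
apply: proj_gt0 (is_arg_rot (- (pi / 3)) corner_arg) _.
by rewrite dir_down sectorE /=; move: h_sq (congr1 ( *%R b%:R) h_sq) (ler0n R b); lra.
Qed.

Lemma proj_down' b : 0 < proj (- (pi / 3) + corner_angle) (om ^+ 2 * sector b 0).
Proof.
apply: proj_gt0 (is_arg_rot (- (pi / 3)) corner_arg) _.
by rewrite dir_down sector_down /=; move: h_sq (congr1 ( *%R b%:R) h_sq) (ler0n R b); lra.
Qed.

(** The angle of a state: 2 pi k / 3 plus the argument inside the sector. *)
Definition ang st : R := 2 * pi * st.2%:~R / 3 + argd corner_angle (sector st.1.1 st.1.2).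

Lemma vertex_ang f st : 0 < proj f (vertex st) ->
   `|f - (2 * pi * st.2%:~R / 3 + corner_angle)| < pi -> argd f (vertex st) = ang st.
Proof.
move=> hf hd; rewrite /ang -argd_rot; apply: argd_agree hf _ hd.
by rewrite proj_rot; exact: proj_sector.
Qed.

Lemma vertex0 a b : vertex (a, b, 0) = sector a b.
Proof. by rewrite /vertex rot0 mul1r. Qed.
Lemma vertex1 a b : vertex (a, b, 1) = om * sector a b.
Proof. by rewrite /vertex rot1. Qed.
Lemma vertexN1 a b : vertex (a, b, -1) = om ^+ 2 * sector a b.
Proof. by rewrite /vertex rotN1. Qed.

(** The crossings rest on omega w = w + omega and omega^2 w = w - 1. *)
Lemma vertex_sector_move0 a b d : (d < 3)%N -> vertex (sector_move (a, b, 0) d) = sector a b + om ^+ d.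
Proof.
have c a' b' : vertex (a', b', 0 + 1) = om * sector a' b' by exact: vertex1.
have c' a' b' : vertex (a', b', 0 - 1) = om ^+ 2 * sector a' b' by exact: vertexN1.
have S a' : a'.+1%:R = a'%:R + 1 :> R[i] by rewrite -natr1.
case: d => [|[|[|//]]] _ /=.
- by rewrite vertex0 /sector S; ring.
- case: b => [|b].
    rewrite c /sector mulrDr mulrDr om_corner mulrCA -exprS om3 mulr1; ring.
  case: a => [|a].
    rewrite c' /sector S mulrDr mulrDr om2_corner; have := om_sum.
    by move: (om ^+ 2) => o2 ->; ring.
  by rewrite vertex0 /sector !S om_sum; ring.
by rewrite vertex0 /sector S; ring.
Qed.

Lemma sector_move_shift a b k d : sector_move (a, b, k) d =
  (let st := sector_move (a, b, 0) d in (st.1.1, st.1.2, k + st.2)).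
Proof.
by case: d => [|[|d]] /=; rewrite ?addr0 //; case: b => [|b] /=; rewrite ?add0r //; case: a => [|a] /=; rewrite ?addr0 ?add0r.
Qed.

Lemma vertex_rot a b k l : vertex (a, b, k + l) = rot k * vertex (a, b, l).
Proof. by rewrite /vertex rotD mulrA. Qed.

Lemma ang_rot a b k l : ang (a, b, k + l) = 2 * pi * k%:~R / 3 + ang (a, b, l).
Proof. by rewrite /ang /= intrD; ring. Qed.

(** Each edge lies in a half-plane in which the angles of the two
    states are the arguments determined near the same direction: for an edge inside
    the sector it is the half-plane around the corner, for a crossing the one
    halfway between two corners. *)
Lemma sector_move_half_plane a b d : (d < 3)%N -> exists f,
  [/\ 0 < proj f (vertex (a, b, 0)), 0 < proj f (vertex (sector_move (a, b, 0) d)),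
      argd f (vertex (a, b, 0)) = ang (a, b, 0)
    & argd f (vertex (sector_move (a, b, 0) d)) = ang (sector_move (a, b, 0) d)].
Proof.
move=> d3; have p0 := pi_gt0 R.
have half f st : 0 < proj f (vertex st) -> `|f - (2 * pi * st.2%:~R / 3 + corner_angle)| < pi ->
    0 < proj f (vertex st) /\ argd f (vertex st) = ang st.
  by move=> hf hd; split=> //; exact: vertex_ang.
have inside a' b' : 0 < proj corner_angle (vertex (a', b', 0)) /\
    argd corner_angle (vertex (a', b', 0)) = ang (a', b', 0).
  apply: half; first by rewrite vertex0; exact: proj_sector.
  by rewrite mulr0 mul0r add0r subrr normr0.
have near f (k : int) x : f = x + corner_angle -> `|x - 2 * pi * k%:~R / 3| < pi ->
    `|f - (2 * pi * k%:~R / 3 + corner_angle)| < pi.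
  by move=> ->; congr (`|_| < _); ring.
have [i1 i2] := inside a b.
have in_sector a' b' : sector_move (a, b, 0) d = (a', b', 0) -> exists f,
  [/\ 0 < proj f (vertex (a, b, 0)), 0 < proj f (vertex (sector_move (a, b, 0) d)),
      argd f (vertex (a, b, 0)) = ang (a, b, 0)
    & argd f (vertex (sector_move (a, b, 0) d)) = ang (sector_move (a, b, 0) d)].
  by move=> ->; have [j1 j2] := inside a' b'; exists corner_angle.
case: d d3 in_sector => [|[|[|//]]] _ in_sector; [exact: in_sector| | exact: in_sector].
case: b in_sector {inside i1 i2} => [|b] in_sector.
  exists (pi / 3 + corner_angle).
  have [] := half (pi / 3 + corner_angle) (a, 0%N, 0).
  - by rewrite vertex0; exact: proj_up.
  - by apply: near erefl _; rewrite mulr0 mul0r subr0 ltr_norml; apply/andP; split; lra.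
  have [] := half (pi / 3 + corner_angle) (0%N, a, 1).
  - by rewrite vertex1; exact: proj_up'.
  - by apply: near erefl _; rewrite mulr1 ltr_norml; apply/andP; split; lra.
  by rewrite /= add0r.
case: a in_sector => [|a] in_sector; last exact: in_sector.
exists (- (pi / 3) + corner_angle).
have [] := half (- (pi / 3) + corner_angle) (0%N, b.+1, 0).
- by rewrite vertex0; exact: proj_down.
- by apply: near erefl _; rewrite mulr0 mul0r subr0 ltr_norml; apply/andP; split; lra.
have [] := half (- (pi / 3) + corner_angle) (b, 0%N, -1).
- by rewrite vertexN1; exact: proj_down'.
- by apply: near erefl _; rewrite mulrN1 ltr_norml; apply/andP; split; lra.
by rewrite /= add0r.
Qed.

Lemma rdir_lt k (i : 'I_3) : (rdir k i < 3)%N.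
Proof. by rewrite /rdir; lia. Qed.

Lemma vertex_step st i : vertex (step st i) = vertex st + om ^+ i.
Proof.
case: st => [[a b] k]; rewrite /step sector_move_shift /= vertex_rot -!surjective_pairing.
by rewrite vertex_sector_move0 ?rdir_lt // mulrDr rot_rdir.
Qed.

Lemma step_half_plane st (i : 'I_3) : exists f,
  [/\ 0 < proj f (vertex st), 0 < proj f (vertex st + om ^+ i),
      argd f (vertex st) = ang st & argd f (vertex st + om ^+ i) = ang (step st i)].
Proof.
rewrite -vertex_step; case: st => [[a b] k]; rewrite /step -[(a, b, k).2]/k sector_move_shift.
have [f] := sector_move_half_plane a b (rdir_lt k i).
case: (sector_move (a, b, 0) _) => [[a' b'] k'] [f1 f2 f3 f4].
rewrite -[let st := _ in _]/(a', b', k + k').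
exists (2 * pi * k%:~R / 3 + f); rewrite vertex_rot -(addr0 k) (vertex_rot a b) (ang_rot a b).
rewrite !addr0 ang_rot /rot !proj_rot !argd_rot.
by rewrite f3 f4.
Qed.

(** The two pieces are run one after the other, each being frozen
    while the other moves. *)
Lemma continuous_splice (f g : R -> R) c d : continuous f -> continuous g ->
  continuous (fun u => f (Num.min u c) + (g (Num.max (u - c) 0) - d)).
Proof.
move=> cf cg u; apply: cvgD.
  apply: (@continuous_comp _ _ _ (fun u => Num.min u c) f); last exact: cf.
  rewrite (_ : (fun u => _) = (fun u : R => u) \min (fun=> c)); last exact/funext.
  by apply: continuous_min => //; exact: cst_continuous.
apply: cvgB; last exact: cvg_cst.
apply: (@continuous_comp _ _ _ (fun u => Num.max (u - c) 0) g); last exact: cg.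
rewrite (_ : (fun u => _) = (fun u : R => u - c) \max (fun=> 0)); last exact/funext.
apply: continuous_max; last exact: cst_continuous.
by apply: cvgB; [exact: cvg_id | exact: cvg_cst].
Qed.

Lemma walk_arg st0 (w : seq 'I_3) : exists th : R -> R,
  [/\ continuous th, th 0 = ang st0, th (size w)%:R = ang (run st0 w)
    & forall j (x : R), (j < size w)%N -> 0 <= x <= 1 ->
        is_arg (edge (vertex (run st0 (take j w))) (om ^+ nth ord0 w j) x) (th (j%:R + x))].
Proof.
elim/last_ind: w => [|w i [th [cth th0 thn hth]]].
  by exists (fun=> ang st0); split => // ?; exact: cst_continuous.
have [f [f1 f2 f3 f4]] := step_half_plane (run st0 w) i.
have [g [cg g0 g1 hg]] := edge_arg f1 f2.
set n := size w in thn hth *.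
(* g does not move before time n, and th is frozen after time n *)
pose F (u : R) := th (Num.min u n%:R) + (g (Num.max (u - n%:R) 0) - g 0).
have Fl (u : R) : u <= n%:R -> F u = th u.
  by move=> un; rewrite /F (min_idPl un) (max_idPr _) ?subr_le0 // subrr addr0.
have Fr (u : R) : 0 <= u -> F (n%:R + u) = g u.
  move=> u0; rewrite /F (min_idPr _) ?lerDl // [n%:R + u]addrC addrK (max_idPl u0) thn g0 -f3.
  by rewrite addrC subrK.
exists F; rewrite size_rcons /run foldl_rcons -/(run st0 w); split.
- exact: continuous_splice.
- by rewrite Fl ?ler0n.
- by rewrite -natr1 Fr // g1 f4.
move=> j x; rewrite ltnS leq_eqVlt => /orP[/eqP-> | jn] hx.
  rewrite -cats1 take_size_cat // nth_cat ltnn subnn /= Fr ?(andP hx).1 //.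
  exact: hg.
rewrite nth_rcons jn -cats1 take_cat jn Fl; first exact: hth.
by apply: le_trans (_ : j.+1%:R <= _); [rewrite -natr1 lerD2l (andP hx).2 | rewrite ler_nat].
Qed.

Lemma vertex_run st0 n (w : n.-tuple 'I_3) j : (j <= n)%N ->
  walk_vertex (vertex st0) w j = vertex (run st0 (take j w)).
Proof.
elim: j => [|j IH] hj; first by rewrite take0 /walk_vertex big1 ?addr0.
have jn : (j < size w)%N by rewrite size_tuple.
rewrite (take_nth ord0 jn) /run foldl_rcons -/(run st0 (take j w)) vertex_step -IH; last exact: ltnW.
rewrite /walk_vertex -addrA; congr (_ + _).
rewrite (bigD1 (Ordinal hj)) //= addrC (tnth_nth ord0); congr (_ + _).
by apply: eq_bigl => i; rewrite ltnS -val_eqE /=; case: ltngtP.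
Qed.

Lemma winding_number_run st0 n (w : n.-tuple 'I_3) :
  sector (run st0 w).1.1 (run st0 w).1.2 = sector st0.1.1 st0.1.2 ->
  winding_number (vertex st0) w = (run st0 w).2 - st0.2.
Proof.
move=> e; have [th [cth th0 thn hth]] := walk_arg st0 w.
rewrite size_tuple in thn hth.
have edgeE (j : 'I_n) x : edge (vertex (run st0 (take j w))) (om ^+ nth ord0 w j) x
    = edge (walk_vertex (vertex st0) w j) (om ^+ tnth w j) x.
  by rewrite vertex_run ?(tnth_nth ord0) // ltnW.
have hth' (j : 'I_n) x : 0 <= x <= 1 ->
    is_arg (edge (walk_vertex (vertex st0) w j) (om ^+ tnth w j) x) (th (j%:R + x)).
  by rewrite -edgeE; exact: hth.
have wE : th n%:R - th 0 = 2 * pi * ((run st0 w).2 - st0.2)%:~R / 3.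
  by rewrite th0 thn /ang e intrB; ring.
rewrite /winding_number; case: xgetP => [k _ hk|/(_ ((run st0 w).2 - st0.2))[]].
  have := winding_unique cth hth' hk; rewrite wE => ek.
  have : k%:~R = ((run st0 w).2 - st0.2)%:~R :> R.
    by have p0 := pi_gt0 R; apply: (mulfI (_ : 2 * pi / 3 != 0 :> R)); [rewrite gt_eqF //; lra | move: ek; lra].
  by move/intr_inj.
exists th; split=> //; first exact: continuous_subspaceT.
by move=> j x hx; apply: is_arg_norm; exact: hth'.
Qed.

Definition normsq z : R := Re z ^+ 2 + Im z ^+ 2.

Lemma ler_normsq z z' : (`|z| <= `|z'|) = (normsq z <= normsq z').
Proof. by rewrite !normc_def lecR ler_sqrt // addr_ge0 ?sqr_ge0. Qed.

Definition lattice_point (a b : int) : R[i] :=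
  (a%:~R - b%:~R / 2 - 1 / 2) +i* ((b%:~R - 1 / 3) * h).

Lemma intc (m : int) : m%:~R = m%:~R +i* 0 :> R[i].
Proof. by rewrite -(rmorph_int (real_complex R)). Qed.

Lemma lattice_vertexP z : lattice_vertex z <-> exists a b, z = lattice_point a b.
Proof.
have E a b : - ((2 + om) / 3) + (a%:~R + b%:~R * om) = lattice_point a b.
  have -> : (2 + om) / 3 = (1 / 2) +i* (h / 3).
    rewrite omE; apply: (mulIf (_ : 3 != 0 :> R[i])); first by rewrite pnatr_eq0.
    by rewrite divfK ?pnatr_eq0 //; apply: complex_ext => /=; lra.
  by rewrite omE !intc /lattice_point; apply: complex_ext => /=; lra.
by split=> -[a [b ->]]; exists a, b; rewrite E.
Qed.

Lemma normsq_lattice a b :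
  normsq (lattice_point a b) = (a * a - a * b + b * b - a)%:~R + 1 / 3.
Proof.
rewrite /normsq /lattice_point /= !(rmorphD, rmorphB, rmorphM) /=.
rewrite [(_ * h) ^+ 2]exprMn [h ^+ 2]om_coord.2.
by field.
Qed.

Lemma lattice_formE (a b : int) : 4 * (a * a - a * b + b * b - a) =
  (2 * a - b - 1) * (2 * a - b - 1) + (3 * b + 1) * (b - 1).
Proof. by ring. Qed.

Lemma lattice_form_ge0 (a b : int) : 0 <= a * a - a * b + b * b - a.
Proof.
have [->|b0] := eqVneq b 0; first by nia.
have Y0 : 0 <= (3 * b + 1) * (b - 1) by nia.
rewrite -(pmulr_rge0 _ (_ : 0 < 4)) // lattice_formE addr_ge0 // -expr2 sqr_ge0 //.
Qed.

Lemma lattice_form_eq0 (a b : int) : a * a - a * b + b * b - a = 0 ->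
  [|| (a == 0) && (b == 0), (a == 1) && (b == 0) | (a == 1) && (b == 1)].
Proof.
move=> e.
have [b0|b0] := eqVneq b 0; first by rewrite b0 in e *; nia.
have [b1|b1] := eqVneq b 1; first by rewrite b1 in e *; nia.
have Y0 : 0 < (3 * b + 1) * (b - 1) by nia.
have := lattice_formE a b; rewrite e mulr0 => /esym/eqP.
by rewrite gt_eqF // ltr_wpDl // -expr2 sqr_ge0.
Qed.

(** The squared norms of the lattice points are 1/3 plus a^2 - a b + b^2 - a,
    a nonnegative integer that vanishes for three pairs only. *)
Lemma closest_vertexP z :
  closest_vertex z <-> lattice_vertex z /\ normsq z = 1 / 3.
Proof.
have min a b : 1 / 3 <= normsq (lattice_point a b).
  by rewrite normsq_lattice lerDr ler0z; exact: lattice_form_ge0.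
split=> -[lz nz]; split=> //.
  have := nz (lattice_point 0 0); rewrite ler_normsq normsq_lattice.
  have := lz; case/lattice_vertexP=> a [b ez]; have := min a b; rewrite -ez => m1 m2.
  have l0 : lattice_vertex (lattice_point 0 0) by apply/lattice_vertexP; exists 0, 0.
  by apply: le_anti; rewrite m1 andbT; have := m2 l0; rewrite (_ : 0 * 0 - 0 * 0 + 0 * 0 - 0 = 0 :> int) // mulr0z add0r.
move=> z' /lattice_vertexP[a [b ->]]; rewrite ler_normsq nz; exact: min.
Qed.

Lemma closest_vertex_start z : closest_vertex z ->
  exists k : int, z = vertex (0%N, 0%N, k).
Proof.
case/closest_vertexP=> /lattice_vertexP[a [b ->]]; rewrite normsq_lattice => e.
have {}e : a * a - a * b + b * b - a = 0.
  by apply/eqP; rewrite -(intr_eq0 R); apply/eqP; move: e; lra.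
have s0 : sector 0 0 = corner by rewrite /sector mul0r !addr0.
case/or3P: (lattice_form_eq0 e)=> /andP[/eqP -> /eqP ->].
- exists 2; rewrite /vertex /= s0 rot_nat om2_corner cornerE /lattice_point.
  by apply: complex_ext => /=; lra.
- exists 0; rewrite /vertex /= s0 rot0 mul1r cornerE /lattice_point.
  by apply: complex_ext => /=; lra.
exists 1; rewrite /vertex /= s0 rot1 om_corner cornerE omE /lattice_point.
by apply: complex_ext => /=; lra.
Qed.

Lemma lattice_vertex_step z i : lattice_vertex z -> (i < 3)%N -> lattice_vertex (z + om ^+ i).
Proof.
case=> a [b ->]; case: i => [|[|[|//]]] _.
- by exists (a + 1), b; rewrite rmorphD; ring.
- by exists a, (b + 1); rewrite rmorphD; ring.
by exists (a - 1), (b - 1); rewrite om_sum !rmorphB; ring.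
Qed.

Lemma lattice_vertex_run st0 (w : seq 'I_3) :
  lattice_vertex (vertex st0) -> lattice_vertex (vertex (run st0 w)).
Proof.
move=> l0; elim/last_ind: w => [//|w i IH].
by rewrite /run foldl_rcons -/(run st0 w) vertex_step; exact: lattice_vertex_step.
Qed.

Lemma normsq_vertex st : normsq (vertex st) =
  (st.1.1 * st.1.1 + st.1.2 * st.1.2 + st.1.1)%:R - (st.1.1 * st.1.2)%:R + 1 / 3.
Proof.
case: st => [[a b] k]; rewrite /normsq /vertex /rot /= sectorE /=.
set c := cos _; set s := sin _; set x : R := _ + 1 / 2; set y : R := - _ - _.
transitivity ((c ^+ 2 + s ^+ 2) * (x ^+ 2 + y ^+ 2)); first by ring.
rewrite cos2Dsin2 mul1r /x /y !natrD !natrM.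
move: (a%:R) (b%:R) (h_sq) => u v e.
rewrite (_ : (- (h / 3) - v * h) ^+ 2 = (1 / 3 + v) ^+ 2 * (h * h)); last by field.
by rewrite e; field.
Qed.

(** The squared norm of the vertex (a, b, k) is 1/3 plus a^2 - a b + b^2 + a,
    which vanishes for a = b = 0 only. *)
Lemma closest_run st0 (w : seq 'I_3) : lattice_vertex (vertex st0) ->
  closest_vertex (vertex (run st0 w)) <-> ((run st0 w).1.1 = 0%N /\ (run st0 w).1.2 = 0%N).
Proof.
move=> l0; rewrite closest_vertexP normsq_vertex; set a := _.1.1; set b := _.1.2.
split=> [[_ e]|[-> ->]]; last by split; [exact: lattice_vertex_run | rewrite !mul0n addn0 subrr add0r].
have : (a * a + b * b + a = a * b)%N.
  by apply/eqP; rewrite -(eqr_nat R); apply/eqP; move: e; lra.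
by split; nia.
Qed.

End Geometry.

(** * The theorem *)

Lemma E_gsum (R : realType) (k : int) : closest_vertex (vertex R (0%N, 0%N, k)) ->
  E (vertex R (0%N, 0%N, k)) = gsum (wF svar (0%N, 0%N, k)) (ps_var Qs) 0.
Proof.
set st0 := (0%N, 0%N, k); move=> /closest_vertexP[l0 _].
rewrite gsum_wF_0 -[E _]pscomp_id pscompE; apply: eq_asum => n; congr (ac _ * _).
rewrite /=; apply: eq_big => [w|w /asboolP].
  have := @closest_run R st0 w l0; rewrite vertex_run // take_oversize ?size_tuple // => h.
  apply/asboolP/andP => [/h[-> ->] //|[/eqP a0 /eqP b0]]; exact/h.
rewrite vertex_run // take_oversize ?size_tuple // => /(closest_run _ l0) [a0 b0].
by rewrite winding_number_run // a0 b0.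
Qed.
Local Close Scope classical_set_scope.

Theorem theorem1 (R : realType) :
  (exists! q : powser rat, is_q q) /\
  (forall q : powser rat, is_q q ->
     (exists h : powser rat,
        q = ps_var rat ^+ 3 + 15%:R * ps_var rat ^+ 6 + 279%:R * ps_var rat ^+ 9
            + ps_var rat ^+ 10 * h) /\
     (forall (r : powser rat) (w0 : R[i]), is_cbrt q r -> closest_vertex w0 ->
        let q1 := QtoL q in
        let q3 := QtoL r in
        (E w0)%:L =
          sL / ((1 - sL ^+ 3) * tL)
          * (sL
             - q3^-1 * (T 1 (q1 ^+ 2) (q1 ^+ 3) / T 1 1 (q1 ^+ 3))
             - q3^-1 * ((T 0 q1 (q1 ^+ 3) * T 1 (sL * q3 ^- 2) q1)
                        / (T 1 1 (q1 ^+ 3) * T 0 (sL * q3 ^- 2) q1))))).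
Proof.
split; first exact: exists_unique_q.
move=> q hq; split; first exact: q_expansion.
move=> r w0 hr hw q1 q3; have [k ew] := closest_vertex_start hw.
rewrite ew in hw *; rewrite (E_gsum hw).
have [r' hr' [er' eq']] := (is_qP q).1 hq.
have er : r = r'.
  apply: is_cbrt_unique hr _; have [r0 r1] := nome_coef hr' er'.
  by split.
have hv := @psQ_vge 1 r' hr'.
apply: (closed_form (st0 := (0%N, 0%N, k)) erefl hv); first exact/psQ_nome.
  by rewrite /q1 QtoLE eq' rmorphXn.
by rewrite /q3 QtoLE er.
Qed.
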